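(* Suppose that either $N=3$ and $D$ is a negative fundamental discriminant with $D\geq-24$, or $N=4$ and $D\in\{-3,-4\}$. Let $\Gamma=\mathrm{GL}_N(\mathcal{O}_D)$. Then the chain $$\xi=\xi_{N,D}=\sum_{\sigma\in\Sigma_{N^2-1}(\Gamma)}\frac{1}{|\mathrm{Stab}(\sigma)|}\,[\sigma]\ \in\ V_{N^2-1}(\Gamma)\otimes\mathbb{Q}$$ is a cycle, and thus generates $H_{N^2-1}(\mathrm{Vor}_{N,D}\otimes\mathbb{Q})$.
   Context: Let $F$ be the imaginary quadratic field of discriminant $D<0$, with ring of integers $\mathcal{O}=\mathcal{O}_D$ and a fixed embedding $F\hookrightarrow\mathbb{C}$; $\Gamma=\mathrm{GL}_N(\mathcal{O})$. Cell decomposition. $\mathcal{H}^N(\mathbb{C})$ is the $N^2$-dimensional real vector space of $N\times N$ Hermitian matrices. For $x\in\mathcal{O}^N$ (column vectors) put $q(x)=xx^*$, where $*$ is conjugate transpose; for a Hermitian matrix $A$ put $A[x]=x^*Ax$. Let $C_N\subset\mathcal{H}^N(\mathbb{C})$ be the cone of positive definite matrices. For $A\in C_N$ let $m(A)=\min_{x\in\mathcal{O}^N\setminus\{0\}}A[x]$ and $M(A)=\{v\in\mathcal{O}^N: A[v]=m(A)\}$ (a finite set). $A$ is a perfect Hermitian form over $F$ if $\{q(v):v\in M(A)\}$ spans $\mathcal{H}^N(\mathbb{C})$ over $\mathbb{R}$. Let $C_N^*$ be the set of nonzero positive semidefinite Hermitian matrices whose kernel is spanned by vectors of $F^N\subset\mathbb{C}^N$.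 $\mathrm{GL}_N(\mathcal{O})$ acts on $C_N^*$ by $g\cdot A=gAg^*$. Let $\pi:C_N^*\to X_N^*=C_N^*/\mathbb{R}_{>0}$ be the quotient by positive homotheties, and $X_N=\pi(C_N)$. For a finite set $M\subset\mathcal{O}^N\setminus\{0\}$ the perfect cone of $M$ is the set of nonzero matrices $\sum_{v\in M}\lambda_v q(v)$ with $\lambda_v\geq 0$ (or its image in $X_N^*$). For $A$ perfect let $\sigma(A)\subset X_N^*$ be the perfect cone of $M(A)$. The sets $\sigma(A)$, $A$ perfect, and their intersections are the cells of a $\Gamma$-invariant cell decomposition of $X_N^*$; the dimension of a cell is the dimension of the real span of the corresponding cone in $\mathcal{H}^N(\mathbb{C})$ minus $1$, and an orientation of a cell is an orientation of that real span. Voronoi complex. $\Sigma_n^*=\Sigma_n^*(\Gamma)$ is a finite set of representatives modulo $\Gamma$ of the $n$-dimensional cells of $X_N^*$ that meet $X_N$. A cell $\sigma$ is orientable if every element of its stabilizer $\mathrm{Stab}(\sigma)\subset\Gamma$ preserves its orientation; $\Sigma_n=\Sigma_n(\Gamma)\subset\Sigma_n^*$ is the subset of orientable cells (all cells in $\Sigma_{N^2-1}^*$ are orientable). Each cell is given an orientation. $V_n(\Gamma)$ is the free abelian group on $\Sigma_n$ (the generator of $\sigma$ being written $[\sigma]$), and $d_n:V_n(\Gamma)\to V_{n-1}(\Gamma)$ is $$d_n(\sigma)=\sum_{\tau\in\Sigma_{n-1}}\ \sum_{\tau'}\eta(\tau,\tau')\,\varepsilon(\tau',\sigma)\,\tau,$$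 where $\tau'$ runs over the codimension-one faces of $\sigma$ that are $\Gamma$-equivalent to $\tau$; $\eta(\tau,\tau')=\pm1$ according to whether $\gamma\in\Gamma$ with $\gamma\tau=\tau'$ preserves or reverses the chosen orientations; and $\varepsilon(\tau',\sigma)=\pm1$ is the sign, in the oriented span of $\sigma$, of the basis obtained by appending to a positive basis of the span of $\tau'$ a vector of the cone of $\sigma$ not in the cone of $\tau'$. The Voronoi complex is $\mathrm{Vor}_{N,D}=(V_*(\Gamma),d_* )$.
   Formalization: The orientations of the top-dimensional representative cells are not arbitrary: they are all required to come from one common orientation of the space of Hermitian matrices, since with independently chosen orientations the chain is not a cycle once there are two classes of perfect forms. *)

(* Defs.v *)
From HB Require Import structures.
From mathcomp Require Import all_boot all_order all_algebra.
From mathcomp Require Import finmap complex.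
From mathcomp Require Import all_classical all_reals.

Set Implicit Arguments.
Unset Strict Implicit.
Unset Printing Implicit Defensive.

Import Order.TTheory GRing.Theory Num.Theory.

Local Open Scope classical_set_scope.
Local Open Scope ring_scope.
Local Open Scope complex_scope.
Local Open Scope sesquilinear_scope.

Definition squarefree (m : int) : Prop :=
  forall p : nat, prime p -> ~~ (p ^ 2 %| `|m|)%N.

Definition fundamental_discriminant (D : int) : Prop :=
  [/\ (D = 1 %[mod 4])%Z, squarefree D & D != 1]
  \/ exists m : int, [/\ D = 4 * m,
       (m = 2 %[mod 4])%Z \/ (m = 3 %[mod 4])%Z & squarefree m].

Section VoronoiComplex.
Variables (R : realType) (D : int) (N : nat).
Local Notation C := R[i].

(* For D a negative fundamental discriminant, Q(sqrt D) is the imaginary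
   quadratic field of discriminant D, here as a subfield of C. *)
Definition quadfield : set C :=
  [set z | exists a b : rat, z = ratr a + ratr b * sqrtC D%:~R].

Definition ringint : set C :=
  [set z | quadfield z /\ integralOver (intr : int -> C) z].

Definition intmx (m n : nat) : set 'M[C]_(m, n) :=
  [set A | forall i j, ringint (A i j)].

Definition Gamma : set 'M[C]_N :=
  [set g | [/\ g \in unitmx, intmx g & intmx (invmx g)]].

Definition gact (g A : 'M[C]_N) : 'M[C]_N := g *m A *m g^t*.

Definition q (x : 'cV[C]_N) : 'M[C]_N := x *m x^t*.

Definition hform (A : 'M[C]_N) (x : 'cV[C]_N) : C := (x^t* *m A *m x) 0 0.

Definition posdef : set 'M[C]_N :=
  [set A | A \is hermsymmx /\ forall x : 'cV[C]_N, x != 0 -> 0 < hform A x].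

(* For A positive definite the infimum is attained. *)
Definition minform (A : 'M[C]_N) : R :=
  inf [set complex.Re (hform A x) | x in @intmx N 1 `\ 0].

Definition minvec (A : 'M[C]_N) : set 'cV[C]_N :=
  [set v | intmx v /\ hform A v = (minform A)%:C].

(* 'M[C]_N is canonically a vector space over C only; real linear algebra is
   done after this R-linear isomorphism onto a vector space over R. *)
Definition reim (A : 'M[C]_N) : 'M[R]_N * 'M[R]_N :=
  (map_mx (@complex.Re R) A, map_mx (@complex.Im R) A).

Local Notation HR := ('M[R]_N * 'M[R]_N)%type.

(* The smallest real subspace containing S. *)
Definition rspan (S : set 'M[C]_N) : {vspace HR} :=
  let contains (U : {vspace HR}) := forall A, S A -> reim A \in U in
  xget 0%VS
    [set U | contains U /\ forall W, contains W -> (U <= W)%VS].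

Definition perfect (A : 'M[C]_N) : Prop :=
  posdef A /\ rspan (q @` minvec A) = rspan [set B | B \is hermsymmx].

Definition perfect_cone (M : set 'cV[C]_N) : set 'M[C]_N :=
  [set B | B != 0 /\ exists2 lambda : 'cV[C]_N -> R,
     forall v, 0 <= lambda v & B = \sum_(v \in M) (lambda v)%:C *: q v].

(* A subset of C_N^* / R_{>0} is represented by its preimage in C_N^*, a set of
   nonzero matrices stable under positive homotheties. *)
Definition is_cell (c : set 'M[C]_N) : Prop :=
  exists P : set 'M[C]_N, [/\ P !=set0, P `<=` perfect &
    c = \bigcap_(A in P) perfect_cone (minvec A)].

Definition inner_cell (n : nat) (c : set 'M[C]_N) : Prop :=
  [/\ is_cell c, \dim (rspan c) = n.+1 & c `&` posdef !=set0].

Definition cell_equiv (c c' : set 'M[C]_N) : Prop :=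
  exists2 g, Gamma g & gact g @` c = c'.

Definition cell_reps (n : nat) (S : {fset set 'M[C]_N}) : Prop :=
  (forall c, c \in S -> inner_cell n c) /\
  (forall c, inner_cell n c -> exists! t, t \in S /\ cell_equiv t c).

Definition stab (c : set 'M[C]_N) : set 'M[C]_N :=
  [set g | Gamma g /\ gact g @` c = c].

Definition rbasis (c : set 'M[C]_N) (b : seq 'M[C]_N) : Prop :=
  basis_of (rspan c) (map reim b).

(* The sign of the determinant of the family b' in the real basis b. *)
Definition rsign (b b' : seq 'M[C]_N) : int :=
  let u := map reim b in
  sgz (\det (\matrix_(i < size u, j < size u)
               coord (in_tuple u) j (reim b'`_i))).

Definition orientable (c : set 'M[C]_N) : Prop :=
  forall b, rbasis c b -> forall g, stab c g -> rsign b (map (gact g) b) = 1.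

Definition facets (c : set 'M[C]_N) : set (set 'M[C]_N) :=
  [set t | [/\ is_cell t, t `<=` c & (\dim (rspan t)).+1 = \dim (rspan c)]].

Section Complex.
(* Sstar n is the finite set of representatives of the n-dimensional cells and
   o c is a positive basis of the real span of the cell c. *)
Variables (Sstar : nat -> {fset set 'M[C]_N}).
Variables (o : set 'M[C]_N -> seq 'M[C]_N).

Definition Sigma (n : nat) : {fset set 'M[C]_N} :=
  [fset c in Sstar n | `[< orientable c >]]%fset.

(* The value does not depend on the element of Gamma chosen by xget when t is
   orientable. *)
Definition eta (t t' : set 'M[C]_N) : int :=
  let g := xget 1%:M [set g | Gamma g /\ gact g @` t = t'] in
  rsign (o t') (map (gact g) (o t)).

(* The value does not depend on the vector chosen by xget when t' is a facet
   of s. *)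
Definition epsilon (t' s : set 'M[C]_N) : int :=
  rsign (o s) (rcons (o t') (xget 0 (s `\` t'))).

Definition incidence (t s : set 'M[C]_N) : int :=
  \sum_(t' \in facets s `&` [set t' | cell_equiv t t'])
    eta t t' * epsilon t' s.

(* V_n(Gamma) is the case K = int, and V_n(Gamma) (x) Q the case K = rat. *)
Definition chains (K : comNzRingType) (n : nat) := {ffun Sigma n -> K^o}.

(* The boundary d_n. A facet has dimension one less than its cell, so d_0 is
   the zero map. *)
Definition boundary (K : comNzRingType) (n : nat) (x : chains K n) :
    chains K n.-1 :=
  [ffun t : Sigma n.-1 =>
     \sum_(s : Sigma n) x s * (incidence (val t) (val s))%:~R].

Definition is_cycle (K : comNzRingType) (n : nat) (x : chains K n) : Prop :=
  boundary x = 0.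

(* x is a cycle whose class generates ker d_n / im d_(n+1) over K. *)
Definition generates_homology (K : comNzRingType) (n : nat)
    (x : chains K n) : Prop :=
  is_cycle x /\ forall z : chains K n, is_cycle z ->
    exists (a : K) (w : chains K n.+1), z = a *: x + boundary w.

Definition xi : chains rat (N ^ 2)%N.-1 :=
  [ffun s : Sigma (N ^ 2)%N.-1 => (#|` fset_set (stab (val s))|%:R)^-1].

End Complex.

End VoronoiComplex.

(* Main.v *)
(* Scale perfect forms to have minimum 1. A cell of codimension one is an
   intersection of at least two perfect cones; the forms whose cones contain it
   lie on a line, and of three of them the middle one would not be perfect, so it
   is a wall between exactly two top-dimensional cones, lying on opposite sides.
   Elements of Gamma preserve the orientation of the space of Hermitian forms.
   Counting the pairs (wall, cone) modulo Gamma therefore shows that the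
   coefficient in the boundary of z of an orientable wall t between s0 and s1 is,
   up to sign, (z(s0) |Stab s0| - z(s1) |Stab s1|) / |Stab t|, where z is extended
   to all top-dimensional cones by Gamma-invariance. This vanishes for xi. If z is
   a cycle, z(s) |Stab s| thus takes the same value on two cones adjacent along an
   inner wall; when the wall is not orientable the two cones are equivalent.
   Finally, any two perfect cones are joined by a chain of cones adjacent along
   inner walls: Voronoi's algorithm, which is the simplex method for minimising
   the sum of A[v] over the minimal vectors v of B, among the forms A that are at
   least 1 on the nonzero lattice vectors, leads from any perfect form to B. *)

(* Face theory of polyhedral cones is replaced by comparing linear functionals. On the cone of a
   normalised form [B], pairing with [B] gives at most the pairing with any other normalised form
   [A], with equality exactly on the cone of the common minimal vectors. Intersections, walls and
   their two sides are read off from this, and the difference of the two forms is a normal vector of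
   the wall. The signs in the boundary involve a chosen element of Gamma, a chosen vector off the
   wall and real coordinates on complex matrices. They become comparable once a basis of the wall is
   completed by one vector and measured by the single determinant [volume]; the choices then enter
   only through the side on which a vector lies. Finiteness of the set of classes of perfect forms
   is supplied by the finite sets [Sstar n], and makes the descent in Voronoi's algorithm terminate.
   That the walls crossed on the way meet the positive definite matrices, so that the cycle
   condition applies to them, comes from the strict decrease of the objective. *)
From HB Require Import structures.
Require Import Defs.
From mathcomp Require Import all_boot all_order all_algebra.
From mathcomp Require Import finmap complex.
From mathcomp Require Import all_classical all_reals.
From mathcomp Require Import ring lra zify.

Set Implicit Arguments.
Unset Strict Implicit.
Unset Printing Implicit Defensive.

Import Order.TTheory GRing.Theory Num.Theory.
Local Open Scope ring_scope.
Local Open Scope complex_scope.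
Local Open Scope sesquilinear_scope.
Local Open Scope classical_set_scope.

(** * Hermitian matrices as a real vector space *)

Section ComplexReal.
Variable R : realType.
Implicit Types (x y : R[i]) (r : R).

Lemma ReD x y : complex.Re (x + y) = complex.Re x + complex.Re y.
Proof. by case: x y => [a b] []. Qed.

Lemma ImD x y : complex.Im (x + y) = complex.Im x + complex.Im y.
Proof. by case: x y => [a b] []. Qed.

Lemma ReN x : complex.Re (- x) = - complex.Re x.
Proof. by case: x. Qed.

Lemma ImN x : complex.Im (- x) = - complex.Im x.
Proof. by case: x. Qed.

Lemma Re_sum (I : Type) (s : seq I) (P : pred I) (F : I -> R[i]) :
  complex.Re (\sum_(i <- s | P i) F i) = \sum_(i <- s | P i) complex.Re (F i).
Proof. exact: (big_morph _ ReD). Qed.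

Lemma ReZ r x : complex.Re (r%:C * x) = r * complex.Re x.
Proof. by case: x => a b /=; rewrite mul0r subr0. Qed.

Lemma ImZ r x : complex.Im (r%:C * x) = r * complex.Im x.
Proof. by case: x => a b /=; rewrite mul0r addr0. Qed.

Lemma ReC_conj x : complex.Re x^*%R = complex.Re x.
Proof. by case: x. Qed.

Lemma ImC_conj x : complex.Im x^*%R = - complex.Im x.
Proof. by case: x. Qed.

Lemma ReM_conj x y :
  complex.Re (x * y^*%R) =
  complex.Re x * complex.Re y + complex.Im x * complex.Im y.
Proof. by case: x y => [a b] [c d] /=; rewrite mulrN opprK. Qed.

Lemma complex_inj x y :
  complex.Re x = complex.Re y -> complex.Im x = complex.Im y -> x = y.
Proof. by case: x y => [a b] [c d] /= -> ->. Qed.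

Lemma conj_RealC r : (r%:C)^*%R = r%:C.
Proof. by rewrite -[LHS]/((r%:C)^*) /= oppr0. Qed.

Lemma conj_eqRe x : x^*%R = x -> x = (complex.Re x)%:C.
Proof.
case: x => a b [] /eqP; rewrite eq_sym -addr_eq0 -mulr2n mulrn_eq0 /=.
by move/eqP->.
Qed.

End ComplexReal.

(* The value A[x], which is real when [A] is Hermitian. *)
HB.lock Definition hf (R : realType) (N : nat) (A : 'M[R[i]]_N)
  (x : 'cV[R[i]]_N) : R := complex.Re (hform A x).

Section HermitianForms.
Variables (R : realType) (N : nat).
Implicit Types (A B G : 'M[R[i]]_N) (x v : 'cV[R[i]]_N) (r : R).

Lemma trmxCM m n p (A : 'M[R[i]]_(m, n)) (B : 'M[R[i]]_(n, p)) :
  (A *m B)^t* = B^t* *m A^t*.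
Proof. by rewrite trmx_mul map_mxM. Qed.

Lemma trmxCK m n (A : 'M[R[i]]_(m, n)) : (A^t*)^t* = A.
Proof. by apply/matrixP=> i j; rewrite !mxE conjCK. Qed.

Lemma trmxCD m n (A B : 'M[R[i]]_(m, n)) : (A + B)^t* = A^t* + B^t*.
Proof. by apply/matrixP=> i j; rewrite !mxE rmorphD. Qed.

Lemma trmxCZ m n r (A : 'M[R[i]]_(m, n)) : (r%:C *: A)^t* = r%:C *: A^t*.
Proof. by apply/matrixP=> i j; rewrite !mxE rmorphM /= conj_RealC. Qed.

Lemma hermP A : A \is hermsymmx <-> A^t* = A.
Proof.
split=> [/is_hermitianmxP|hA]; first by rewrite expr0 scale1r.
by apply/is_hermitianmxP; rewrite expr0 scale1r hA.
Qed.

Lemma hermD A B : A \is hermsymmx -> B \is hermsymmx -> A + B \is hermsymmx.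
Proof. by move=> /hermP hA /hermP hB; apply/hermP; rewrite trmxCD hA hB. Qed.

Lemma hermZ r A : A \is hermsymmx -> r%:C *: A \is hermsymmx.
Proof. by move=> /hermP hA; apply/hermP; rewrite trmxCZ hA. Qed.

Lemma herm0 : (0 : 'M[R[i]]_N) \is hermsymmx.
Proof. by apply/hermP/matrixP=> i j; rewrite !mxE conjC0. Qed.

Lemma scaleCN1 (V : lmodType R[i]) (A : V) : - A = (-1 : R)%:C *: A.
Proof. by rewrite rmorphN rmorph1 scaleN1r. Qed.

Lemma hermB A B : A \is hermsymmx -> B \is hermsymmx -> A - B \is hermsymmx.
Proof. by move=> hA hB; rewrite scaleCN1; apply/hermD/hermZ. Qed.

Lemma herm_sum (I : Type) (s : seq I) (P : pred I) (F : I -> 'M[R[i]]_N) :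
  (forall i, P i -> F i \is hermsymmx) -> \sum_(i <- s | P i) F i \is hermsymmx.
Proof.
move=> hF; elim/big_rec: _ => [|i A Pi hA]; first exact: herm0.
exact: (hermD (hF _ Pi) hA).
Qed.

Lemma herm_q v : q v \is hermsymmx.
Proof. by apply/hermP; rewrite /q trmxCM trmxCK. Qed.

Lemma herm_gact (g : 'M[R[i]]_N) A : A \is hermsymmx -> gact g A \is hermsymmx.
Proof.
by move=> /hermP hA; apply/hermP; rewrite /gact !trmxCM trmxCK hA mulmxA.
Qed.

Lemma hfE A x : hf A x = complex.Re (hform A x).
Proof. by rewrite hf.unlock. Qed.

Lemma hformE A x : A \is hermsymmx -> hform A x = (hf A x)%:C.
Proof.
move=> /hermP hA; rewrite hfE; apply: conj_eqRe.
have : (x^t* *m A *m x)^t* = x^t* *m A *m x.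
  by rewrite !trmxCM trmxCK hA mulmxA.
by move/matrixP/(_ 0 0); rewrite mxE [X in _ -> _ = X]/hform => <-; rewrite mxE.
Qed.

Lemma hformD A B x : hform (A + B) x = hform A x + hform B x.
Proof. by rewrite /hform mulmxDr mulmxDl mxE. Qed.

Lemma hformZ c A x : hform (c *: A) x = c * hform A x.
Proof. by rewrite /hform -scalemxAr -scalemxAl mxE. Qed.

Lemma hfD A B x : hf (A + B) x = hf A x + hf B x.
Proof. by rewrite !hfE hformD ReD. Qed.

Lemma hfZ r A x : hf (r%:C *: A) x = r * hf A x.
Proof. by rewrite !hfE hformZ ReZ. Qed.

Lemma hfN A x : hf (- A) x = - hf A x.
Proof. by rewrite scaleCN1 hfZ mulN1r. Qed.

Lemma hfB A B x : hf (A - B) x = hf A x - hf B x.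
Proof. by rewrite hfD hfN. Qed.

Lemma hf0 x : hf 0 x = 0.
Proof. by rewrite -(scale0r (0 : 'M[R[i]]_N)) hfZ mul0r. Qed.

Lemma hform_mulmx A (g : 'M[R[i]]_N) x :
  hform (g^t* *m A *m g) x = hform A (g *m x).
Proof. by rewrite /hform trmxCM !mulmxA. Qed.

Lemma posdef_herm A : posdef A -> A \is hermsymmx.
Proof. by case. Qed.

Lemma posdef_hf_gt0 A x : posdef A -> x != 0 -> 0 < hf A x.
Proof. by move=> [hA pA] /pA; rewrite hformE // ltcR. Qed.

Lemma hf_ge0 A x : posdef A -> 0 <= hf A x.
Proof.
have [->|xn0 /posdef_hf_gt0 h] := eqVneq x 0; last exact/ltW/h.
by rewrite hfE /hform mulmx0 mxE.
Qed.

Lemma posdefP A :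
  A \is hermsymmx -> (forall x, x != 0 -> 0 < hf A x) -> posdef A.
Proof. by move=> hA pA; split=> // x xn0; rewrite hformE // ltcR pA. Qed.

Lemma gact_q (g : 'M[R[i]]_N) v : gact g (q v) = q (g *m v).
Proof. by rewrite /gact /q trmxCM !mulmxA. Qed.

Lemma gactD (g : 'M[R[i]]_N) A B : gact g (A + B) = gact g A + gact g B.
Proof. by rewrite /gact mulmxDr mulmxDl. Qed.

Lemma gactZ (g : 'M[R[i]]_N) (c : R[i]) A : gact g (c *: A) = c *: gact g A.
Proof. by rewrite /gact -scalemxAr -scalemxAl. Qed.

Lemma gact0 (g : 'M[R[i]]_N) : gact g 0 = 0.
Proof. by rewrite /gact mulmx0 mul0mx. Qed.

Lemma gact_sum (I : Type) (s : seq I) (P : pred I) (F : I -> 'M[R[i]]_N) (g :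
  'M[R[i]]_N) :
  gact g (\sum_(i <- s | P i) F i) = \sum_(i <- s | P i) gact g (F i).
Proof. exact: (big_morph _ (gactD g) (gact0 g)). Qed.

Lemma gactM (g h : 'M[R[i]]_N) A : gact (g *m h) A = gact g (gact h A).
Proof. by rewrite /gact trmxCM !mulmxA. Qed.

Lemma trmxC1 : (1%:M : 'M[R[i]]_N)^t* = 1%:M.
Proof. by rewrite trmx1 map_mx1. Qed.

Lemma gact1 A : gact 1%:M A = A.
Proof. by rewrite /gact trmxC1 mul1mx mulmx1. Qed.

Lemma gactK (g : 'M[R[i]]_N) : g \in unitmx -> cancel (gact g) (gact (invmx g)).
Proof. by move=> ug A; rewrite -gactM mulVmx // gact1. Qed.

Lemma gactVK (g : 'M[R[i]]_N) : g \in unitmx -> cancel (gact (invmx g)) (gact g).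
Proof. by move=> ug A; rewrite -gactM mulmxV // gact1. Qed.

End HermitianForms.

Definition dot (R : realType) (N : nat) (x y : 'M[R]_N * 'M[R]_N) : R :=
  \sum_i \sum_j (x.1 i j * y.1 i j + x.2 i j * y.2 i j).

HB.lock Definition ip (R : realType) (N : nat) (A B : 'M[R[i]]_N) : R :=
  dot (reim A) (reim B).

Section RealSpan.
Variables (R : realType) (N : nat).
Local Notation HR := ('M[R]_N * 'M[R]_N)%type.
Implicit Types (A B G : 'M[R[i]]_N) (S : set 'M[R[i]]_N) (r : R) (x y : HR).

Lemma reimD A B : reim (A + B) = reim A + reim B.
Proof. by congr (_, _); apply/matrixP=> i j; rewrite !mxE ?ReD ?ImD. Qed.

Lemma reimZ r A : reim (r%:C *: A) = r *: reim A.
Proof. by congr (_, _); apply/matrixP=> i j; rewrite !mxE ?ReZ ?ImZ. Qed.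

Lemma reim0 : reim (0 : 'M[R[i]]_N) = 0.
Proof. by congr (_, _); apply/matrixP=> i j; rewrite !mxE. Qed.

Lemma reim_sum (I : Type) (s : seq I) (P : pred I) (F : I -> 'M[R[i]]_N) :
  reim (\sum_(i <- s | P i) F i) = \sum_(i <- s | P i) reim (F i).
Proof. exact: (big_morph _ reimD reim0). Qed.

Definition unreim x : 'M[R[i]]_N := \matrix_(i, j) (x.1 i j +i* x.2 i j).

Lemma reimK : cancel (@reim R N) unreim.
Proof. by move=> A; apply/matrixP=> i j; rewrite !mxE /=; case: (A i j). Qed.

Lemma unreimK : cancel unreim (@reim R N).
Proof. by move=> [a b]; congr (_, _); apply/matrixP=> i j; rewrite !mxE. Qed.

Lemma dotC x y : dot x y = dot y x.
Proof.
by apply: eq_bigr => i _; apply: eq_bigr => j _; congr (_ + _); exact: mulrC.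
Qed.

Lemma dotDr x y z : dot x (y + z) = dot x y + dot x z.
Proof.
rewrite -big_split; apply: eq_bigr => i _; rewrite -big_split.
by apply: eq_bigr => j _ /=; rewrite !mxE; ring.
Qed.

Lemma dotZr r x y : dot x (r *: y) = r * dot x y.
Proof.
rewrite big_distrr; apply: eq_bigr => i _; rewrite big_distrr.
by apply: eq_bigr => j _ /=; rewrite !mxE; ring.
Qed.

Lemma dot_linear x : linear (dot x : HR -> R^o).
Proof. by move=> r y z; rewrite dotDr dotZr. Qed.

HB.instance Definition _ x :=
  GRing.isLinear.Build R HR R^o _ (dot x : HR -> R^o) (dot_linear x).

Lemma dot_ge0 x : 0 <= dot x x.
Proof.
by apply: sumr_ge0 => i _; apply: sumr_ge0 => j _; rewrite -!expr2 addr_ge0 ?sqr_ge0.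
Qed.

Lemma dot_eq0 x : dot x x = 0 -> x = 0.
Proof.
have h (i j : 'I_N) : 0 <= x.1 i j * x.1 i j + x.2 i j * x.2 i j.
  by rewrite -!expr2 addr_ge0 ?sqr_ge0.
move=> /eqP; rewrite psumr_eq0 => [/allP h0|i _]; last exact: sumr_ge0.
have h1 i j : x.1 i j * x.1 i j + x.2 i j * x.2 i j = 0.
  have := h0 i (mem_index_enum _); rewrite /= psumr_eq0 // => /allP h1.
  exact/eqP/(h1 j)/mem_index_enum.
case: x h h0 h1 => a b h _ h1; congr (_, _); apply/matrixP=> i j; rewrite mxE.
  by have := h1 i j; move/eqP;
    rewrite /= -!expr2 paddr_eq0 ?sqr_ge0 // !sqrf_eq0 => /andP[/eqP].
by have := h1 i j; move/eqP;
  rewrite /= -!expr2 paddr_eq0 ?sqr_ge0 // !sqrf_eq0 => /andP[_ /eqP].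
Qed.

Lemma ipE A B : ip A B = dot (reim A) (reim B).
Proof. by rewrite ip.unlock. Qed.

Lemma ip_q A v : ip A (q v) = hf A v.
Proof.
rewrite hfE /hform mxE Re_sum ipE /dot exchange_big; apply: eq_bigr => j _.
rewrite mxE mulr_suml Re_sum; apply: eq_bigr => i _.
rewrite !mxE /= big_ord_recl big_ord0 addr0 !mxE.
rewrite -ReM_conj rmorphM /=; congr complex.Re.
by rewrite conjCK mulrA (mulrC (A i j)).
Qed.

Lemma ipDr A B G : ip A (B + G) = ip A B + ip A G.
Proof. by rewrite !ipE reimD dotDr. Qed.

Lemma ipZr r A B : ip A (r%:C *: B) = r * ip A B.
Proof. by rewrite !ipE reimZ dotZr. Qed.

Lemma ipC A B : ip A B = ip B A.
Proof. by rewrite !ipE dotC. Qed.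

Lemma ipDl A B G : ip (A + B) G = ip A G + ip B G.
Proof. by rewrite ipC ipDr !(ipC G). Qed.

Lemma ipZl r A B : ip (r%:C *: A) B = r * ip A B.
Proof. by rewrite ipC ipZr ipC. Qed.

Lemma ipNl A B : ip (- A) B = - ip A B.
Proof. by rewrite scaleCN1 ipZl mulN1r. Qed.

Lemma ip0r A : ip A 0 = 0.
Proof. by rewrite -(scale0r (0 : 'M[R[i]]_N)) ipZr mul0r. Qed.

Lemma ip_sumr (I : Type) (s : seq I) (P : pred I) (F : I -> 'M[R[i]]_N) A :
  ip A (\sum_(i <- s | P i) F i) = \sum_(i <- s | P i) ip A (F i).
Proof. exact: (big_morph _ (ipDr A) (ip0r A)). Qed.

Lemma ip_eq0 A : ip A A = 0 -> A = 0.
Proof.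
by rewrite ipE => /dot_eq0; rewrite -reim0 => /(congr1 unreim); rewrite !reimK.
Qed.

(** [rspan] is chosen by [xget], with 0 as default, so the smallest subspace must be shown to exist.
    Among the subspaces contained in every subspace that contains [S], one of largest dimension
    already contains [S]: otherwise a line could be added to it. *)
Lemma rspanP S : (forall A, S A -> reim A \in rspan S) /\
  (forall W : {vspace HR}, (forall A, S A -> reim A \in W) -> (rspan S <= W)%VS).
Proof.
rewrite /rspan; case: xgetP => [U _ //|noU].
pose spansub k := exists U : {vspace HR}, \dim U = k /\
  forall W : {vspace HR}, (forall A, S A -> reim A \in W) -> (U <= W)%VS.
suff [U [hU1 hU2]] : exists U : {vspace HR}, (forall A, S A -> reim A \in U) /\
  forall W : {vspace HR}, (forall A, S A -> reim A \in W) -> (U <= W)%VS.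
  by case: (noU U).
have ex0 : exists k, `[< spansub k >].
  by exists 0%N; apply/asboolP; exists 0%VS; rewrite dimv0; split=> // W _;
    exact: sub0v.
have bnd k : `[< spansub k >] -> (k <= \dim {:HR})%N.
  by move=> /asboolP[U [<- _]]; apply/dimvS/subvf.
case: (ex_maxnP ex0 bnd) => k /asboolP[U [dU hU]] kmax.
exists U; split=> // A SA; apply/negPn/negP=> AU.
have : `[< spansub (\dim (U + <[reim A]>)) >].
  apply/asboolP; exists (U + <[reim A]>)%VS; split=> // W hW.
  by rewrite subv_add hU //= -memvE hW.
move/kmax; rewrite -dU leqNgt => /negP; apply.
by rewrite ltnNge (geq_leqif (dimv_leqif_sup (addvSl _ _))) subv_add subvv
           -memvE.
Qed.

Lemma mem_rspan S A : S A -> reim A \in rspan S.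
Proof. exact: (rspanP S).1. Qed.

Lemma rspan_sub S (W : {vspace HR}) :
  (forall A, S A -> reim A \in W) -> (rspan S <= W)%VS.
Proof. exact: (rspanP S).2. Qed.

Lemma rspan_mono S T : (S `<=` T)%classic -> (rspan S <= rspan T)%VS.
Proof. by move=> ST; apply: rspan_sub => A /ST; exact: mem_rspan. Qed.

End RealSpan.

(** * Dimension of the Hermitian matrices and annihilators of real spans *)

Section HermitianDimension.
Variables (R : realType) (N : nat).
Local Notation HR := ('M[R]_N * 'M[R]_N)%type.
Implicit Types (A B G F : 'M[R[i]]_N) (S : set 'M[R[i]]_N) (r : R) (x y : HR).

Definition herm_space : {vspace HR} :=
  rspan [set B : 'M[R[i]]_N | B \is hermsymmx].

(** An isomorphism from real matrices onto Hermitian ones: X is half the sum of the real and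
    imaginary parts, one symmetric and the other antisymmetric. The dimension N^2 follows without
    writing a basis. *)
Definition symskew (X : 'M[R]_N) : HR := (X + X^T, X - X^T).

Fact symskew_is_linear : linear symskew.
Proof.
by move=> r X Y; congr (_, _); apply/matrixP=> i j; rewrite !mxE; ring.
Qed.

HB.instance Definition _ :=
  GRing.isLinear.Build R 'M[R]_N HR _ symskew symskew_is_linear.

Lemma herm_unreim_symskew X : unreim (symskew X) \is hermsymmx.
Proof.
apply/hermP/matrixP=> i j; rewrite !mxE /=.
by apply: complex_inj => /=; ring.
Qed.

Lemma symskew_onto A :
  A \is hermsymmx -> exists X, reim A = symskew X.
Proof.
move=> /hermP hA.
exists (\matrix_(i, j) ((complex.Re (A i j) + complex.Im (A i j)) / 2)).
have h i j : A j i = (A i j)^*%R by rewrite -{1}hA !mxE.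
by congr (_, _); apply/matrixP=> i j; rewrite !mxE h ReC_conj ImC_conj;
  field.
Qed.

Lemma herm_spaceE : herm_space = limg (linfun symskew).
Proof.
apply: subv_anti; apply/andP; split.
  apply: rspan_sub => A /symskew_onto[X ->].
  by rewrite -[symskew X](lfunE symskew) memv_img ?memvf.
apply/subvP => _ /memv_imgP[X _ ->]; rewrite lfunE /=.
by rewrite -(unreimK (symskew X)); apply/mem_rspan/herm_unreim_symskew.
Qed.

Lemma dim_herm_space : \dim herm_space = (N * N)%N.
Proof.
rewrite herm_spaceE limg_dim_eq ?dimvf ?dim_matrix //; apply/eqP.
rewrite capfv -subv0; apply/subvP => X; rewrite memv_ker lfunE /= memv0.
move=> /eqP[/matrixP h1 /matrixP h2]; apply/eqP/matrixP => i j.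
by have := h1 i j; have := h2 i j; rewrite !mxE; lra.
Qed.

Lemma mem_herm_space A : (reim A \in herm_space) = (A \is hermsymmx).
Proof.
apply/idP/idP => [|hA]; last exact: mem_rspan.
rewrite herm_spaceE => /memv_imgP[X _]; rewrite lfunE /= => e.
by rewrite -(reimK A) e herm_unreim_symskew.
Qed.

Lemma rspan_herm S :
  (S `<=` [set B | B \is hermsymmx])%classic -> (rspan S <= herm_space)%VS.
Proof. exact: rspan_mono. Qed.

Definition dot_basis (U : {vspace HR}) (x : HR) : 'rV[R]_(\dim U) :=
  \row_i dot x (vbasis U)`_i.

Fact dot_basis_is_linear U : linear (dot_basis U).
Proof.
move=> r x y; apply/rowP => i.
by rewrite !mxE !(dotC _ (vbasis U)`_i) dotDr dotZr.
Qed.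

HB.instance Definition _ U :=
  GRing.isLinear.Build R HR 'rV[R]_(\dim U) _ (dot_basis U)
    (dot_basis_is_linear U).

Definition orthv (U : {vspace HR}) : {vspace HR} := lker (linfun (dot_basis U)).

Lemma mem_orthvP (U : {vspace HR}) x :
  reflect (forall y, y \in U -> dot x y = 0) (x \in orthv U).
Proof.
rewrite memv_ker lfunE /=; apply: (iffP eqP) => [/rowP h y /coord_vbasis ->|h].
  rewrite (linear_sum (dot x : HR -> R^o)) big1 // => i _.
  by rewrite linearZ /=; have := h i; rewrite !mxE => ->; rewrite scaler0.
by apply/rowP => i; rewrite !mxE h // vbasis_mem // mem_nth ?size_tuple.
Qed.

(** One inequality holds because [dot] is positive definite, so that [U] meets its complement
    trivially; the other because the complement is the kernel of a map into a space of dimension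
    [\dim U]. *)
Lemma dim_orthv (U V : {vspace HR}) :
  (U <= V)%VS -> (\dim U + \dim (V :&: orthv U) = \dim V)%N.
Proof.
move=> UV; apply/eqP; rewrite eqn_leq; apply/andP; split.
  rewrite -dimv_disjoint_sum; first by rewrite dimvS // subv_add UV capvSl.
  apply/eqP; rewrite -subv0; apply/subvP => x.
  rewrite !memv_cap => /and3P[xU _ /mem_orthvP/(_ x xU)/dot_eq0 ->].
  exact: mem0v.
rewrite -(limg_ker_dim (linfun (dot_basis U)) V) addnC leq_add2r.
by rewrite (leq_trans (dimvS (subvf _))) // dimvf /dim /= mul1n.
Qed.

Lemma dot_rspan S x :
  (forall A, S A -> dot x (reim A) = 0) -> forall y, y \in rspan S -> dot x y = 0.
Proof.
move=> h y; have /subvP sub : (rspan S <= lker (linfun (dot x : HR -> R^o)))%VS.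
  by apply: rspan_sub => A /h; rewrite memv_ker lfunE /= => ->.
by move/sub; rewrite memv_ker lfunE /= => /eqP.
Qed.

Definition annihilator S : {vspace HR} := (herm_space :&: orthv (rspan S))%VS.

Lemma mem_annihilator S G :
  reim G \in annihilator S <->
  G \is hermsymmx /\ forall A, S A -> ip G A = 0.
Proof.
rewrite memv_cap mem_herm_space; split=> [/andP[-> /mem_orthvP h]|[-> h]].
  by split=> // A /mem_rspan; rewrite ipE; exact: h.
by apply/mem_orthvP => y; apply: dot_rspan => A /h; rewrite ipE.
Qed.

Lemma dim_rspan_annihilator S :
  (S `<=` [set B | B \is hermsymmx])%classic ->
  (\dim (rspan S) + \dim (annihilator S) = N * N)%N.
Proof. by move/rspan_herm/dim_orthv => ->; exact: dim_herm_space. Qed.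

Lemma dim_rspan_full S :
  (S `<=` [set B | B \is hermsymmx])%classic ->
  \dim (rspan S) = (N * N)%N <->
  forall G, G \is hermsymmx -> (forall A, S A -> ip G A = 0) -> G = 0.
Proof.
move=> hS; have := dim_rspan_annihilator hS => dS; split=> [e G hG GS|h].
  have /eqP : \dim (annihilator S) = 0%N by lia.
  rewrite dimv_eq0 => /eqP a0.
  have /mem_annihilator : G \is hermsymmx /\ forall A, S A -> ip G A = 0 by [].
  by rewrite a0 memv0 -reim0 => /eqP/(can_inj (@reimK _ _)).
suff : \dim (annihilator S) = 0%N by lia.
apply/eqP; rewrite dimv_eq0 -subv0; apply/subvP => x xa.
have /mem_annihilator[hx xS] : reim (unreim x) \in annihilator S by rewrite unreimK.
by rewrite -(unreimK x) (h _ hx xS) reim0 memv0.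
Qed.

Lemma rspan_full S :
  (S `<=` [set B | B \is hermsymmx])%classic ->
  rspan S = herm_space <-> \dim (rspan S) = (N * N)%N.
Proof.
move=> hS; split=> [->|d]; first exact: dim_herm_space.
by apply/eqP; rewrite eqEdim rspan_herm //= d dim_herm_space.
Qed.

(** For [S] Hermitian: [S] spans a hyperplane of the Hermitian matrices with normal vector [F]. *)
Definition ann_line S F :=
  [/\ F \is hermsymmx, F != 0, forall A, S A -> ip F A = 0 &
      forall G, G \is hermsymmx -> (forall A, S A -> ip G A = 0) ->
        exists c : R, G = c%:C *: F].

Lemma dim_rspan_hyperplane S :
  (S `<=` [set B | B \is hermsymmx])%classic ->
  (\dim (rspan S)).+1 = (N * N)%N <-> exists F, ann_line S F.
Proof.
move=> hS; have := dim_rspan_annihilator hS => dS; split=> [e|[F [hF F0 FS Fl]]].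
  have da : \dim (annihilator S) = 1%N by lia.
  have := memv_pick (annihilator S); set x := vpick _ => xa.
  have xn0 : x != 0 by rewrite vpick0 -dimv_eq0 da.
  have aE : annihilator S = <[x]>%VS.
    by apply/eqP; rewrite eq_sym eqEdim dim_vline xn0 da andbT -memvE.
  have /mem_annihilator[hx xS] : reim (unreim x) \in annihilator S.
    by rewrite unreimK.
  exists (unreim x); split=> // [|G hG GS].
    by apply: contra xn0 => /eqP x0; rewrite -(unreimK x) x0 reim0.
  have /mem_annihilator : G \is hermsymmx /\ forall A, S A -> ip G A = 0 by [].
  rewrite aE => /vlineP[c eG]; exists c; apply: (can_inj (@reimK _ _)).
  by rewrite eG reimZ unreimK.
have aE : annihilator S = <[reim F]>%VS.
  apply/eqP; rewrite eqEsubv -memvE; apply/andP; split; last first.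
    exact/mem_annihilator.
  apply/subvP => x xa.
  have /mem_annihilator[hx xS] : reim (unreim x) \in annihilator S.
    by rewrite unreimK.
  have [c e] := Fl _ hx xS.
  by apply/vlineP; exists c; rewrite -(unreimK x) e reimZ.
have := dim_vline (reim F); rewrite -aE.
have -> : reim F != 0.
  by apply: contra F0; rewrite -reim0 => /eqP/(can_inj (@reimK _ _)) ->.
by move=> /= d1; move: dS; rewrite d1 addn1.
Qed.

End HermitianDimension.

(** * The ring of integers *)

(** Gauss's lemma: X - a divides a monic integer polynomial, so it is a rational multiple of an
    integer polynomial whose leading coefficient is a unit. *)
Lemma integralOver_ratr (F : numFieldType) (a : rat) :
  integralOver (intr : int -> F) (ratr a) -> a \is a Num.int.
Proof.
move=> [p mp rp].
have e : map_poly (intr : int -> F) p = map_poly ratr (map_poly (intr : int ->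
  rat) p).
  by rewrite -map_poly_comp; apply: eq_map_poly => z /=; rewrite ratr_int.
move: rp; rewrite e fmorph_root -dvdp_XsubCl => /dvdpP_rat_int[p1 [c c0 ep1] [r pE]].
have l1 : lead_coef p1 * lead_coef r = 1.
  by rewrite -lead_coefM -pE; exact/eqP.
have [s1|s1] : lead_coef p1 = 1 \/ lead_coef p1 = -1.
  have : (`|lead_coef p1| * `|lead_coef r| = 1)%N by rewrite -abszM l1.
  by move/eqP; rewrite muln_eq1 => /andP[/eqP ? _]; lia.
all: have : lead_coef ('X - a%:P) = c * (lead_coef p1)%:~R
  by rewrite {1}ep1 lead_coefZ lead_coef_map_inj //; exact: intr_inj.
all: rewrite lead_coefXsubC s1 => ec.
all: have : ('X - a%:P)`_0 = c * (p1`_0)%:~R by rewrite {1}ep1 coefZ coef_map.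
all: rewrite coefB coefX coefC /= sub0r => ea.
  have -> : a = (- p1`_0)%:~R.
    by apply: oppr_inj; rewrite ea rmorphN opprK; move: ec; rewrite mulr1 => <-;
      rewrite mul1r.
  exact: intr_int.
have -> : a = (p1`_0)%:~R.
  apply: oppr_inj; rewrite ea; move: ec; rewrite mulrN1 => /eqP.
  by rewrite eq_sym eqr_oppLR => /eqP ->; rewrite mulN1r.
exact: intr_int.
Qed.

Section RingOfIntegers.
Variables (R : realType) (D : int).
Hypothesis D_lt0 : D < 0.
Local Notation C := R[i].
Local Notation w := (sqrtC (D%:~R : C)).
Implicit Types z : C.

Definition normsq z : R := complex.Re z ^+ 2 + complex.Im z ^+ 2.

Lemma normsqE z : (normsq z)%:C = z * z^*%R.
Proof. by rewrite /normsq add_Re2_Im2 normCK. Qed.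

Lemma normsq_ge0 z : 0 <= normsq z.
Proof. by rewrite addr_ge0 ?sqr_ge0. Qed.

Lemma normsq_eq0 z : (normsq z == 0) = (z == 0).
Proof. by rewrite /normsq paddr_eq0 ?sqr_ge0 // !sqrf_eq0 eq_complex. Qed.

Lemma intr_RealC (m : int) : (m%:~R : C) = (m%:~R : R)%:C.
Proof. by rewrite rmorph_int. Qed.

Lemma ReC_int (m : int) : complex.Re (m%:~R : C) = m%:~R.
Proof. by rewrite intr_RealC. Qed.

Lemma ImC_int (m : int) : complex.Im (m%:~R : C) = 0.
Proof. by rewrite intr_RealC. Qed.

Lemma sqrtD_Re : complex.Re w = 0.
Proof.
have := sqrtCK (D%:~R : C); rewrite expr2; case: w => x y /= e.
have := congr1 (@complex.Re R) e; have := congr1 (@complex.Im R) e.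
rewrite ReC_int ImC_int /= => eI eR; apply/eqP/negPn/negP => x0.
have y0 : y = 0.
  have /eqP : x * y = 0 by move: eI; lra.
  by rewrite mulf_eq0 (negPf x0) => /eqP.
have : (D%:~R : R) < 0 by rewrite ltrz0.
by rewrite -eR y0 mulr0 subr0 -expr2 ltNge sqr_ge0.
Qed.

Lemma sqrtD_Im_sqr : complex.Im w ^+ 2 = - D%:~R.
Proof.
have := congr1 (@complex.Re R) (sqrtCK (D%:~R : C)).
have := sqrtD_Re; rewrite expr2 ReC_int; case: w => x y /= -> <-.
by rewrite mul0r sub0r opprK expr2.
Qed.

Lemma sqrtD_Im_neq0 : complex.Im w != 0.
Proof. by rewrite -sqrf_eq0 sqrtD_Im_sqr oppr_eq0 intr_eq0 ltr0_neq0. Qed.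

Lemma sqrtD_conj : w^*%R = - w.
Proof. by apply: complex_inj;
  rewrite ?ReC_conj ?ImC_conj ?ReN ?sqrtD_Re ?oppr0 //; case: w. Qed.

Lemma ringintD z1 z2 : ringint D z1 -> ringint D z2 -> ringint D (z1 + z2).
Proof.
move=> [[a [b e1]] i1] [[c [d e2]] i2]; split;
  last exact: (@integral_add _ _ (intmul 1)).
by exists (a + c), (b + d); rewrite e1 e2 !rmorphD /=; ring.
Qed.

Lemma ringintM z1 z2 : ringint D z1 -> ringint D z2 -> ringint D (z1 * z2).
Proof.
move=> [[a [b e1]] i1] [[c [d e2]] i2]; split;
  last exact: (@integral_mul _ _ (intmul 1)).
exists (a * c + b * d * D%:~R), (a * d + b * c).
rewrite e1 e2 !(rmorphD, rmorphM) /= ratr_int.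
by have := sqrtCK (D%:~R : C); move: w => s <-; ring.
Qed.

Lemma ringint_int (m : int) : ringint D (m%:~R : C).
Proof.
split; first by exists m%:~R, 0; rewrite rmorph0 mul0r addr0 ratr_int.
exact: (@integral_id _ _ (intmul 1)).
Qed.

Lemma ringint_sqrtD : ringint D w.
Proof.
split; first by exists 0, 1; rewrite rmorph0 rmorph1 mul1r add0r.
exists ('X^2 - D%:P);
  first by rewrite monicE lead_coefDl ?lead_coefXn // size_polyN size_polyXn
    size_polyC; case: eqP.
by rewrite rmorphB /= map_polyXn map_polyC /= /root !hornerE sqrtCK subrr.
Qed.

Lemma ringint_sum (I : Type) (s : seq I) (P : pred I) (F : I -> C) :
  (forall i, P i -> ringint D (F i)) -> ringint D (\sum_(i <- s | P i) F i).
Proof.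
move=> hF; elim/big_rec: _ => [|i z Pi hz]; first exact: (ringint_int 0).
by apply: ringintD => //; apply: hF.
Qed.

(** Integrality passes to the conjugate, a root of the same integer polynomial, hence to the trace
    and the norm, which are also rational. This yields discreteness without an integral basis. *)
Lemma ringint_trace_norm z : ringint D z ->
  exists m n : int, complex.Re z *+ 2 = m%:~R /\ normsq z = n%:~R.
Proof.
move=> [[a [b e]] iz].
have ratJ (c : rat) : (ratr c : C)^*%R = ratr c.
  by rewrite conj_Creal // rpred_rat.
have iJ : integralOver (intr : int -> C) z^*%R.
  case: iz => p mp rp; exists p => //.
  have -> : map_poly (intr : int -> C) p = map_poly Num.conj (map_poly intr p).
    by rewrite -map_poly_comp; apply: eq_map_poly => k /=; rewrite rmorph_int.
  by rewrite fmorph_root.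
have ej : z^*%R = ratr a - ratr b * w.
  rewrite e; move: (ratJ a) (ratJ b); move: (ratr a) (ratr b) => x y jx jy.
  by rewrite rmorphD rmorphM /= jx jy sqrtD_conj mulrN.
have eT : z + z^*%R = ratr (a *+ 2).
  by rewrite ej e rmorphMn /=; ring.
have eN : z * z^*%R = ratr (a ^+ 2 - b ^+ 2 * D%:~R).
  rewrite ej e rmorphB /= rmorphXn /= rmorphM /= rmorphXn /= ratr_int.
  by have := sqrtCK (D%:~R : C); move: w => s <-; ring.
have /integralOver_ratr/intrP[m em] : integralOver (intr : int -> C) (ratr (a *+ 2)).
  by rewrite -eT; exact: (@integral_add _ _ (intmul 1)).
have /integralOver_ratr/intrP[n en] :
    integralOver (intr : int -> C) (ratr (a ^+ 2 - b ^+ 2 * D%:~R)).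
  by rewrite -eN; exact: (@integral_mul _ _ (intmul 1)).
exists m, n; split.
  by rewrite -(ReC_int m) -ratr_int -em -eT ReD ReC_conj mulr2n.
by rewrite -(ReC_int n) -ratr_int -en -eN -normsqE.
Qed.

Lemma finite_ringint_ball (r : R) :
  finite_set [set z | ringint D z /\ normsq z <= r].
Proof.
pose K := (Num.truncn (4 * r)).+1.
have rK : 4 * r < K%:R by exact: truncnS_gt.
(* A ring element is recovered from its trace (shifted by [K] to be a natural number), its norm and
   the sign of its imaginary part. One bound [K] serves both numbers, as the squared trace is at
   most four times the norm. *)
pose f (t : 'I_(K.*2) * 'I_K * bool) : C :=
  let m : R := (t.1.1%:R - K%:R) / 2 in
  m +i* ((-1) ^+ t.2 * Num.sqrt (t.1.2%:R - m ^+ 2)).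
apply: (@sub_finite_set _ _ (f @` [set: _])); last first.
  exact/finite_image/finite_finset.
move=> z [/ringint_trace_norm[m [n [em en]]] zr].
have n0 : 0 <= n by rewrite -(ler0z R) -en normsq_ge0.
have nK : (`|n| < K)%N.
  have : (n%:~R : R) < K%:~R.
    by rewrite -en; apply: le_lt_trans rK; have := normsq_ge0 z; lra.
  by rewrite ltr_int; lia.
have mK : (`|m| < K)%N.
  have : (m ^+ 2)%:~R < (K%:~R : R).
    rewrite rmorphXn /= -em; apply: le_lt_trans rK.
    by have : complex.Re z ^+ 2 <= normsq z; [rewrite lerDl sqr_ge0 | nra].
  by rewrite ltr_int; nia.
have mK2 : (absz (m + K%:Z)%R < K.*2)%N by rewrite -addnn; lia.
exists (Ordinal mK2, Ordinal nK, complex.Im z < 0) => //; rewrite /f /=.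
have -> : ((absz (m + K%:Z)%R)%:R : R) = m%:~R + K%:R.
  rewrite -[RHS](rmorphD (intmul (1 : R)) m K%:Z) /= pmulrn; by congr (_ %:~R); lia.
have -> : (`|n|%N%:R : R) = n%:~R.
  by rewrite pmulrn; congr (_%:~R); lia.
rewrite addrK -em -en mulr2n; apply: complex_inj => /=; first by field.
have -> : normsq z - ((complex.Re z + complex.Re z) / 2) ^+ 2 = complex.Im z ^+ 2.
  by rewrite /normsq; field.
by rewrite sqrtr_sqr -realEsign ?num_real.
Qed.

End RingOfIntegers.

(** * Integral matrices and simultaneous approximation *)

Section Lattice.
Variables (R : realType) (D : int) (N : nat).
Hypothesis D_lt0 : D < 0.
Local Notation C := R[i].
Local Notation w := (sqrtC (D%:~R : C)).

Lemma finite_mx_entries m n (S : set C) :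
  finite_set S -> finite_set [set A : 'M[C]_(m, n) | forall i j, S (A i j)].
Proof.
move=> fS.
pose f (t : {ffun 'I_m * 'I_n -> fset_set S}) : 'M[C]_(m, n) :=
  \matrix_(i, j) val (t (i, j)).
apply: (@sub_finite_set _ _ (f @` [set: _])); last first.
  exact/finite_image/finite_finset.
move=> A hA; have hA' i j : A i j \in fset_set S by rewrite in_fset_set ?inE.
exists [ffun p => [` hA' p.1 p.2]%fset] => //.
by apply/matrixP => i j; rewrite !mxE ffunE.
Qed.

Lemma intmxM m n p (A : 'M[C]_(m, n)) (B : 'M[C]_(n, p)) :
  intmx D A -> intmx D B -> intmx D (A *m B).
Proof.
by move=> hA hB i j; rewrite mxE; apply: ringint_sum => k _; apply: ringintM.
Qed.

Lemma frac_bound (K : nat) (x y : R) :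
  Num.truncn (K%:R * (x - (Num.floor x)%:~R)) =
  Num.truncn (K%:R * (y - (Num.floor y)%:~R)) ->
  (K%:R * ((x - (Num.floor x)%:~R) - (y - (Num.floor y)%:~R))) ^+ 2 <= 1.
Proof.
move=> e.
have hx : 0 <= K%:R * (x - (Num.floor x)%:~R).
  by rewrite mulr_ge0 // subr_ge0 floor_le.
have hy : 0 <= K%:R * (y - (Num.floor y)%:~R).
  by rewrite mulr_ge0 // subr_ge0 floor_le.
have /andP[h1 h2] := truncn_itv hx; have /andP[h3 h4] := truncn_itv hy.
rewrite -!natr1 e in h1 h2 h3 h4 *; rewrite mulrBr.
move: (K%:R * (x - _)) (K%:R * (y - _)) (_%:R) h1 h2 h3 h4 => a b c *.
nra.
Qed.

(** Pigeonhole in the sublattice Z + Z [w] of the ring: two multiples of [u] whose real coordinates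
    in the basis (1, [w]) have fractional parts in the same boxes differ by nearly a lattice
    vector. *)
Lemma dirichlet (u : 'cV[C]_N) (eps : R) : 0 < eps ->
  exists2 x : 'cV[C]_N, intmx D x & exists2 k : nat, (0 < k)%N &
    forall i, normsq (x i 0 - k%:R * u i 0) <= eps.
Proof.
move=> eps0.
set y := complex.Im w.
have yn0 : y != 0 by exact: sqrtD_Im_neq0.
have y2 : 0 < y ^+ 2 by rewrite lt_def sqrf_eq0 yn0 sqr_ge0.
(* In a common box each coordinate error is at most 1/K, so the squared modulus of the error is at
   most (1 + y^2)/K^2; this [K] makes it at most [eps]. *)
pose K := (Num.truncn ((1 + y ^+ 2) / eps)).+1.
have hK : 1 + y ^+ 2 <= eps * K%:R ^+ 2.
  rewrite mulrC -ler_pdivrMr //; apply: le_trans (ltW (truncnS_gt _)) _.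
  by rewrite -natrX ler_nat -/K leq_pmulr.
have K0 : 0 < K%:R :> R by rewrite ltr0n.
pose ca (z : C) : R := complex.Re z; pose cb (z : C) : R := complex.Im z / y.
pose box (x : R) := Num.truncn (K%:R * (x - (Num.floor x)%:~R)).
have boxK x : (box x < K)%N.
  rewrite /box -(ltr_nat R);
    apply: le_lt_trans (_ : K%:R * (x - (Num.floor x)%:~R) < _).
    by rewrite truncn_le mulr_ge0 // subr_ge0 floor_le.
  rewrite gtr_pMr // ltrBlDl; have := floorD1_gt x; rewrite rmorphD /=; lra.
pose f (k : nat) : {ffun 'I_N -> 'I_K * 'I_K} :=
  [ffun i => (Ordinal (boxK (ca (k%:R * u i 0))), Ordinal (boxK (cb (k%:R * u i
    0))))].
have [k1 [k2 [k12 ef]]] : exists k1 k2, (k1 < k2)%N /\ f k1 = f k2.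
  pose T := {ffun 'I_N -> 'I_K * 'I_K}.
  pose g (k : 'I_(#|{: T}|.+1)) : T := f k.
  have /injectivePn[a [b ab eg]] : ~~ injectiveb g.
      by apply/negP => /injectiveP/leq_card; rewrite card_ord ltnn.
  have : nat_of_ord a != b by [].
  by rewrite neq_ltn => /orP[] l; [exists a, b | exists b, a].
pose z k i : C := k%:R * u i 0.
exists (\col_i (((Num.floor (ca (z k2 i)) - Num.floor (ca (z k1 i)))%:~R : C) +
         (Num.floor (cb (z k2 i)) - Num.floor (cb (z k1 i)))%:~R * w)).
  move=> i j; rewrite mxE; apply: ringintD; first exact: ringint_int.
  by apply: ringintM; [exact: ringint_int|exact: ringint_sqrtD].
exists (k2 - k1)%N; first by rewrite subn_gt0.
move=> i; rewrite mxE natrB ?(ltnW k12) // mulrBl -/(z k2 i) -/(z k1 i).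
have := congr1 (fun h : {ffun _ -> _} => (val (h i).1, val (h i).2)) ef.
rewrite !ffunE /= => -[/frac_bound ha /frac_bound hb].
rewrite -/(z k2 i) -/(z k1 i) in ha hb.
rewrite -(ler_pM2r (exprn_gt0 2 K0)); apply: le_trans hK.
have sI (x : C) : complex.Im x = y * cb x by rewrite mulrCA divff // mulr1.
have eR (m n : int) : complex.Re ((m%:~R : C) + n%:~R * w) = m%:~R.
  by rewrite ReD ReC_int [n%:~R]intr_RealC ReZ sqrtD_Re // mulr0 addr0.
have eI (m n : int) : complex.Im ((m%:~R : C) + n%:~R * w) = n%:~R * y.
  by rewrite ImD ImC_int [n%:~R]intr_RealC ImZ add0r.
rewrite /normsq ReD ImD ReN ImN eR eI ReD ReN ImD ImN !sI !rmorphB /=.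
rewrite -/(ca (z k1 i)) -/(ca (z k2 i)) in ha *.
move: (ca (z k1 i)) (ca (z k2 i)) (cb (z k1 i)) (cb (z k2 i)) ha hb => a1 a2 b1 b2.
move: (_%:~R) (_%:~R) (_%:~R) (_%:~R) => m1 m2 n1 n2 ha hb.
have -> : ((n1 - n2 - (a2 - a1)) ^+ 2 + ((m1 - m2) * y - (y * b2 - y * b1)) ^+ 2)
  * K%:R ^+ 2
  = (K%:R * (a1 - n2 - (a2 - n1))) ^+ 2
    + y ^+ 2 * (K%:R * (b1 - m2 - (b2 - m1))) ^+ 2 by ring.
by rewrite lerD // ger_pMr.
Qed.

End Lattice.

(** * Positive definite forms *)

Section PositiveForms.
Variables (R : realType) (N : nat).
Local Notation C := R[i].
Implicit Types (A F : 'M[C]_N) (x y u v : 'cV[C]_N).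

Lemma normsqM (a b : C) : normsq (a * b) = normsq a * normsq b.
Proof. by case: a b => [a b] [c d]; rewrite /normsq /=; ring. Qed.

Lemma normsq_conj (a : C) : normsq a^*%R = normsq a.
Proof. by rewrite /normsq ReC_conj ImC_conj sqrrN. Qed.

Definition bform A x y : C := (x^t* *m A *m y) 0 0.

Lemma bform_conj A x y : A \is hermsymmx -> (bform A x y)^*%R = bform A y x.
Proof.
move=> /hermP hA; have : (x^t* *m A *m y)^t* = y^t* *m A *m x.
  by rewrite !trmxCM trmxCK hA mulmxA.
by move/matrixP/(_ 0 0) => e; rewrite /bform -e !mxE.
Qed.

Lemma bformDZr A x y z (t : C) :
  bform A z (x + t *: y) = bform A z x + t * bform A z y.
Proof. by rewrite /bform mulmxDr -scalemxAr mxE [X in _ + X]mxE. Qed.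

Lemma bformDZl A x y z (t : C) :
  bform A (x + t *: y) z = bform A x z + t^*%R * bform A y z.
Proof.
have e : (x + t *: y)^t* = x^t* + t^*%R *: y^t*.
  by apply/matrixP => i j; rewrite !mxE rmorphD rmorphM.
by rewrite /bform e !mulmxDl -!scalemxAl mxE [X in _ + X]mxE.
Qed.

Lemma hfDZ A x y (t : C) : A \is hermsymmx ->
  hf A (x + t *: y) =
  hf A x + complex.Re (t * bform A x y) *+ 2 + normsq t * hf A y.
Proof.
move=> hA.
have hfb z : hf A z = complex.Re (bform A z z) by rewrite hfE.
have expand (a b d : C) : complex.Re (a + t^*%R * b^*%R + t * (b + t^*%R * d)) =
    complex.Re a + complex.Re (t * b) *+ 2 + normsq t * complex.Re d.
  rewrite mulrDr mulrA -normsqE -(rmorphM Num.conj t b).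
  by rewrite !ReD ReC_conj ReZ mulr2n !addrA.
by rewrite !hfb bformDZr !bformDZl -(bform_conj x y hA) expand.
Qed.

(** Stated for semidefinite forms, since [ryshkov_posdef] applies it before definiteness is
    known. *)
Lemma cauchy_schwarz A x y : A \is hermsymmx -> (forall z, 0 <= hf A z) ->
  normsq (bform A x y) <= hf A x * hf A y.
Proof.
move=> hA pA; set b := bform A x y; set n := normsq b.
have n0 : 0 <= n by exact: normsq_ge0.
(* The test vector is x - s conj(b) y with s real, so that the expansion is a real polynomial of
   degree at most 2 in s. *)
have h (s : R) : 0 <= hf A x - s * n *+ 2 + s ^+ 2 * n * hf A y.
  have := pA (x + (- s%:C * b^*%R) *: y); rewrite hfDZ // -/b normsqM.
  have -> : - s%:C * b^*%R * b = (- (s * n))%:C.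
    by rewrite -mulrA (mulrC _ b) -normsqE -/n mulNr rmorphN rmorphM.
  rewrite normsq_conj -/n.
  have -> : normsq (- s%:C) = s ^+ 2 by rewrite /normsq /=; ring.
  by rewrite /= mulNrn.
have [hy|hy] := eqVneq (hf A y) 0.
  have [->|nn] := eqVneq n 0; first by rewrite mulr_ge0.
  have := h ((hf A x + 1) / (n *+ 2)); rewrite hy mulr0 addr0.
  have -> : (hf A x + 1) / (n *+ 2) * n *+ 2 = hf A x + 1.
    by rewrite mulr2n; field.
  lra.
have y0 : 0 < hf A y by rewrite lt_def hy pA.
have := h (hf A y)^-1.
have -> : hf A x - (hf A y)^-1 * n *+ 2 + (hf A y)^-1 ^+ 2 * n * hf A y
   = (hf A x * hf A y - n) / hf A y by field.
by rewrite pmulr_lge0 ?invr_gt0 // subr_ge0.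
Qed.

(** The coordinate x_i is the sesquilinear product of A^-1 e_i and x, to which Cauchy-Schwarz
    applies. This replaces compactness of the unit sphere. *)
Lemma posdef_coord_bound A : posdef A ->
  exists2 c : R, 0 < c & forall x i, normsq (x i 0) <= c * hf A x.
Proof.
move=> pA; have hA := posdef_herm pA.
have uA : A \in unitmx.
  rewrite -unitmx_tr -row_free_unit -kermx_eq0; apply/eqP/row_matrixP => i.
  rewrite row0; apply/eqP/negPn/negP => rn0.
  have : row i (kermx A^T) *m A^T = 0.
    by apply/sub_kermxP; exact: row_sub.
  move/(congr1 trmx); rewrite trmx_mul trmxK trmx0 => Ar0.
  have /(posdef_hf_gt0 pA) : (row i (kermx A^T))^T != 0 by rewrite trmx_eq0.
  by rewrite hfE /hform -mulmxA Ar0 mulmx0 mxE ltxx.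
pose y i := invmx A *m delta_mx i (0 : 'I_1) : 'cV[C]_N.
have cge0 i : 0 <= hf A (y i) by exact: hf_ge0.
exists (1 + \sum_i hf A (y i)).
  by rewrite ltr_pwDl // sumr_ge0.
move=> x i.
have -> : x i 0 = bform A (y i) x.
  rewrite /bform.
  have -> : (y i)^t* *m A = delta_mx 0 i.
    rewrite -[X in _ *m X](hermP A).1 // -trmxCM /y mulmxA mulmxV // mul1mx.
    by apply/matrixP => a b; rewrite !mxE rmorph_nat andbC.
  by rewrite -rowE mxE.
have psd z : 0 <= hf A z by exact: hf_ge0.
apply: le_trans (cauchy_schwarz _ _ hA psd) _.
rewrite ler_wpM2r ?hf_ge0 // (bigD1 i) //= addrCA lerDl addr_ge0 ?sumr_ge0 //.
Qed.

Lemma hf_bound A F : posdef A ->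
  exists2 c : R, 0 < c & forall x, `|hf F x| <= c * hf A x.
Proof.
move=> /[dup] pA /posdef_coord_bound[c c0 hc].
exists (1 + \sum_i \sum_j (normsq (F j i) + 1) * c).
  rewrite ltr_pwDl // sumr_ge0 // => i _; rewrite sumr_ge0 // => j _.
  by apply: mulr_ge0; [rewrite addr_ge0 ?normsq_ge0 | exact: ltW].
move=> x; rewrite mulrDl mul1r ler_wpDl ?hf_ge0 //.
rewrite hfE /hform mxE Re_sum mulr_suml.
apply: le_trans (ler_norm_sum _ _ _) _; apply: ler_sum => i _.
rewrite mxE mulr_suml Re_sum mulr_suml.
apply: le_trans (ler_norm_sum _ _ _) _; apply: ler_sum => j _.
rewrite !mxE.
have key (a b : C) : `|complex.Re (a * b)| <= normsq a + normsq b.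
  case: a b => [a a'] [b b']; rewrite /normsq /= ler_norml.
  have := sqr_ge0 (a - b); have := sqr_ge0 (a + b).
  have := sqr_ge0 (a' - b'); have := sqr_ge0 (a' + b').
  by have := sqr_ge0 a; have := sqr_ge0 b; move=> *; apply/andP; split; nra.
apply: le_trans (key _ _) _; rewrite normsqM normsq_conj mulrC.
have := hc x i; have := hc x j; have := normsq_ge0 (F j i).
move: (normsq _) (normsq _) (normsq _) (hf A x) => f a b h *; nra.
Qed.

Lemma finite_posdef_ball (D : int) A (r : R) : D < 0 -> posdef A ->
  finite_set [set x : 'cV[C]_N | intmx D x /\ hf A x <= r].
Proof.
move=> D0 /posdef_coord_bound[c c0 hc].
apply: sub_finite_set (finite_mx_entries _ _ (finite_ringint_ball D0 (c * r))).
move=> x [ix xr] i j; split; first exact: ix.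
by rewrite (ord1 j); apply: le_trans (hc x i) _; rewrite ler_pM2l.
Qed.

End PositiveForms.

(** * Perfect cones and cells *)

Section Cones.
Variables (R : realType) (N : nat).
Local Notation C := R[i].
Implicit Types (A B G x : 'M[C]_N) (u v : 'cV[C]_N) (M : set 'cV[C]_N).

Lemma hf_q v u : hf (q v) u = normsq ((v^t* *m u) 0 0).
Proof.
have e : (u^t* *m v) 0 0 = ((v^t* *m u) 0 0)^*%R.
  have : u^t* *m v = (v^t* *m u)^t* by rewrite trmxCM trmxCK.
  by move=> ->; rewrite mxE [LHS]/= mxE.
have -> : normsq ((v^t* *m u) 0 0) = complex.Re ((normsq ((v^t* *m u) 0 0))%:C) by [].
rewrite hfE normsqE -e /hform /q !mulmxA -mulmxA mxE big_ord1.
by rewrite mulrC.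
Qed.

Lemma q_eq0 v : q v = 0 -> v = 0.
Proof.
move=> /matrixP qv; apply/matrixP => i j; rewrite (ord1 j) mxE.
apply/eqP; rewrite -normsq_eq0 -(inj_eq (@complexI R)) normsqE.
by have := qv i i; rewrite !mxE big_ord1 !mxE => ->.
Qed.

Lemma perfect_coneP M x : finite_set M ->
  perfect_cone M x <-> x != 0 /\ exists2 lambda : 'cV[C]_N -> R,
    forall v, 0 <= lambda v & x = \sum_(v <- fset_set M) (lambda v)%:C *: q v.
Proof.
move=> fM; split=> -[x0 [l l0 xl]]; split=> //; exists l => //.
  by rewrite xl fsbig_finite.
by rewrite fsbig_finite.
Qed.

Lemma perfect_cone_herm M x : finite_set M -> perfect_cone M x -> x \is hermsymmx.
Proof.
move=> fM /(perfect_coneP _ fM)[_ [l _ ->]].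
by apply: herm_sum => v _; apply/hermZ/herm_q.
Qed.

Lemma ip_cone A (l : 'cV[C]_N -> R) (s : seq 'cV[C]_N) :
  ip A (\sum_(v <- s) (l v)%:C *: q v) = \sum_(v <- s) l v * hf A v.
Proof. by rewrite ip_sumr; apply: eq_bigr => v _; rewrite ipZr ip_q. Qed.

Lemma perfect_cone_q M v : finite_set M -> M v -> v != 0 -> perfect_cone M (q v).
Proof.
move=> fM Mv v0; apply/perfect_coneP => //; split.
  by apply: contra v0 => /eqP/q_eq0 ->.
exists (fun u => (u == v)%:R) => [u|]; first by rewrite ler0n.
rewrite (big_fsetD1 v) /=; last by rewrite in_fset_set ?inE.
rewrite eqxx scale1r big_seq big1 ?addr0 // => u.
by rewrite !inE => /andP[/negPf -> _]; rewrite scale0r.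
Qed.

Lemma perfect_cone_sub M M' : finite_set M' -> M `<=` M' ->
  perfect_cone M `<=` perfect_cone M'.
Proof.
move=> fM' MM' x; have fM := sub_finite_set MM' fM'.
move=> /(perfect_coneP _ fM)[x0 [l l0 xl]]; apply/(perfect_coneP _ fM'); split=> //.
exists (fun v => if v \in M then l v else 0) => [v|]; first by case: ifP.
rewrite xl -[RHS](@big_fset_incl _ _ _ _ (fset_set M) (fset_set M')).
- by apply: eq_big_seq => v; rewrite in_fset_set // => ->.
- by rewrite -fset_set_sub.
- by move=> v _; rewrite in_fset_set // => /negPf ->; rewrite scale0r.
Qed.

Lemma perfect_cone_ann M G : finite_set M -> ~ M 0 ->
  (forall x, perfect_cone M x -> ip G x = 0) <-> (forall v, M v -> hf G v = 0).
Proof.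
move=> fM M0; split=> [h v Mv|h x /(perfect_coneP _ fM)[_ [l _ ->]]].
  rewrite -ip_q; apply/h/perfect_cone_q => //.
  by apply: contra_notN M0 => /eqP <-.
rewrite ip_cone big_seq big1 // => v; rewrite in_fset_set // inE => /h ->.
exact: mulr0.
Qed.

Lemma posdef_sum_q M : finite_set M ->
  (forall u, (forall v, M v -> (v^t* *m u) 0 0 = 0) -> u = 0) ->
  posdef (\sum_(v <- fset_set M) q v).
Proof.
move=> fM h; apply: posdefP; first by apply: herm_sum => v _; exact: herm_q.
move=> u u0.
have e : hf (\sum_(v <- fset_set M) q v) u =
    \sum_(v <- fset_set M) normsq ((v^t* *m u) 0 0).
  rewrite -ip_q ipC ip_sumr; apply: eq_bigr => v _.
  by rewrite ipC ip_q hf_q.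
have n0 v : true -> 0 <= normsq ((v^t* *m u) 0 0) by move=> _; exact: normsq_ge0.
rewrite e lt_def sumr_ge0 // andbT; apply: contra u0.
rewrite psumr_eq0 // => /allP z; apply/eqP/h => v Mv.
have := z v; rewrite in_fset_set // inE => /(_ Mv).
by rewrite normsq_eq0 => /eqP.
Qed.

End Cones.

(** * Perfect forms of minimum 1 and the cells they define *)

Section PerfectForms.
Variables (R : realType) (D : int) (N : nat).
Hypotheses (D_lt0 : D < 0) (N_gt0 : (0 < N)%N).
Local Notation C := R[i].
Implicit Types (A B G x : 'M[C]_N) (u v : 'cV[C]_N) (M : set 'cV[C]_N)
  (c : set 'M[C]_N).

Definition unitvec A : set 'cV[C]_N := [set v | intmx D v /\ hf A v = 1].

(** Perfection is stated dually, as injectivity of the evaluation of Hermitian forms on the minimal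
    vectors. It also forces the value 1 to be attained, see [exists_unitvec]. *)
Record normperfect A : Prop := Normperfect {
  normperfect_posdef : posdef A;
  normperfect_ge1 : forall v, intmx D v -> v != 0 -> 1 <= hf A v;
  normperfect_ann : forall G, G \is hermsymmx ->
    (forall v, unitvec A v -> hf G v = 0) -> G = 0 }.

Definition pcone A := perfect_cone (unitvec A).

Lemma normperfect_herm A : normperfect A -> A \is hermsymmx.
Proof. by case=> /posdef_herm. Qed.

Lemma finite_unitvec A : normperfect A -> finite_set (unitvec A).
Proof.
move=> [pA _ _]; apply: sub_finite_set (finite_posdef_ball 1 D_lt0 pA).
by move=> v [iv e]; split=> //; rewrite e.
Qed.

Lemma unitvec_neq0 A v : unitvec A v -> v != 0.
Proof.
move=> [_ h]; apply/eqP => v0; move: h; rewrite v0 hfE /hform mulmx0 mxE /=.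
by move/esym/eqP; rewrite oner_eq0.
Qed.

Lemma unitvecN0 A : ~ unitvec A 0.
Proof. by move/unitvec_neq0; rewrite eqxx. Qed.

(** The rank-one form [q u] vanishes at v exactly when v^* u = 0, so perfection kills it: the
    minimal vectors span C^N. *)
Lemma ortho_unitvec A u : normperfect A ->
  (forall v, unitvec A v -> (v^t* *m u) 0 0 = 0) -> u = 0.
Proof.
move=> [_ _ pA] h; apply: q_eq0; apply: pA => [|v Mv]; first exact: herm_q.
rewrite -ip_q ipC ip_q hf_q h //.
by rewrite /normsq /= !expr0n addr0.
Qed.

Lemma exists_unitvec A : normperfect A -> exists v, unitvec A v.
Proof.
move=> nA; apply: contrapT => /forallNP h.
have : (delta_mx (Ordinal N_gt0) 0 : 'cV[C]_N) = 0.
  by apply: (ortho_unitvec nA) => v /h.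
by move/matrixP/(_ (Ordinal N_gt0) 0)/eqP; rewrite !mxE !eqxx oner_eq0.
Qed.

Lemma minformE A : minform D A = inf [set hf A v | v in @intmx R D N 1 `\ 0].
Proof. by congr inf; apply: eq_imagel => v _; rewrite hfE. Qed.

Lemma minvec_normperfect A : normperfect A -> minvec D A = unitvec A.
Proof.
move=> nA; have [pA mA _] := nA; have [v0 Mv0] := exists_unitvec nA.
suff m1 : minform D A = 1.
  apply/seteqP; split=> v [iv e]; split=> //; last first.
    by rewrite hformE ?normperfect_herm // e m1.
  by move: e; rewrite hformE ?normperfect_herm // m1 => -[].
rewrite minformE; apply/eqP; rewrite eq_le; apply/andP; split.
  apply: ge_inf; first by exists 0 => _ [v _ <-]; exact: hf_ge0.
  exists v0; last exact: Mv0.2.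
  by split; [exact: Mv0.1 | apply/eqP/(unitvec_neq0 Mv0)].
apply: lb_le_inf; first by exists 1; exists v0; [split; [exact: Mv0.1 |
  apply/eqP/(unitvec_neq0 Mv0)] | exact: Mv0.2].
by move=> _ [v [iv /eqP v0'] <-]; apply: mA.
Qed.

Lemma perfect_normperfect A : perfect D A ->
  exists2 B, normperfect B & unitvec B = minvec D A.
Proof.
move=> [pA spA]; have hA := posdef_herm pA.
have annA G : G \is hermsymmx -> (forall v, minvec D A v -> hf G v = 0) -> G = 0.
  have hS : (@q R N) @` minvec D A `<=` [set B | B \is hermsymmx].
    by move=> _ [v _ <-]; exact: herm_q.
  have /(rspan_full hS)/(dim_rspan_full hS) h := spA.
  move=> hG Gv; apply: h => // _ [v Mv <-].
  by rewrite ip_q Gv.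
set m := minform D A.
(* With m <= 0 the only possible minimal vector is 0, where every form vanishes, against
   perfection. *)
have m0 : 0 < m.
  rewrite ltNge; apply/negP => m0.
  have : (q (delta_mx (Ordinal N_gt0) 0) : 'M[C]_N) = 0.
    apply: annA => [|v [iv]]; first exact: herm_q.
    rewrite hformE // => -[e].
    have [->|v0] := eqVneq v 0; first by rewrite hfE /hform mulmx0 mxE.
    by have := posdef_hf_gt0 pA v0; rewrite e ltNge m0.
  move/q_eq0/matrixP/(_ (Ordinal N_gt0) 0)/eqP.
  by rewrite !mxE !eqxx oner_eq0.
have MA : unitvec (m^-1%:C *: A) = minvec D A.
  apply/seteqP; split=> v [iv]; rewrite ?hfZ => e; split=> //.
    rewrite hformE // -/m; congr (_%:C).
    by apply: (mulfI (invr_neq0 (lt0r_neq0 m0))); rewrite e mulVf ?lt0r_neq0.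
  by move: e; rewrite hformE // hfZ => -[->]; rewrite mulVf ?lt0r_neq0.
exists (m^-1%:C *: A); last exact: MA.
split.
- apply: posdefP => [|v v0]; first exact: hermZ.
  by rewrite hfZ mulr_gt0 ?invr_gt0 ?posdef_hf_gt0.
- move=> v iv v0; rewrite hfZ mulrC ler_pdivlMr // mul1r /m minformE.
  apply: ge_inf; first by exists 0 => _ [u _ <-]; exact: hf_ge0.
  by exists v => //; split=> //; exact/eqP.
- by rewrite MA.
Qed.

Lemma normperfect_perfect A : normperfect A -> perfect D A.
Proof.
move=> nA; have [pA _ aA] := nA; split=> //; rewrite minvec_normperfect //.
have hS : (@q R N) @` unitvec A `<=` [set B | B \is hermsymmx].
  by move=> _ [v _ <-]; exact: herm_q.
apply/(rspan_full hS)/(dim_rspan_full hS) => G hG h; apply: aA => // v Mv.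
by rewrite -ip_q; apply: h; exists v.
Qed.

(* Comparing the linear forms <A,.> and <B,.> shows that the intersection of
   the cones of A and B is a common face. *)
Lemma pcone_le A B x : normperfect A -> normperfect B -> pcone B x ->
  ip B x <= ip A x.
Proof.
move=> nA nB; have fB := finite_unitvec nB.
move=> /(perfect_coneP _ fB)[_ [l l0 ->]]; rewrite !ip_cone big_seq [leRHS]big_seq.
apply: ler_sum => v; rewrite in_fset_set // inE => Bv; rewrite Bv.2 mulr1 ler_peMr //.
by case: nA => _ mA _; apply: mA; [exact: Bv.1 | exact: unitvec_neq0 Bv].
Qed.

Lemma pcone_eq A B x : normperfect A -> normperfect B -> pcone B x ->
  ip A x = ip B x -> perfect_cone (unitvec B `&` unitvec A) x.
Proof.
move=> nA nB; have fB := finite_unitvec nB.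
have fBA : finite_set (unitvec B `&` unitvec A) by apply: sub_finite_set fB => ? [].
move=> /(perfect_coneP _ fB)[x0 [l l0 xE]] e; apply/(perfect_coneP _ fBA); split=> //.
exists l => //.
have Avge1 v : unitvec B v -> 1 <= hf A v.
  by case: nA => _ mA _ Bv; apply: mA; [exact: Bv.1 | exact: unitvec_neq0 Bv].
(* A vanishing sum of nonnegative terms: a coefficient can be nonzero only at vectors that are
   minimal for [A] too. *)
have z : \sum_(v <- fset_set (unitvec B)) l v * (hf A v - hf B v) = 0.
  under eq_bigr do rewrite mulrBr.
  by rewrite sumrB -2!ip_cone -xE e subrr.
have zv v : v \in fset_set (unitvec B) -> l v * (hf A v - hf B v) = 0.
  move: z; rewrite big_seq => /eqP; rewrite psumr_eq0.
    by move=> /allP h vB; have := h v vB; rewrite vB /= => /eqP.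
  move=> u; rewrite in_fset_set // inE => Bu.
  by rewrite mulr_ge0 // subr_ge0 Bu.2 Avge1.
rewrite xE [RHS](@big_fset_incl _ _ _ _ _ (fset_set (unitvec B))) //.
  by rewrite -fset_set_sub // => ? [].
move=> v vB; rewrite in_fset_set // => vA.
have := zv v vB; move/eqP; rewrite mulf_eq0 => /orP[/eqP -> |].
  by rewrite scale0r.
move: (vB); rewrite in_fset_set // inE => -[iv ev]; rewrite ev subr_eq0 => /eqP eA.
by case/negP: vA; rewrite inE.
Qed.

(** The rays of the cone of [A] lie in both cones, so both inequalities of [pcone_le] hold there and
    [A - B] vanishes at the minimal vectors of [A]. *)
Lemma pcone_sub_inj A B : normperfect A -> normperfect B ->
  pcone A `<=` pcone B -> A = B.
Proof.
move=> nA nB sub; apply/eqP; rewrite -subr_eq0; apply/eqP.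
have [_ _ aA] := nA; apply: aA => [|v Av].
  by apply: hermB; exact: normperfect_herm.
have cA : pcone A (q v).
  by apply: perfect_cone_q; [exact: finite_unitvec | | exact: unitvec_neq0 Av].
rewrite hfB -!ip_q; apply/eqP; rewrite subr_eq0 eq_le.
by rewrite (pcone_le nB nA cA) (pcone_le nA nB (sub _ cA)).
Qed.

Lemma pcone_inj A B : normperfect A -> normperfect B -> pcone A = pcone B -> A = B.
Proof. by move=> nA nB e; apply: pcone_sub_inj => //; rewrite e. Qed.

Lemma is_cellP c : is_cell D c <->
  exists P : set 'M[C]_N, [/\ P !=set0, P `<=` normperfect &
    c = \bigcap_(A in P) pcone A].
Proof.
split=> -[P [P0 Pp ->]].
  exists [set B | normperfect B /\ exists2 A, P A & unitvec B = minvec D A].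
  split.
  - have [A PA] := P0; have [B nB e] := perfect_normperfect (Pp _ PA).
    by exists B; split=> //; exists A.
  - by move=> B [].
  - apply/seteqP; split=> x h A.
      by move=> [nA [B PB e]]; rewrite /pcone e; exact: h.
    move=> PA; have [B nB e] := perfect_normperfect (Pp _ PA).
    by rewrite -e; apply: h; split=> //; exists A.
exists P; split=> //; first by move=> A /Pp/normperfect_perfect.
apply/seteqP; split=> x h A PA; have := h A PA; rewrite /pcone minvec_normperfect //;
  exact: Pp.
Qed.

(** A point of all the cones pairs equally with all forms of [P], so in its expansion over the
    minimal vectors of [A] every vector with nonzero coefficient is minimal for each of them. *)
Lemma cell_pcone (P : set 'M[C]_N) A : P `<=` normperfect -> P A ->
  \bigcap_(B in P) pcone B = perfect_cone (\bigcap_(B in P) unitvec B).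
Proof.
move=> Pn PA; have nA := Pn A PA; have fA := finite_unitvec nA.
have sub : \bigcap_(B in P) unitvec B `<=` unitvec A by move=> v; exact.
have fP := sub_finite_set sub fA.
apply/seteqP; split=> x.
  move=> h; have /(perfect_coneP _ fA)[x0 [l l0 xE]] := h A PA.
  apply/(perfect_coneP _ fP); split=> //; exists l => //.
  rewrite xE [RHS](@big_fset_incl _ _ _ _ _ (fset_set (unitvec A))) //.
    by rewrite -fset_set_sub.
  move=> v vA; rewrite in_fset_set // => vP.
  suff -> : l v = 0 by rewrite scale0r.
  apply/eqP/negPn/negP => lv; case/negP: vP; rewrite inE => B PB.
  have nB := Pn B PB.
  have e : ip A x = ip B x.
    apply/eqP; rewrite eq_le.
    by rewrite (pcone_le nA nB (h B PB)) (pcone_le nB nA (h A PA)).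
  have z : \sum_(v <- fset_set (unitvec A)) l v * (hf B v - hf A v) = 0.
    under eq_bigr do rewrite mulrBr.
    by rewrite sumrB -!ip_cone -xE e subrr.
  move: z; rewrite big_seq => /eqP; rewrite psumr_eq0.
    move=> /allP/(_ v vA); rewrite vA /= mulf_eq0 (negPf lv) /= subr_eq0.
    by move: vA; rewrite in_fset_set // inE => -[iv ->] /eqP.
  move=> u; rewrite in_fset_set // inE => Au; rewrite mulr_ge0 // subr_ge0 Au.2.
  by case: nB => _ mB _; apply: mB; [exact: Au.1 | exact: unitvec_neq0 Au].
move=> h B PB; apply: perfect_cone_sub h; first exact/finite_unitvec/Pn.
by move=> v; exact.
Qed.

Lemma cell_herm c : is_cell D c -> c `<=` [set B | B \is hermsymmx].
Proof.
move=> /is_cellP[P [[A PA] Pn ->]] x /(_ A PA).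
exact/perfect_cone_herm/finite_unitvec/Pn.
Qed.

Lemma pcone_cell A : normperfect A -> is_cell D (pcone A).
Proof.
move=> nA; apply/is_cellP; exists [set A]; split; first by exists A.
  by move=> _ ->.
by rewrite bigcap_set1.
Qed.

Lemma dim_pcone A : normperfect A -> \dim (rspan (pcone A)) = (N * N)%N.
Proof.
move=> nA; have [_ _ aA] := nA.
apply/dim_rspan_full; first exact/cell_herm/pcone_cell.
move=> G hG h; apply: aA => //.
by apply/perfect_cone_ann; [exact: finite_unitvec | exact: unitvecN0 | exact: h].
Qed.

Lemma sqrN_pred : (N ^ 2).-1.+1 = (N * N)%N.
Proof. by rewrite prednK ?expn_gt0 ?N_gt0 // mulnn. Qed.

Lemma perfect_cone_sum_q M v0 : finite_set M -> M v0 ->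
  posdef (\sum_(v <- fset_set M) q v) ->
  perfect_cone M (\sum_(v <- fset_set M) q v).
Proof.
move=> fM Mv0 pS; apply/perfect_coneP => //; split.
  apply/eqP => e; move: pS; rewrite e => /posdef_hf_gt0.
  move=> /(_ (delta_mx (Ordinal N_gt0) 0)); rewrite hf0 ltxx => h.
  have : is_true false.
    apply: h; apply/eqP => /matrixP/(_ (Ordinal N_gt0) 0)/eqP.
    by rewrite !mxE !eqxx oner_eq0.
  by [].
exists (fun=> 1) => //; by apply: eq_bigr => v _; rewrite scale1r.
Qed.

Lemma pcone_inner A : normperfect A -> inner_cell D (N ^ 2)%N.-1 (pcone A).
Proof.
move=> nA; have fA := finite_unitvec nA; have [v0 Av0] := exists_unitvec nA.
split; first exact: pcone_cell.
  by rewrite dim_pcone // sqrN_pred.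
have pS := posdef_sum_q fA (fun u => @ortho_unitvec A u nA).
exists (\sum_(v <- fset_set (unitvec A)) q v); split=> //.
exact: perfect_cone_sum_q fA Av0 pS.
Qed.

(** The cell spans all Hermitian matrices, while any two forms whose cones contain it agree on it;
    so only one cone occurs in the intersection. *)
Lemma inner_pcone c : inner_cell D (N ^ 2)%N.-1 c ->
  exists2 A, normperfect A & c = pcone A.
Proof.
move=> [cc]; rewrite sqrN_pred => dc _.
have /(dim_rspan_full (cell_herm cc)) ann := dc.
move: cc ann => /is_cellP[P [[A PA] Pn ->]] ann; exists A; first exact: Pn.
apply/seteqP; split=> [x|x Ax B PB]; first exact.
suff -> : B = A by [].
apply/eqP; rewrite -subr_eq0; apply/eqP/ann => [|y cy].
  by apply: hermB; apply/normperfect_herm/Pn.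
rewrite ipDl ipNl; apply/eqP; rewrite subr_eq0 eq_le.
have nA := Pn A PA; have nB := Pn B PB.
by rewrite (pcone_le nB nA (cy A PA)) (pcone_le nA nB (cy B PB)).
Qed.

End PerfectForms.

(** * The action of Gamma *)

Section Equivariance.
Variables (R : realType) (D : int) (N : nat).
Hypotheses (D_lt0 : D < 0) (N_gt0 : (0 < N)%N).
Local Notation C := R[i].
Implicit Types (A B G F x g h : 'M[C]_N) (u v : 'cV[C]_N) (M : set 'cV[C]_N)
  (c t : set 'M[C]_N).
Local Notation Gamma := (@Gamma R D N).

Lemma Gamma_unit g : Gamma g -> g \in unitmx. Proof. by case. Qed.

Lemma Gamma1 : Gamma 1%:M.
Proof.
have i1 : @intmx R D N N 1%:M.
  by move=> i j; rewrite mxE; exact: (ringint_int R D (i == j)).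
by split; rewrite ?unitmx1 ?invmx1.
Qed.

Lemma GammaV g : Gamma g -> Gamma (invmx g).
Proof. by move=> [ug ig jg]; split; rewrite ?unitmx_inv ?invmxK. Qed.

Lemma GammaM g h : Gamma g -> Gamma h -> Gamma (g *m h).
Proof.
move=> [ug ig jg] [uh ih jh]; split; first by rewrite unitmx_mul ug.
  exact: intmxM.
have -> : invmx (g *m h) = invmx h *m invmx g.
  apply: (can_inj (mulKmx (_ : g *m h \in unitmx))); first by rewrite unitmx_mul ug.
  rewrite mulmxV ?unitmx_mul ?ug // mulmxA -(mulmxA g) mulmxV // mulmx1.
  by rewrite mulmxV.
exact: intmxM.
Qed.

Lemma image_gactE g c x : g \in unitmx ->
  (gact g @` c) x <-> c (gact (invmx g) x).
Proof.
move=> ug; split=> [[y cy <-]|cx]; first by rewrite gactK.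
by exists (gact (invmx g) x); rewrite ?gactVK.
Qed.

Lemma image_gactM g h c : gact (g *m h) @` c = gact g @` (gact h @` c).
Proof.
apply/seteqP; split=> [_ [x cx <-]|_ [_ [x cx <-] <-]]; last first.
  by exists x; rewrite ?gactM.
by rewrite gactM; exists (gact h x) => //; exists x.
Qed.

Lemma image_gact1 c : gact 1%:M @` c = c.
Proof.
apply/seteqP; split=> [_ [x cx <-]|x cx]; first by rewrite gact1.
by exists x; rewrite ?gact1.
Qed.

Lemma image_gactK g c : g \in unitmx -> gact (invmx g) @` (gact g @` c) = c.
Proof. by move=> ug; rewrite -image_gactM mulVmx // image_gact1. Qed.

Lemma image_gactVK g c : g \in unitmx -> gact g @` (gact (invmx g) @` c) = c.
Proof. by move=> ug; rewrite -image_gactM mulmxV // image_gact1. Qed.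

(* Contragredient to [gact]. *)
Definition form_act g A := (invmx g)^t* *m A *m invmx g.

Lemma hf_form_act g A v : hf (form_act g A) v = hf A (invmx g *m v).
Proof. by rewrite !hfE hform_mulmx. Qed.

Lemma herm_form_act g A : A \is hermsymmx -> form_act g A \is hermsymmx.
Proof.
by move=> /hermP hA; apply/hermP; rewrite /form_act !trmxCM trmxCK hA mulmxA.
Qed.

Lemma mulmx_unit_eq0 g v : g \in unitmx -> (g *m v == 0) = (v == 0).
Proof.
move=> ug; apply/eqP/eqP => [e|->]; last exact: mulmx0.
by rewrite -(mulKmx ug v) e mulmx0.
Qed.

Lemma unitvec_form_act g A v : Gamma g ->
  unitvec D (form_act g A) v <-> unitvec D A (invmx g *m v).
Proof.
move=> [ug ig jg]; rewrite /unitvec /= hf_form_act.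
split=> -[iv e]; split=> //; first exact: intmxM.
by rewrite -(mulKVmx ug v); exact: intmxM.
Qed.

Lemma normperfect_form_act g A :
  Gamma g -> normperfect D A -> normperfect D (form_act g A).
Proof.
move=> Gg [pA mA aA]; have [ug ig jg] := Gg; split.
- apply: posdefP => [|v v0]; first exact/herm_form_act/posdef_herm.
  by rewrite hf_form_act posdef_hf_gt0 // mulmx_unit_eq0 ?unitmx_inv.
- move=> v iv v0; rewrite hf_form_act; apply: mA; first exact: intmxM.
  by rewrite mulmx_unit_eq0 ?unitmx_inv.
- move=> G hG h.
  have e : form_act (invmx g) G = 0.
    apply: aA => [|v Av]; first exact: herm_form_act.
    rewrite hf_form_act invmxK; apply: h.
    by apply/unitvec_form_act => //; rewrite mulKmx.
  have -> : G = form_act g (form_act (invmx g) G).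
    rewrite /form_act invmxK !mulmxA -trmxCM mulmxV // trmxC1 mul1mx.
    by rewrite -mulmxA mulmxV // mulmx1.
  by rewrite e /form_act mulmx0 mul0mx.
Qed.

Lemma sub_image_perfect_cone g M : g \in unitmx -> finite_set M ->
  gact g @` perfect_cone M `<=` perfect_cone (mulmx g @` M).
Proof.
move=> ug fM _ [x /(perfect_coneP _ fM)[x0 [l l0 xE]] <-].
have fgM : finite_set (mulmx g @` M) by exact: finite_image.
apply/(perfect_coneP _ fgM); split.
  apply: contra x0 => /eqP e; apply/eqP.
  by rewrite -(gactK ug x) e gact0.
exists (fun v => l (invmx g *m v)) => //.
rewrite xE gact_sum fset_set_image // big_imfset /=; last first.
  by move=> u v _ _ /(can_inj (mulKmx ug)).
by apply: eq_bigr => v _; rewrite gactZ gact_q mulKmx.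
Qed.

Lemma unitvec_image g A : Gamma g ->
  mulmx g @` unitvec D A = unitvec D (form_act g A).
Proof.
move=> Gg; have ug := Gamma_unit Gg; apply/seteqP; split=> v.
  by move=> [u Au <-]; apply/unitvec_form_act => //; rewrite mulKmx.
by move=> /(unitvec_form_act _ _ Gg) Av; exists (invmx g *m v); rewrite // mulKVmx.
Qed.

Lemma image_pcone g A : Gamma g -> normperfect D A ->
  gact g @` pcone D A = pcone D (form_act g A).
Proof.
move=> Gg nA; have ug := Gamma_unit Gg; apply/seteqP; split.
  rewrite /pcone -unitvec_image //.
  by apply: sub_image_perfect_cone => //; exact: finite_unitvec.
move=> x gx; apply/image_gactE => //.
have nB := normperfect_form_act Gg nA.
have : (gact (invmx g) @` pcone D (form_act g A)) (gact (invmx g) x) by exists x.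
move/(sub_image_perfect_cone (_ : invmx g \in unitmx) (finite_unitvec D_lt0 nB)).
rewrite unitmx_inv => /(_ ug); rewrite -unitvec_image // image_comp.
suff -> : (mulmx (invmx g) \o mulmx g) @` unitvec D A = unitvec D A by [].
apply/seteqP; split=> [_ [v Av <-]|v Av]; first by rewrite /= mulKmx.
by exists v; rewrite //= mulKmx.
Qed.

Lemma image_cell g c : Gamma g -> is_cell D c -> is_cell D (gact g @` c).
Proof.
move=> Gg /(is_cellP D N_gt0)[P [[A0 PA0] Pn ->]].
have ug := Gamma_unit Gg.
apply/(is_cellP D N_gt0); exists (form_act g @` P); split.
- by exists (form_act g A0), A0.
- by move=> _ [A PA <-]; apply: normperfect_form_act => //; exact: Pn.
- apply/seteqP; split=> x.
    move=> [y cy <-] _ [A PA <-]; rewrite -image_pcone //; last exact: Pn.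
    by exists y => //; exact: cy.
  move=> h; apply/image_gactE => // A PA; apply/image_gactE => //.
  by rewrite image_pcone //; [apply: h; exists A | exact: Pn].
Qed.

Definition gact_reim g (y : 'M[R]_N * 'M[R]_N) := reim (gact g (unreim y)).

Fact gact_reim_is_linear g : linear (gact_reim g).
Proof.
move=> r y z; rewrite /gact_reim; rewrite -reimZ -reimD; congr reim.
have -> : unreim (r *: y + z) = r%:C *: unreim y + unreim z.
  by apply: (can_inj (@reimK _ _)); rewrite reimD reimZ !unreimK.
by rewrite gactD gactZ.
Qed.

HB.instance Definition _ g := GRing.isLinear.Build R _ _ _
  (gact_reim g) (gact_reim_is_linear g).

Lemma dim_image_gact_le g c :
  (\dim (rspan (gact g @` c)) <= \dim (rspan c))%N.
Proof.
pose f := linfun (gact_reim g).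
rewrite -(limg_ker_dim f (rspan c)); apply: leq_trans (leq_addl _ _).
apply: dimvS; apply: rspan_sub => _ [x cx <-].
have -> : reim (gact g x) = f (reim x) by rewrite lfunE /= /gact_reim reimK.
by rewrite memv_img ?mem_rspan.
Qed.

Lemma dim_image_gact g c : g \in unitmx ->
  \dim (rspan (gact g @` c)) = \dim (rspan c).
Proof.
move=> ug; apply/eqP; rewrite eqn_leq dim_image_gact_le /=.
by rewrite -{1}(image_gactK c ug) dim_image_gact_le.
Qed.

Lemma mem_rspan_gact g c x :
  reim x \in rspan c -> reim (gact g x) \in rspan (gact g @` c).
Proof.
pose f := linfun (gact_reim g).
have fE y : f (reim y) = reim (gact g y) by rewrite lfunE /= /gact_reim reimK.
have /subvP sub : (rspan c <= f @^-1: rspan (gact g @` c))%VS.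
  by apply: rspan_sub => y cy; rewrite -memv_preim fE mem_rspan //; exists y.
by move=> /sub; rewrite -memv_preim fE.
Qed.

(** The hypothesis on orthogonal vectors says that [M] spans. With the elements of [M] as columns of
    [B], [g] is recovered from [g *m B], whose entries lie in a finite set. *)
Lemma finite_mulmx_set M (S : set 'cV[C]_N) : finite_set M -> finite_set S ->
  (forall u, (forall v, M v -> (v^t* *m u) 0 0 = 0) -> u = 0) ->
  finite_set [set g : 'M[C]_N | forall v, M v -> S (g *m v)].
Proof.
move=> fM fS spanM; pose s := fset_set M : seq _.
pose B : 'M[C]_(N, size s) := \matrix_(i, j) (s`_j) i 0.
have Ms (j : 'I_(size s)) : M s`_j.
  by have : s`_j \in fset_set M; [exact: mem_nth | rewrite in_fset_set ?inE].
have fB : row_free B.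
  rewrite -kermx_eq0; apply/eqP/row_matrixP => i; rewrite row0.
  set r := row i (kermx B).
  have rB : r *m B = 0 by apply/sub_kermxP; exact: row_sub.
  have : r^t* = 0.
    apply: spanM => v Mv.
    have vs : v \in s by rewrite in_fset_set ?inE.
    have -> : v^t* *m r^t* = (r *m v)^t* by rewrite trmxCM.
    have iv : (index v s < size s)%N by rewrite index_mem.
    have : (r *m B) 0 (Ordinal iv) = 0 by rewrite rB mxE.
    rewrite mxE => e; rewrite !mxE (_ : \sum_j _ = 0) ?rmorph0 // -[RHS]e.
    by apply: eq_bigr => k _; rewrite [B _ _]mxE /= nth_index.
  by move=> e; rewrite -(trmxCK r) e; apply/matrixP => a b; rewrite !mxE rmorph0.
pose E := \bigcup_(i in [set: 'I_N]) ((fun v : 'cV[C]_N => v i 0) @` S).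
have fE : finite_set E.
  by apply: bigcup_finite => [|i _]; [exact: finite_finset | exact: finite_image].
apply: (@sub_finite_set _ _ ((fun X => X *m pinvmx B) @`
   [set X : 'M[C]_(N, size s) | forall i j, E (X i j)])); last first.
  exact/finite_image/finite_mx_entries.
move=> g hg; exists (g *m B); last by rewrite mulmxKp.
move=> i j; exists i => //; exists (g *m s`_j); first exact/hg/Ms.
by rewrite !mxE; apply: eq_bigr => k _; rewrite mxE.
Qed.

(** A form is determined by its cone, so such a [g] carries the minimal vectors of [A] to those of
    [B]. For [A] = [B] this is finiteness of stabilisers. *)
Lemma finite_pcone_maps A B : normperfect D A -> normperfect D B ->
  finite_set [set g | Gamma g /\ gact g @` pcone D A = pcone D B].
Proof.
move=> nA nB.
have fin := finite_mulmx_set (finite_unitvec D_lt0 nA) (finite_unitvec D_lt0 nB)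
  (fun u => @ortho_unitvec _ _ _ A u nA).
apply: sub_finite_set fin => g [Gg e] v Av.
have -> : B = form_act g A.
  apply: (pcone_inj D_lt0 nB (normperfect_form_act Gg nA)).
  by rewrite -e image_pcone.
by rewrite -unitvec_image //; exists v.
Qed.

(** At a minimal vector of [B] the value 1 is a proper mean of values of [A] and [G] that are at
    least 1, so both are 1; then [G - A] vanishes on a set that determines it. *)
Lemma collinear_normperfect A B G (s : R) : normperfect D A -> normperfect D B ->
  normperfect D G -> 0 < s < 1 -> B = A + s%:C *: (G - A) -> G = A.
Proof.
move=> nA nB nG /andP[s0 s1] BE; apply/eqP; rewrite -subr_eq0; apply/eqP.
apply: (normperfect_ann nB); first by apply: hermB;
  [exact: (normperfect_herm nG)|exact: (normperfect_herm nA)].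
move=> v Bv; have v0 := unitvec_neq0 Bv.
have := normperfect_ge1 nA Bv.1 v0; have := normperfect_ge1 nG Bv.1 v0.
have := Bv.2; rewrite BE hfD hfZ !hfB.
move: (hf G v) (hf A v) => a b; nra.
Qed.

(* The forms whose cones contain [t] lie on a line, and of three normalised forms
   on a line the middle one is not perfect. *)
Lemma codim1_cell t : is_cell D t -> (\dim (rspan t)).+1 = (N * N)%N ->
  exists A0 A1, [/\ normperfect D A0, normperfect D A1,
    t = pcone D A0 `&` pcone D A1, ann_line t (A1 - A0) &
    forall A, normperfect D A -> t `<=` pcone D A -> A = A0 \/ A = A1].
Proof.
move=> ct dt.
have [F [hF F0 Ft Fl]] := (dim_rspan_hyperplane (cell_herm D_lt0 N_gt0 ct)).1 dt.
have [P [[A0 PA0] Pn tE]] := (is_cellP D N_gt0 t).1 ct.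
have [A1 PA1 A10] : exists2 A1, P A1 & A1 != A0.
  apply: contrapT => h; have tA0 : t = pcone D A0.
    rewrite tE; apply/seteqP; split=> x; first exact.
    move=> xA B PB; suff -> : B = A0 by [].
    by apply/eqP/negPn/negP => BA; apply: h; exists B.
  by move: dt; rewrite tA0 dim_pcone //; [lia | exact: Pn].
have n0 := Pn _ PA0; have n1 := Pn _ PA1.
have tP A : P A -> t `<=` pcone D A by move=> PA; rewrite tE => x; exact.
have diff A : normperfect D A -> t `<=` pcone D A ->
    (A - A0 \is hermsymmx) /\ forall x, t x -> ip (A - A0) x = 0.
  move=> nA tA; split.
    by apply: hermB; [exact: (normperfect_herm nA)|exact: (normperfect_herm n0)].
  move=> x tx; rewrite ipDl ipNl; apply/eqP; rewrite subr_eq0 eq_le.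
  by rewrite (pcone_le D_lt0 n0 nA (tA x tx)) (pcone_le D_lt0 nA n0 (tP _ PA0 x tx)).
have [hF1 F1t] := diff _ n1 (tP _ PA1).
have [c1 c1E] := Fl _ hF1 F1t.
have c10 : c1 != 0.
  apply: contra A10 => /eqP c0; rewrite -subr_eq0 c1E c0.
  by rewrite rmorph0 scale0r.
have line G : G \is hermsymmx -> (forall x, t x -> ip G x = 0) ->
    exists r : R, G = r%:C *: (A1 - A0).
  move=> hG Gt; have [c cE] := Fl _ hG Gt; exists (c / c1).
  by rewrite c1E scalerA -rmorphM /= divfK.
have only A : normperfect D A -> t `<=` pcone D A -> A = A0 \/ A = A1.
  move=> nA tA; have [hFA FAt] := diff _ nA tA; have [r rE] := line _ hFA FAt.
  have AE : A = A0 + r%:C *: (A1 - A0) by rewrite -rE addrC subrK.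
  (* [A] has parameter r on the line with [A0] at 0 and [A1] at 1. For other values of r one of the
     three forms lies strictly between the other two, at the parameter passed to
     [collinear_normperfect]. *)
  have [r0|r0|r0] := ltgtP r 0; last by left; rewrite AE r0 scale0r addr0.
  - suff : A1 = A by right.
    have r1 : 0 < 1 - r by lra.
    apply: (@collinear_normperfect A A0 A1 (- r / (1 - r)) nA n0 n1).
      by rewrite divr_gt0 ?ltr_pdivrMr //= ?oppr_gt0 //; lra.
    have e : A1 - A = (1 - r)%:C *: (A1 - A0).
      by rewrite {1}AE opprD addrA rmorphB rmorph1 scalerBl scale1r.
    rewrite e scalerA -rmorphM /= divfK ?lt0r_neq0 // rmorphN scaleNr -rE.
    by rewrite opprB addrC subrK.
  - have [r1|r1|r1] := ltgtP r 1; last by right; rewrite AE r1 scale1r addrC subrK.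
    + suff e : A1 = A0 by rewrite e eqxx in A10.
      by apply: (@collinear_normperfect A0 A A1 r n0 nA n1); rewrite ?r0.
    + suff : A = A0 by left.
      apply: (@collinear_normperfect A0 A1 A r^-1 n0 n1 nA).
        by rewrite invr_gt0 r0 invf_lt1.
      rewrite rE scalerA -rmorphM /= mulVf ?gt_eqF // scale1r.
      by rewrite addrC subrK.
exists A0, A1; split=> //.
  apply/seteqP; split=> [x tx|x [x0 x1]]; first by split; apply: tP.
  rewrite tE => A PA; have [->|->] // := only A (Pn A PA) (tP A PA).
by split=> //; rewrite subr_eq0.
Qed.

Lemma codim1_side t A0 A1 x : normperfect D A0 -> normperfect D A1 ->
  t = pcone D A0 `&` pcone D A1 -> (pcone D A0 `\` t) x -> 0 < ip (A1 - A0) x.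
Proof.
move=> n0 n1 tE [x0 xt]; rewrite ipDl ipNl subr_gt0 lt_def.
rewrite (pcone_le D_lt0 n1 n0 x0) andbT.
apply/eqP => e; apply: xt; rewrite tE; split=> //.
apply: perfect_cone_sub (pcone_eq D_lt0 n1 n0 x0 e); first exact: finite_unitvec.
by move=> v [].
Qed.

End Equivariance.

(** * Orientations and walls *)

(** Left multiplication by the block diagonal matrix with blocks P and 1. Rows are indexed by [nat]
    so that [m] can be replaced by [n + k] without casts. *)
Lemma det_rows_comb (K : comNzRingType) m n k (f f' : nat -> 'rV[K]_m)
    (P : 'M[K]_n) : (n + k = m)%N ->
  (forall i : 'I_n, f' i = \sum_(j < n) P i j *: f j) ->
  (forall i, (n <= i)%N -> f' i = f i) ->
  \det (\matrix_(i < m) f' i) = \det P * \det (\matrix_(i < m) f i).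
Proof.
move=> e; case: m / e f f' => f f' h1 h2.
have split_rows (h : nat -> 'rV[K]_(n + k)) : \matrix_(i < n + k) h i =
    col_mx (\matrix_(i < n) h i) (\matrix_(i < k) h (n + i)%N).
  apply/matrixP => i j; rewrite !mxE; case: splitP => l il; rewrite mxE.
    by rewrite il.
  by rewrite il.
have -> : \matrix_(i < n + k) f' i =
    block_mx P 0 0 (1%:M : 'M_k) *m \matrix_(i < n + k) f i.
  rewrite !split_rows mul_block_col !mul0mx add0r addr0 mul1mx.
  congr col_mx; apply/row_matrixP => i; rewrite ?row_mul !rowK.
    rewrite mulmx_sum_row h1; apply: eq_bigr => j _.
    by rewrite rowK !mxE.
  by rewrite h2 ?leq_addr.
by rewrite det_mulmx det_ublock det1 mulr1.
Qed.

Section Volume.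
Variables (R : realType) (N : nat).
Local Notation C := R[i].
Local Notation HR := ('M[R]_N * 'M[R]_N)%type.
Implicit Types (A F X g : 'M[C]_N) (b c : seq 'M[C]_N) (W : {vspace HR}).

(* The coordinates are those of the complex space of all matrices, of which the
   Hermitian matrices are a real form. A real change of basis multiplies this
   determinant by a real one, and the action of g in GL_N(C) by the positive
   number |det g|^(2N), so that it detects orientations. *)
Definition volume b : C := \det (\matrix_(i < N * N) mxvec b`_i).

(** Bridge between signs inside a subspace and [volume]: both families are completed by the same
    tail [c], and the factor is the determinant whose sign defines [rsign]. *)
Lemma rsign_volume b b' c W : basis_of W (map (@reim R N) b) ->
  (forall i, (i < size b)%N -> reim b'`_i \in W) ->
  size b' = size b -> (size b + size c = N * N)%N ->
  exists2 p : R, rsign b b' = sgz p & volume (b' ++ c) = p%:C * volume (b ++ c).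
Proof.
move=> bW b'W sb sN; set u := map (@reim R N) b.
pose P : 'M[R]_(size u) := \matrix_(i, j) coord (in_tuple u) j (reim b'`_i).
exists (\det P) => //.
have su : size u = size b by rewrite size_map.
rewrite /volume -det_map_mx; apply: (@det_rows_comb _ (N * N) (size u) (size c)
  (fun i => mxvec (b ++ c)`_i) (fun i => mxvec (b' ++ c)`_i)); first by rewrite su.
  move=> i; have ib : (i < size b)%N by rewrite -su.
  rewrite nth_cat sb ib.
  suff -> : b'`_i = \sum_(j < size u) (P i j)%:C *: b`_j.
    rewrite linear_sum; apply: eq_bigr => j _; rewrite linearZ /=.
    by rewrite nth_cat -su ltn_ord [in RHS]mxE mxE.
  apply: (can_inj (@reimK R N)); rewrite reim_sum.
  have bu : basis_of W (in_tuple u) by [].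
  rewrite (coord_basis bu (b'W i ib)); apply: eq_bigr => j _.
  by rewrite reimZ mxE (nth_map 0) // -su.
by move=> i ni; rewrite !nth_cat sb ltnNge -su ni.
Qed.

(** Hermitian matrices independent over R are independent over C: the real and imaginary parts of a
    complex relation give Hermitian X and Y with X + iY = 0, and taking adjoints X - iY = 0. *)
Lemma volume_neq0 b : basis_of (herm_space R N) (map (@reim R N) b) -> volume b != 0.
Proof.
move=> bb; have sb : size b = (N * N)%N.
  by rewrite -(size_map (@reim R N)) -(size_basis (X := in_tuple _) bb)
    dim_herm_space.
set B := \matrix_(i < N * N) mxvec b`_i.
suff : B \in unitmx by rewrite unitmxE unitfE.
rewrite -row_free_unit -kermx_eq0; apply/eqP/row_matrixP => i0; rewrite row0.
set r := row i0 (kermx B).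
have : r *m B = 0 by apply/sub_kermxP; exact: row_sub.
rewrite mulmx_sum_row.
under eq_bigr => i _ do rewrite rowK -linearZ.
rewrite -linear_sum /= => /eqP; rewrite mxvec_eq0 => /eqP rb.
have hb (i : 'I_(N * N)) : b`_i \is hermsymmx.
  rewrite -mem_herm_space -(nth_map 0 0) ?sb //; apply: (basis_mem bb).
  by rewrite mem_nth // size_map sb.
pose X (f : C -> R) := \sum_(i < N * N) (f (r 0 i))%:C *: b`_i.
have hX f : X f \is hermsymmx by apply: herm_sum => i _; apply/hermZ/hb.
have dbl0 (Y : 'M[C]_N) : Y + Y = 0 -> Y = 0.
  by rewrite -mulr2n -scaler_nat => /eqP; rewrite scaler_eq0 pnatr_eq0 => /eqP.
have X0 : X (@complex.Re R) = 0 /\ X (@complex.Im R) = 0.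
  have e1 : X (@complex.Re R) + 'i *: X (@complex.Im R) = 0.
    rewrite scaler_sumr -big_split -[RHS]rb; apply: eq_bigr => i _ /=.
    by rewrite scalerA -scalerDl -complexE.
  have e2 : X (@complex.Re R) - 'i *: X (@complex.Im R) = 0.
    have /hermP hR := hX (@complex.Re R); have /hermP hI := hX (@complex.Im R).
    have := congr1 (fun Y : 'M[C]_N => Y^t*) e1; rewrite trmxCD hR.
    have -> : ('i *: X (@complex.Im R))^t* = - ('i *: X (@complex.Im R)).
      by rewrite -{2}hI; apply/matrixP => k l; rewrite !mxE rmorphM /= conjCi mulNr.
    by move=> ->; apply/matrixP => k l; rewrite !mxE rmorph0.
  split.
    have : X (@complex.Re R) + X (@complex.Re R) = 0.
      by rewrite -[RHS](addr0 0) -{1}e1 -e2 addrACA subrr addr0.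
    by move/dbl0.
  have : 'i *: X (@complex.Im R) = 0.
    have : 'i *: X (@complex.Im R) + 'i *: X (@complex.Im R) = 0.
      have : (X (@complex.Re R) + 'i *: X (@complex.Im R)) -
             (X (@complex.Re R) - 'i *: X (@complex.Im R)) = 0.
        by rewrite e1 e2 subrr.
      by rewrite opprB (addrC (X _)) addrACA subrr addr0.
    by move/dbl0.
  by move/eqP; rewrite scaler_eq0 (negPf (neq0Ci _)) => /eqP.
have fb : free (map (@reim R N) b) := basis_free bb.
have sz : size (map (@reim R N) b) == (N * N)%N by rewrite size_map sb.
pose u := Tuple sz.
have fu : free u by [].
have c0 f : X f = 0 -> forall i, f (r 0 i) = 0.
  move=> /(congr1 (@reim R N)); rewrite reim_sum reim0 => e.
  apply: (freeP fu (fun i => f (r 0 i))); rewrite -[RHS]e; apply: eq_bigr => i _.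
  by rewrite reimZ /= (nth_map 0) ?sb.
apply/rowP => i; rewrite [RHS]mxE; apply: complex_inj.
  by rewrite (c0 _ X0.1).
by rewrite (c0 _ X0.2).
Qed.

(** Right multiplication by [g^t*] is, up to transposition, the complex conjugate of left
    multiplication by [g]. The determinant of the action is therefore the squared modulus of one
    determinant. *)
Lemma volume_gact g b : g \in unitmx -> size b = (N * N)%N ->
  exists2 p : R, 0 < p & volume (map (gact g) b) = p%:C * volume b.
Proof.
move=> ug sb.
pose M1 := lin_mx (mulmx g : 'M[C]_N -> 'M[C]_N).
pose M2 := lin_mx (mulmxr (g^t*) : 'M[C]_N -> 'M[C]_N).
pose T := lin_mx (@trmx C N N).
have TT : T *m T = 1%:M.
  apply/row_matrixP => i; rewrite row_mul !rowE -[delta_mx 0 i]vec_mxK.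
  by rewrite !mul_vec_lin /= trmxK mulmx1.
have M2E : M2 = map_mx Num.conj (T *m M1 *m T).
  apply/row_matrixP => i; rewrite -map_row !rowE -[delta_mx 0 i]vec_mxK.
  rewrite !mulmxA !mul_vec_lin /= map_mxvec trmx_mul trmxK map_mxM.
  congr mxvec; congr (_ *m _); apply/matrixP => k l; rewrite !mxE.
  by rewrite rmorph_nat.
exists (normsq (\det M1)).
  rewrite lt_def normsq_eq0 normsq_ge0 andbT -unitfE -unitmxE.
  have M1V : M1 *m lin_mx (mulmx (invmx g) : 'M[C]_N -> 'M[C]_N) = 1%:M.
    apply/row_matrixP => i; rewrite row_mul !rowE -[delta_mx 0 i]vec_mxK.
    by rewrite !mul_vec_lin /= mulKmx // mulmx1.
  have [uM1 _] := mulmx1_unit M1V; exact: uM1.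
have -> : volume (map (gact g) b) = \det ((\matrix_(i < N * N) mxvec b`_i) *m (M1
  *m M2)).
  congr (\det _); apply/row_matrixP => i; rewrite row_mul !rowK.
  by rewrite (nth_map 0) ?sb // mulmxA !mul_vec_lin.
rewrite !det_mulmx M2E det_map_mx !det_mulmx normsqE.
have dT : \det T * \det T = 1 by rewrite -det_mulmx TT det1.
rewrite mulrC; congr (_ * _); congr (_ * _).
by rewrite mulrAC dT mul1r.
Qed.

(** A row operation: the part of the last vector that lies in the span of [b] does not
    contribute. *)
Lemma volume_rcons b F (c : R) y : (size b).+1 = (N * N)%N ->
  reim y \in <<map (@reim R N) b>>%VS ->
  volume (rcons b (c%:C *: F + y)) = c%:C * volume (rcons b F).
Proof.
move=> sb ys; set u := map (@reim R N) b.
have su : size u = size b by rewrite size_map.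
pose r : 'rV[R]_(size u) := \row_j coord (in_tuple u) j (reim y).
pose P : 'M[R]_(size u + 1) := block_mx 1%:M 0 r c%:M.
have dP : \det P = c by rewrite det_lblock det1 mul1r det_scalar1.
rewrite -[X in _ = X%:C * _]dP.
rewrite /volume -det_map_mx; apply: (@det_rows_comb _ (N * N) (size u + 1) 0
  (fun i => mxvec (rcons b F)`_i) (fun i => mxvec (rcons b _)`_i));
    first by rewrite su addn0 addn1.
  have hb (k : 'I_(size u)) : (k < size b)%N by rewrite -su.
  have blt (k : 'I_(size u)) (z : 'M[C]_N) : (rcons b z)`_k = b`_k.
    by rewrite nth_rcons hb.
  have blast z : (rcons b z)`_(size u + 0) = z.
    by rewrite nth_rcons su addn0 ltnn eqxx.
  move=> i; rewrite big_split_ord /= big_ord1 /= blast map_block_mx.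
  rewrite -(fintype.splitK i); case: (fintype.split i) => {}i /=.
    rewrite blt (bigD1 i) //= blt big1 => [|j ji].
      by rewrite block_mxEul block_mxEur !mxE eqxx rmorph1 rmorph0 scale1r
        scale0r !addr0.
    by rewrite block_mxEul !mxE eq_sym (negPf ji) rmorph0 scale0r.
  rewrite (ord1 i) blast block_mxEdr linearD linearZ /= addrC !mxE; congr (_ + _).
  under eq_bigr => j _ do rewrite block_mxEdl blt -linearZ.
  rewrite -linear_sum; congr mxvec; apply: (can_inj (@reimK R N)).
  rewrite reim_sum (coord_span (X := in_tuple u) ys); apply: eq_bigr => j _.
  by rewrite !mxE reimZ (nth_map 0).
by move=> i; rewrite su addn1 => ib; rewrite !nth_default ?size_rcons.
Qed.

End Volume.

Section Walls.
Variables (R : realType) (D : int) (N : nat).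
Hypotheses (D_lt0 : D < 0) (N_gt0 : (0 < N)%N).
Local Notation C := R[i].
Implicit Types (A B G F x w g h : 'M[C]_N) (b : seq 'M[C]_N)
  (s t c : set 'M[C]_N).
Local Notation Gamma := (@Gamma R D N).
Local Notation pcone := (@pcone R D N).

(** The functional [ip (A1 - A0)] vanishes on the wall, is positive on the rest of the cone of [A0]
    and negative on the rest of the cone of [A1]; the order of the two forms fixes a side. *)
Record wall t A0 A1 : Prop := Wall {
  wall_cell : is_cell D t;
  wall_form0 : normperfect D A0;
  wall_form1 : normperfect D A1;
  wallE : t = pcone A0 `&` pcone A1;
  wall_ann : ann_line t (A1 - A0);
  wall_only : forall A, normperfect D A -> t `<=` pcone A -> A = A0 \/ A = A1 }.

Lemma codim1_wall t : is_cell D t -> (\dim (rspan t)).+1 = (N * N)%N ->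
  exists A0 A1, wall t A0 A1.
Proof.
move=> ct dt; have [A0 [A1 [n0 n1 tE ann only]]] := codim1_cell D_lt0 N_gt0 ct dt.
by exists A0, A1; split.
Qed.

Lemma wall_sym t A0 A1 : wall t A0 A1 -> wall t A1 A0.
Proof.
move=> [ct n0 n1 tE [hF F0 Ft Fl] only].
split; [exact: ct | exact: n1 | exact: n0 | by rewrite setIC | | ].
  rewrite -opprB; split.
  + by rewrite scaleCN1 hermZ.
  + by rewrite oppr_eq0.
  + by move=> x tx; rewrite ipNl Ft ?oppr0.
  + move=> G hG Gt; have [c ->] := Fl G hG Gt; exists (- c).
    by rewrite rmorphN scaleNr scalerN opprK.
by move=> A nA /(only A nA)[]; [right|left].
Qed.

Lemma wall_gt0 t A0 A1 x : wall t A0 A1 -> (pcone A1 `\` t) x ->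
  ip (A1 - A0) x < 0.
Proof.
move=> /wall_sym W xt; rewrite -opprB ipNl oppr_lt0.
by apply: (codim1_side D_lt0 (wall_form0 W) (wall_form1 W) (wallE W)).
Qed.

Lemma wall_lt0 t A0 A1 x : wall t A0 A1 -> (pcone A0 `\` t) x ->
  0 < ip (A1 - A0) x.
Proof.
move=> W xt.
by apply: (codim1_side D_lt0 (wall_form0 W) (wall_form1 W) (wallE W)).
Qed.

Lemma wall_sub0 t A0 A1 : wall t A0 A1 -> t `<=` pcone A0.
Proof. by move=> /wallE -> x []. Qed.

Lemma wall_herm t A0 A1 : wall t A0 A1 -> t `<=` [set B | B \is hermsymmx].
Proof. by move=> /wall_cell ct; apply: (cell_herm D_lt0 N_gt0 ct). Qed.

Lemma wall_dim t A0 A1 : wall t A0 A1 -> (\dim (rspan t)).+1 = (N * N)%N.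
Proof.
move=> W; apply/(dim_rspan_hyperplane (wall_herm W)); exists (A1 - A0).
exact: wall_ann W.
Qed.

Lemma pcone_herm A x : normperfect D A -> pcone A x -> x \is hermsymmx.
Proof. by move=> nA; exact/perfect_cone_herm/finite_unitvec. Qed.

Lemma wall_neq t A0 A1 : wall t A0 A1 -> pcone A0 <> pcone A1.
Proof.
move=> W /(pcone_inj D_lt0 (wall_form0 W) (wall_form1 W)) e.
by have [_] := wall_ann W; rewrite e subrr eqxx.
Qed.

Lemma wall_proper t A0 A1 s : wall t A0 A1 -> s = pcone A0 \/ s = pcone A1 ->
  exists x, (s `\` t) x.
Proof.
move=> W hs; apply: contrapT => /forallNP h.
have st : s `<=` t by move=> x sx; apply: contrapT => tx; apply: (h x).
have ds : \dim (rspan s) = (N * N)%N.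
  by case: hs => ->; rewrite dim_pcone //; [exact: wall_form0 W|exact: wall_form1 W].
by have := dimvS (rspan_mono st); rewrite ds -(wall_dim W) ltnn.
Qed.

Lemma mem_rspan_wall t A0 A1 x : wall t A0 A1 -> x \is hermsymmx ->
  ip (A1 - A0) x = 0 -> reim x \in rspan t.
Proof.
move=> W hx Fx; have [hF F0 Ft _] := wall_ann W; set F := A1 - A0 in hF F0 Ft Fx.
pose V := (herm_space R N :&: orthv <[reim F]>)%VS.
have FV : (<[reim F]> <= herm_space R N)%VS by rewrite -memvE mem_herm_space.
have UV : (rspan t <= V)%VS.
  apply: rspan_sub => y ty; rewrite memv_cap mem_herm_space.
  apply/andP; split; first exact: (wall_herm W ty).
  apply/mem_orthvP => _ /vlineP[c ->].
  by rewrite dotZr dotC -ipE Ft // mulr0.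
have -> : rspan t = V.
  apply/eqP; rewrite eqEdim UV /=.
  have := dim_orthv FV; rewrite dim_herm_space -(wall_dim W) dim_vline.
  have -> : reim F != 0.
    by apply: contra F0; rewrite -reim0 => /eqP/(can_inj (@reimK _ _)) ->.
  by rewrite add1n => -[<-].
rewrite memv_cap mem_herm_space hx; apply/mem_orthvP => _ /vlineP[c ->].
by rewrite dotZr dotC -ipE Fx mulr0.
Qed.

Lemma ip_wall_gt0 t A0 A1 : wall t A0 A1 -> 0 < ip (A1 - A0) (A1 - A0).
Proof.
move=> W; have [_ F0 _ _] := wall_ann W.
rewrite lt_def ipE dot_ge0 andbT -ipE; apply: contra F0 => /eqP/ip_eq0 ->.
exact: eqxx.
Qed.

Lemma size_wall_basis t A0 A1 b : wall t A0 A1 -> rbasis t b ->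
  (size b).+1 = (N * N)%N.
Proof.
move=> W bt; rewrite -(wall_dim W) -(size_map (@reim R N)).
by rewrite -(size_basis (X := in_tuple _) bt).
Qed.

(** The last vector is split orthogonally, and its component in the hyperplane lies in the span of
    the wall. Its sign relative to the normal is thus its side of the wall. *)
Lemma volume_wall t A0 A1 b x : wall t A0 A1 -> rbasis t b -> x \is hermsymmx ->
  volume (rcons b x) = (ip (A1 - A0) x / ip (A1 - A0) (A1 - A0))%:C *
                       volume (rcons b (A1 - A0)).
Proof.
move=> W bt hx; have [hF _ _ _] := wall_ann W; have F0 := ip_wall_gt0 W.
set F := A1 - A0 in hF F0 *; set c := ip F x / ip F F.
have -> : x = c%:C *: F + (x - c%:C *: F) by rewrite addrC subrK.
apply: volume_rcons; first exact: (size_wall_basis W bt).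
rewrite (span_basis bt); apply: (mem_rspan_wall W).
  exact: (hermB hx (hermZ _ hF)).
rewrite -/F ipC ipDl ipNl ipZl ipC divfK ?subrr //.
exact: lt0r_neq0.
Qed.

Lemma basis_wall t A0 A1 b : wall t A0 A1 -> rbasis t b ->
  basis_of (herm_space R N) (map (@reim R N) (rcons b (A1 - A0))).
Proof.
move=> W bt; have [hF _ _ _] := wall_ann W; have F0 := ip_wall_gt0 W.
set F := A1 - A0 in hF F0 *.
rewrite basisEdim size_map size_rcons (size_wall_basis W bt) dim_herm_space leqnn.
rewrite andbT map_rcons -cats1 span_cat span_seq1 (span_basis bt).
apply/subvP => y; rewrite -(unreimK y) mem_herm_space; set x := unreim y => hx.
set c := ip F x / ip F F.
have -> : x = (x - c%:C *: F) + c%:C *: F by rewrite subrK.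
rewrite reimD memv_add //; last by rewrite reimZ memvZ // memv_line.
apply: (mem_rspan_wall W).
  exact: (hermB hx (hermZ _ hF)).
rewrite -/F ipC ipDl ipNl ipZl ipC divfK ?subrr //.
exact: lt0r_neq0.
Qed.

Lemma form_actK g A : g \in unitmx -> form_act (invmx g) (form_act g A) = A.
Proof.
move=> ug; rewrite /form_act invmxK !mulmxA -trmxCM mulVmx // trmxC1 mul1mx.
by rewrite -mulmxA mulVmx // mulmx1.
Qed.

(** The image is a wall between two forms; the transported forms are distinct and their cones
    contain it, so they are these two in some order. *)
Lemma wall_image t A0 A1 g : wall t A0 A1 -> Gamma g ->
  wall (gact g @` t) (form_act g A0) (form_act g A1).
Proof.
move=> W Gg; have ug := Gamma_unit Gg.
have n0 := wall_form0 W; have n1 := wall_form1 W.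
have d : (\dim (rspan (gact g @` t))).+1 = (N * N)%N.
  by rewrite dim_image_gact // (wall_dim W).
have ct := image_cell D_lt0 N_gt0 Gg (wall_cell W).
have [B0 [B1 W']] := codim1_wall ct d.
have s0 : gact g @` t `<=` pcone (form_act g A0).
  rewrite -(image_pcone D_lt0 Gg n0); apply: image_subset; exact: wall_sub0 W.
have s1 : gact g @` t `<=` pcone (form_act g A1).
  rewrite -(image_pcone D_lt0 Gg n1); apply: image_subset;
    exact: wall_sub0 (wall_sym W).
have ne : form_act g A0 <> form_act g A1.
  move=> /(congr1 (form_act (invmx g))); rewrite !form_actK // => e.
  by apply: (wall_neq W); rewrite e.
have m0 := normperfect_form_act Gg n0; have m1 := normperfect_form_act Gg n1.
have [e0|e0] := wall_only W' m0 s0; have [e1|e1] := wall_only W' m1 s1.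
- by case: ne; rewrite e0 e1.
- by rewrite e0 e1.
- by rewrite e0 e1; exact: wall_sym.
- by case: ne; rewrite e0 e1.
Qed.

(* A stabiliser element either preserves the orientation of the wall and both
   of its sides, or reverses it and exchanges the sides, because it preserves
   the orientation of the space of Hermitian forms. *)
Lemma stab_wall t A0 A1 b g : wall t A0 A1 -> rbasis t b -> stab D t g ->
  (rsign b (map (gact g) b) = 1 /\ gact g @` pcone A0 = pcone A0) \/
  (rsign b (map (gact g) b) = -1 /\ gact g @` pcone A0 = pcone A1).
Proof.
move=> W bt [Gg gt]; have ug := Gamma_unit Gg.
have n0 := wall_form0 W; have n1 := wall_form1 W.
have [w wt] := wall_proper W (or_introl (erefl (pcone A0))).
have hw := pcone_herm n0 wt.1.
have sb := size_wall_basis W bt.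
have [p1 e1 v1] : exists2 p : R, rsign b (map (gact g) b) = sgz p &
    volume (map (gact g) b ++ [:: gact g w]) = p%:C * volume (b ++ [:: gact g w]).
  apply: (rsign_volume bt); rewrite ?size_map ?addn1 //.
  move=> i ib; rewrite (nth_map 0) // -gt.
  by apply: mem_rspan_gact; apply: (basis_mem bt); rewrite map_f // mem_nth.
have [|p2 p20 v2] := volume_gact ug (b := rcons b w); first by rewrite size_rcons.
set F := A1 - A0; have F0 := ip_wall_gt0 W; rewrite -/F in F0.
have V0 : volume (rcons b F) != 0 by exact: (volume_neq0 (basis_wall W bt)).
(* The volume of the image of ([b], [w]) is computed twice, through the action on the wall ([p1])
   and on the whole space ([p2], which is positive). The sign of [p1] thus tells on which side [w]
   lands. *)
have key : p1 * ip F (gact g w) = p2 * ip F w.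
  move: v2;
    rewrite map_rcons -cats1 v1 cats1 (volume_wall W bt hw) (volume_wall W bt
      (herm_gact g hw)).
  rewrite -/F !mulrA -!rmorphM /= => /(mulIf V0)/complexI.
  by rewrite !mulrA => /(mulIf (invr_neq0 (lt0r_neq0 F0))).
have Fw : 0 < ip F w := wall_lt0 W wt.
have gw : ((gact g @` pcone A0) `\` t) (gact g w).
  split; first by exists w => //; exact: wt.1.
  rewrite -gt => /(image_gactE _ _ ug); rewrite gactK //; exact: wt.2.
have m0 := normperfect_form_act Gg n0.
have tg : t `<=` pcone (form_act g A0).
  rewrite -(image_pcone D_lt0 Gg n0) -{1}gt; apply: image_subset; exact: wall_sub0 W.
rewrite (image_pcone D_lt0 Gg n0) in gw *.
have pos : 0 < p1 * ip F (gact g w) by rewrite key mulr_gt0.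
have [e|e] := wall_only W m0 tg; rewrite e in gw *; [left|right]; split=> //.
  by rewrite e1; apply: gtr0_sgz; move: pos; rewrite pmulr_lgt0 // (wall_lt0 W gw).
by rewrite e1; apply: ltr0_sgz; move: pos; rewrite nmulr_lgt0 // (wall_gt0 W gw).
Qed.

End Walls.

(** * The boundary *)

Section CellEquivalence.
Variables (R : realType) (D : int) (N : nat).
Implicit Types (g h : 'M[R[i]]_N) (s t c : set 'M[R[i]]_N).

Definition transporter s s' := [set g | Gamma D g /\ gact g @` s = s'].

(** With [t] a wall of [s], these are the walls of [s'] obtained from [t] by elements that also
    carry [s] to [s']: the side from which a wall comes is kept in view. *)
Definition translates t s s' := (fun g => gact g @` t) @` transporter s s'.

Lemma transporterM s1 s2 s3 g h :
  transporter s2 s3 g -> transporter s1 s2 h -> transporter s1 s3 (g *m h).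
Proof.
by move=> [Gg <-] [Gh <-]; split; [exact: GammaM | rewrite image_gactM].
Qed.

Lemma transporterV s s' g : transporter s s' g -> transporter s' s (invmx g).
Proof.
move=> [Gg <-]; split; first exact: GammaV.
by rewrite image_gactK // (Gamma_unit Gg).
Qed.

Lemma transporter1 s : transporter s s 1%:M.
Proof. by split; [exact: Gamma1 | rewrite image_gact1]. Qed.

Lemma cell_equivE c c' : cell_equiv D c c' <-> exists g, transporter c c' g.
Proof. by split=> -[g]; [exists g | case=> ? ?; exists g]. Qed.

Lemma cell_equiv_sym c c' : cell_equiv D c c' -> cell_equiv D c' c.
Proof.
move=> /cell_equivE[g h]; apply/cell_equivE; exists (invmx g).
exact: transporterV.
Qed.

Lemma cell_equiv_trans c1 c2 c3 :
  cell_equiv D c1 c2 -> cell_equiv D c2 c3 -> cell_equiv D c1 c3.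
Proof.
move=> /cell_equivE[g h] /cell_equivE[g' h']; apply/cell_equivE.
by exists (g' *m g); exact: transporterM h' h.
Qed.

Lemma card_fset_set_inj (X Y : choiceType) (f : X -> Y) (A : set X) :
  finite_set A -> injective f -> #|` fset_set (f @` A)| = #|` fset_set A|.
Proof. by move=> fA fI; rewrite fset_set_image // card_imfset. Qed.

Lemma mulmx_unit_inj (g : 'M[R[i]]_N) : g \in unitmx -> injective (@mulmx _ N N N g).
Proof. by move=> ug; exact: can_inj (mulKmx ug). Qed.

Lemma card_transporter s s' g : finite_set (stab D s') -> transporter s s' g ->
  #|` fset_set (transporter s s')| = #|` fset_set (stab D s')|.
Proof.
move=> fs tg; have ug : g \in unitmx := Gamma_unit tg.1.
have -> : transporter s s' = (fun h => h *m g) @` stab D s'.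
  apply/seteqP; split=> [h th|_ [h sh <-]]; last exact: transporterM sh tg.
  exists (h *m invmx g); last by rewrite mulmxKV.
  exact: transporterM th (transporterV tg).
by apply: card_fset_set_inj => //; exact: can_inj (mulmxK ug).
Qed.

(** Orbit counting: the elements sending [t] to a given translate form a coset of its stabiliser,
    which stays inside the transporter because the stabiliser of [t] fixes [s]. *)
Lemma card_transporter_translates t s s' : finite_set (transporter s s') ->
  finite_set (stab D t) -> (forall h, stab D t h -> gact h @` s = s) ->
  #|` fset_set (transporter s s')| =
  (#|` fset_set (translates t s s')| * #|` fset_set (stab D t)|)%N.
Proof.
move=> fG ft ts; rewrite /translates fset_set_image //.
set G := fset_set (transporter s s'); pose phi g := gact g @` t.
rewrite -[#|` G|]sum1_size (partition_big_imfset _ phi) /=.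
transitivity (\sum_(t' <- [fset phi g | g in G]%fset) #|` fset_set (stab D
  t)|)%N; last first.
  by rewrite big_const_seq count_predT iter_addn_0 mulnC.
apply: eq_big_seq => t' /imfsetP[g /= gG ->].
have tg : transporter s s' g by move: gG; rewrite in_fset_set ?inE.
have ug := Gamma_unit tg.1.
rewrite -(card_fset_set_inj ft (mulmx_unit_inj ug)) -sum1_size -big_filter sum1_size.
rewrite sum1_size; apply: perm_size; apply: uniq_perm.
- exact: filter_uniq (fset_uniq _).
- exact: fset_uniq.
- have fim : finite_set (mulmx g @` stab D t) by exact: finite_image.
  move=> h; rewrite mem_filter !in_fset_set //.
  apply/idP/idP => [/andP[/eqP e]|]; rewrite !inE.
    move=> th; exists (invmx g *m h); last by rewrite mulKVmx.
    split; first by apply: GammaM; [exact/GammaV/tg.1 | exact: th.1].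
    by rewrite image_gactM -/(phi h) e image_gactK.
  move=> [k [Gk kt] <-]; apply/andP; split; first by rewrite /phi image_gactM kt.
  rewrite inE; apply: transporterM tg _; split=> //; exact: ts.
Qed.

End CellEquivalence.

Section Incidence.
Variables (R : realType) (D : int) (N : nat).
Hypotheses (D_lt0 : D < 0) (N_gt0 : (0 < N)%N).
Variable o : set 'M[R[i]]_N -> seq 'M[R[i]]_N.
Hypothesis o_basis : forall c, is_cell D c -> rbasis c (o c).
Implicit Types (A F w g h : 'M[R[i]]_N) (s t c : set 'M[R[i]]_N).
Local Notation pcone := (@pcone R D N).

Lemma orientable_pcone A : normperfect D A -> orientable D (pcone A).
Proof.
move=> nA b bA g [Gg gA].
have hA := cell_herm D_lt0 N_gt0 (pcone_cell N_gt0 nA).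
have bH : basis_of (herm_space R N) (map (@reim R N) b).
  by rewrite -((rspan_full hA).2 (dim_pcone D_lt0 N_gt0 nA)).
have sb : size b = (N * N)%N.
  by rewrite -(size_map (@reim R N)) -(size_basis (X := in_tuple _) bH)
    dim_herm_space.
have [p ->] : exists2 p : R, rsign b (map (gact g) b) = sgz p &
    volume (map (gact g) b ++ [::]) = p%:C * volume (b ++ [::]).
  apply: (rsign_volume bH); rewrite ?size_map ?addn0 //.
  move=> i ib; rewrite (nth_map 0) // mem_herm_space herm_gact //.
  rewrite -mem_herm_space; apply: (basis_mem bH).
  by rewrite map_f // mem_nth.
have [r r0] := volume_gact (Gamma_unit Gg) sb; rewrite !cats0 => ->.
by move=> /(mulIf (volume_neq0 bH))/complexI <-; exact: gtr0_sgz.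
Qed.

(** Carrying [w] back by [g] turns the product of the two signs into one comparison of volumes at
    [t]: the orientation of the cone against ([o t], normal), and the side of [t] on which the
    vector lies. The basis chosen for [t'] cancels. *)
Lemma incidence_term t A0 A1 A g w (sigma : R) (t' := gact g @` t) :
  wall D t A0 A1 -> normperfect D A -> Gamma D g -> t' `<=` pcone A ->
  (pcone A `\` t') w -> sigma != 0 ->
  volume (o (pcone A)) = sigma%:C * volume (rcons (o t) (A1 - A0)) ->
  rsign (o t') (map (gact g) (o t)) * rsign (o (pcone A)) (rcons (o t') w) =
  sgz sigma * sgz (ip (A1 - A0) (gact (invmx g) w)).
Proof.
move=> W nA Gg t's wt s0 vs; have ug := Gamma_unit Gg.
have W' := wall_image D_lt0 N_gt0 W Gg; rewrite -/t' in W'.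
have bt := o_basis (wall_cell W); have bt' := o_basis (wall_cell W').
have cA := pcone_cell N_gt0 nA.
have hA := cell_herm D_lt0 N_gt0 cA.
have bs : basis_of (herm_space R N) (map (@reim R N) (o (pcone A))).
  by rewrite -((rspan_full hA).2 (dim_pcone D_lt0 N_gt0 nA)); exact: o_basis.
have sb := size_wall_basis D_lt0 N_gt0 W bt.
have sb' := size_wall_basis D_lt0 N_gt0 W' bt'.
have hw : w \is hermsymmx := pcone_herm D_lt0 nA wt.1.
have ss : size (o (pcone A)) = (N * N)%N.
  by rewrite -(size_map (@reim R N)) -(size_basis (X := in_tuple _) bs)
    dim_herm_space.
have [p1 -> v1] : exists2 p : R, rsign (o t') (map (gact g) (o t)) = sgz p &
    volume (map (gact g) (o t) ++ [:: w]) = p%:C * volume (o t' ++ [:: w]).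
  apply: (rsign_volume bt'); rewrite ?size_map ?addn1 //; last first.
    by apply: succn_inj; rewrite sb.
  move=> i ib; rewrite (nth_map 0); last by move: ib; rewrite -ltnS sb' -sb ltnS.
  apply: mem_rspan_gact; apply: (basis_mem bt); rewrite map_f // mem_nth //.
  by move: ib; rewrite -ltnS sb' -sb ltnS.
have [p2 -> v2] : exists2 p : R, rsign (o (pcone A)) (rcons (o t') w) = sgz p &
    volume (rcons (o t') w ++ [::]) = p%:C * volume (o (pcone A) ++ [::]).
  apply: (rsign_volume bs); rewrite ?size_rcons ?addn0 ?ss //.
  move=> i ib; rewrite nth_rcons; case: ltnP => [it|_].
    apply: (subvP (rspan_herm (wall_herm D_lt0 N_gt0 W'))).
    by apply: (basis_mem bt'); rewrite map_f // mem_nth.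
  case: eqP => _; [by rewrite mem_herm_space | by rewrite reim0 mem0v].
set F := A1 - A0 in vs *; set w' := gact (invmx g) w.
have hw' : w' \is hermsymmx by exact: herm_gact.
have [|p3 p30 v3] := volume_gact ug (b := rcons (o t) w');
  first by rewrite size_rcons.
have F0 := ip_wall_gt0 W; rewrite -/F in F0.
have V0 : volume (rcons (o t) F) != 0.
  exact: (volume_neq0 (basis_wall D_lt0 N_gt0 W bt)).
have key : p1 * (p2 * sigma) = p3 * (ip F w' / ip F F).
  move: v3; rewrite map_rcons gactVK // -cats1 v1 cats1.
  move: v2; rewrite !cats0 => ->; rewrite vs (volume_wall D_lt0 N_gt0 W bt hw') -/F.
  by rewrite !mulrA -!rmorphM /= => /(mulIf V0)/complexI; rewrite !mulrA.
have i0 : 0 < (ip F F)^-1 by rewrite invr_gt0.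
have : sgz (p1 * (p2 * sigma)) = sgz (ip F w').
  by rewrite key !sgzM (gtr0_sgz p30) (gtr0_sgz i0) mul1r mulr1.
rewrite !sgzM => <-.
have ss1 : sgz sigma * sgz sigma = 1 by rewrite -sgzM -expr2 gtr0_sgz // lt_def
  sqrf_eq0 s0 sqr_ge0.
transitivity (sgz p1 * sgz p2 * (sgz sigma * sgz sigma)); last by ring.
by rewrite ss1 mulr1.
Qed.

Lemma incidence_wall t A0 A1 A (sigma : R) :
  wall D t A0 A1 -> orientable D t -> normperfect D A -> sigma != 0 ->
  volume (o (pcone A)) = sigma%:C * volume (rcons (o t) (A1 - A0)) ->
  incidence D o t (pcone A) = sgz sigma *
    (#|` fset_set (translates D t (pcone A0) (pcone A))|%:Z -
     #|` fset_set (translates D t (pcone A1) (pcone A))|%:Z).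
Proof.
move=> W ot nA s0 vs.
have n0 := wall_form0 W; have n1 := wall_form1 W.
have bt := o_basis (wall_cell W).
have st0 h : stab D t h -> gact h @` pcone A0 = pcone A0.
  move=> th; case: (stab_wall D_lt0 N_gt0 W bt th) => -[e //].
  by rewrite (ot _ bt _ th) in e.
have st1 h : stab D t h -> gact h @` pcone A1 = pcone A1.
  move=> th; case: (stab_wall D_lt0 N_gt0 (wall_sym W) bt th) => -[e //].
  by rewrite (ot _ bt _ th) in e.
set T0 := translates D t (pcone A0) (pcone A).
set T1 := translates D t (pcone A1) (pcone A).
have f0 : finite_set T0 by apply/finite_image/finite_pcone_maps.
have f1 : finite_set T1 by apply/finite_image/finite_pcone_maps.
have side B : B = A0 \/ B = A1 -> forall g, transporter D (pcone B) (pcone A) g ->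
    gact g @` t `<=` pcone A.
  move=> hB g [Gg <-]; apply: image_subset.
  by case: hB => ->; [exact: wall_sub0 W | exact: wall_sub0 (wall_sym W)].
(* Undoing the transport of a facet gives a cone that contains [t], hence one of the two cones at
   the wall. *)
have fE : facets D (pcone A) `&` [set t' | cell_equiv D t t'] = T0 `|` T1.
  apply/seteqP; split=> [t' [[ct' t's dt'] [g Gg gt]]|t' h].
    have ug := Gamma_unit Gg.
    have tA : t `<=` pcone (form_act (invmx g) A).
      rewrite -(image_pcone D_lt0 (GammaV Gg) nA) -(image_gactK t ug) gt.
      exact: image_subset.
    have nB := normperfect_form_act (GammaV Gg) nA.
    have gB : gact g @` pcone (form_act (invmx g) A) = pcone A.
      by rewrite -(image_pcone D_lt0 (GammaV Gg) nA) image_gactVK.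
    by case: (wall_only W nB tA) => e; rewrite e in gB; [left|right]; exists g.
  have [B [hB [g tg gt]]] : exists B, (B = A0 \/ B = A1) /\
      exists2 g, transporter D (pcone B) (pcone A) g & gact g @` t = t'.
    by case: h => -[g tg gt]; [exists A0|exists A1]; split;
      [left| exists g| right|exists g].
  have Gg := tg.1; split; last by exists g.
  rewrite -gt; split.
  - exact: (image_cell D_lt0 N_gt0 Gg (wall_cell W)).
  - exact: (side B).
  - by rewrite (dim_image_gact _ (Gamma_unit Gg)) (wall_dim D_lt0 N_gt0 W) dim_pcone.
(* A common translate would give an element of the stabiliser of [t] carrying the cone of [A1] to
   that of [A0], which orientability of [t] forbids. *)
have T01 : T0 `&` T1 `<=` set0.
  move=> t' [[g tg gt] [h th ht]]; apply: (wall_neq D_lt0 W).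
  have ug := Gamma_unit tg.1.
  have sgh : stab D t (invmx g *m h).
    split; first exact: GammaM (GammaV tg.1) th.1.
    by rewrite image_gactM ht -gt image_gactK.
  rewrite -(st1 _ sgh) image_gactM th.2 -tg.2.
  by rewrite image_gactK.
have term B t' : B = A0 \/ B = A1 -> translates D t (pcone B) (pcone A) t' ->
    exists2 w', (pcone B `\` t) w' &
    eta D o t t' * epsilon o t' (pcone A) = sgz sigma * sgz (ip (A1 - A0) w').
  move=> hB [g tg gt].
  (* The [g'] picked by [eta] differs from [g] by an element of the stabiliser of [t], which fixes
     both sides as [t] is orientable; so [g'] also carries the cone of [B] to that of [A]. *)
  rewrite /eta /epsilon; set g' := xget _ _; set w := xget _ _.
  have [Gg' gt'] : Gamma D g' /\ gact g' @` t = t'.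
    by apply: (@xgetPex _ _ [set g | Gamma D g /\ gact g @` t = t']); exists g;
      split=> //; exact: tg.1.
  have ug' := Gamma_unit Gg'.
  have gB : gact (invmx g') @` pcone A = pcone B.
    have sg : stab D t (invmx g' *m g).
      split; first exact: GammaM (GammaV Gg') tg.1.
      by rewrite image_gactM gt -gt' image_gactK.
    rewrite -tg.2 -image_gactM.
    by case: hB => ->; [exact: st0 | exact: st1].
  have t's : t' `<=` pcone A by rewrite -gt; exact: (side B).
  have wt : (pcone A `\` t') w.
    apply: (@xgetPex _ _ (pcone A `\` t')).
    have W' := wall_image D_lt0 N_gt0 W Gg'; rewrite gt' in W'.
    apply: (wall_proper D_lt0 N_gt0 W').
    have := wall_only W' nA t's.
    by case=> ->; [left|right].
  exists (gact (invmx g') w).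
    split; first by rewrite -gB; exists w => //; exact: wt.1.
    move=> tw; apply: wt.2; rewrite -gt'; apply/image_gactE => //.
  rewrite -gt'; apply: incidence_term => //; by rewrite gt'.
rewrite /incidence fE fsbigU0 // mulrBr; congr (_ + _).
  rewrite fsbig_finite // (eq_big_seq (fun=> sgz sigma)) => [|t'].
    by rewrite big_const_seq count_predT iter_addr_0 -mulr_natr natz.
  rewrite in_fset_set // inE => /(term A0)[|w' wt ->]; first by left.
  by rewrite (gtr0_sgz (wall_lt0 D_lt0 W wt)) mulr1.
rewrite fsbig_finite // (eq_big_seq (fun=> - sgz sigma)) => [|t'].
  by rewrite big_const_seq count_predT iter_addr_0 -mulr_natr natz mulNr.
rewrite in_fset_set // inE => /(term A1)[|w' wt ->]; first by right.
by rewrite (ltr0_sgz (wall_gt0 D_lt0 W wt)) mulrN1.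
Qed.

End Incidence.

(** * Boundary coefficients of top-dimensional chains *)

Section Boundary.
Variables (R : realType) (D : int) (N : nat).
Hypotheses (D_lt0 : D < 0) (N_gt1 : (1 < N)%N).
Variables (Sstar : nat -> {fset set 'M[R[i]]_N})
  (o : set 'M[R[i]]_N -> seq 'M[R[i]]_N).
Hypothesis reps : forall n, cell_reps D n (Sstar n).
Hypothesis o_basis : forall c, is_cell D c -> rbasis c (o c).
Hypothesis o_top : forall c c',
  c \in Sstar (N ^ 2)%N.-1 -> c' \in Sstar (N ^ 2)%N.-1 ->
  rsign (o c) (o c') = 1.
Implicit Types (A F w g h : 'M[R[i]]_N) (s t c : set 'M[R[i]]_N).
Local Notation pcone := (@pcone R D N).
Local Notation top := (N ^ 2)%N.-1.
Local Notation Sigma := (Sigma D Sstar).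

Let N_gt0 : (0 < N)%N. Proof. exact: ltnW. Qed.

(** A cell of dimension n has a span of dimension n + 1, so cells of dimension [top.-1] span
    hyperplanes. For N = 1 the truncated predecessor would spoil the count. *)
Lemma sqrN_pred2 : (top.-1.+2 = N * N)%N.
Proof. by rewrite -mulnn; case: N N_gt1 => [|[|k]] //= _; rewrite mulSn. Qed.

Lemma top_rep_form s : s \in Sstar top -> exists2 A, normperfect D A & s = pcone A.
Proof. by move=> /(reps top).1; exact: inner_pcone. Qed.

Lemma rbasis_pcone A : normperfect D A ->
  basis_of (herm_space R N) (map (@reim R N) (o (pcone A))).
Proof.
move=> nA; have cA := pcone_cell N_gt0 nA.
rewrite -((rspan_full (cell_herm D_lt0 N_gt0 cA)).2 (dim_pcone D_lt0 N_gt0 nA)).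
exact: o_basis.
Qed.

Lemma size_herm_basis (b : seq 'M[R[i]]_N) :
  basis_of (herm_space R N) (map (@reim R N) b) -> size b = (N * N)%N.
Proof.
move=> bH; rewrite -(size_map (@reim R N)) -(size_basis (X := in_tuple _) bH).
by rewrite dim_herm_space.
Qed.

Lemma rsign_herm_basis (b b' : seq 'M[R[i]]_N) :
  basis_of (herm_space R N) (map (@reim R N) b) ->
  basis_of (herm_space R N) (map (@reim R N) b') ->
  exists p : R, [/\ p != 0, rsign b b' = sgz p & volume b' = p%:C * volume b].
Proof.
move=> bH bH'; have sb := size_herm_basis bH; have sb' := size_herm_basis bH'.
have [p e] : exists2 p : R, rsign b b' = sgz p &
    volume (b' ++ [::]) = p%:C * volume (b ++ [::]).
  apply: (rsign_volume bH); rewrite ?sb ?sb' ?addn0 //.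
  by move=> i ib; apply: (basis_mem bH'); rewrite map_f // mem_nth // sb'.
rewrite !cats0 => v; exists p; split=> //.
have := volume_neq0 bH'; rewrite v; apply: contra => /eqP ->.
by rewrite rmorph0 mul0r.
Qed.

(** All top-dimensional representatives are oriented alike ([o_top]), so comparing one of them with
    ([o t], normal) fixes the sign for all. When there is no representative, any nonzero [k]
    does. *)
Lemma wall_orientation t A0 A1 : wall D t A0 A1 ->
  exists2 k : int, k != 0 & forall A, normperfect D A -> pcone A \in Sstar top ->
    exists sigma : R, [/\ sigma != 0, sgz sigma = k &
      volume (o (pcone A)) = sigma%:C * volume (rcons (o t) (A1 - A0))].
Proof.
move=> W; have BH := basis_wall D_lt0 N_gt0 W (o_basis (wall_cell W)).
have [[B [nB BS]]|no] := pselect (exists B, normperfect D B /\ pcone B \in Sstar top);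
    last first.
  by exists 1 => // A nA AS; case: no; exists A.
have [p [p0 _ vB]] := rsign_herm_basis BH (rbasis_pcone nB).
exists (sgz p); first by rewrite sgz_eq0.
move=> A nA AS.
have [r [r0 er vA]] := rsign_herm_basis (rbasis_pcone nB) (rbasis_pcone nA).
rewrite o_top // in er.
exists (r * p); split; first by rewrite mulf_neq0.
  by rewrite sgzM -er mul1r.
by rewrite vA vB mulrA rmorphM.
Qed.

Definition weight (z : chains D Sstar rat top) (r : Sigma top) : rat :=
  z r * #|` fset_set (stab D (val r))|%:R.

Lemma Sigma_Sstar n (s : Sigma n) : val s \in Sstar n.
Proof. by have := valP s; rewrite !inE => /andP[]. Qed.

Lemma Sigma_orientable n (s : Sigma n) : orientable D (val s).
Proof. by have := valP s; rewrite !inE => /andP[_ /asboolP]. Qed.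

(** Only the representative of the orbit of [pcone B] receives translates; their number is the size
    of a transporter, a coset of its stabiliser, divided by |Stab t|. *)
Lemma sum_translates (z : chains D Sstar rat top) t B (r : Sigma top) :
  normperfect D B -> finite_set (stab D t) ->
  (forall h, stab D t h -> gact h @` pcone B = pcone B) ->
  cell_equiv D (val r) (pcone B) ->
  \sum_(s : Sigma top) z s * #|` fset_set (translates D t (pcone B) (val s))|%:R =
  weight z r / #|` fset_set (stab D t)|%:R.
Proof.
move=> nB ft tB rB; rewrite (bigD1 r) //= big1 ?addr0; last first.
  move=> s sr; suff -> : translates D t (pcone B) (val s) = set0.
    by rewrite fset_set0 cardfs0 mulr0.
  apply/seteqP; split=> // t' [g tg _]; exfalso; case/eqP: sr; apply: val_inj.
  have sB : cell_equiv D (val s) (pcone B).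
    by apply: cell_equiv_sym; apply/cell_equivE; exists g.
  have [x [_ ux]] := (reps top).2 _ (pcone_inner D_lt0 N_gt0 nB).
  by rewrite -(ux (val s)) ?(ux (val r)); [|split=> //; exact: Sigma_Sstar..].
rewrite /weight -mulrA; congr (_ * _).
have [A nA rE] := top_rep_form (Sigma_Sstar r).
have fA : finite_set (stab D (val r)).
  by rewrite rE; exact: (finite_pcone_maps D_lt0 nA nA).
have ftr : finite_set (transporter D (pcone B) (val r)).
  by rewrite rE; exact: (finite_pcone_maps D_lt0 nB nA).
have /cell_equivE[g tg] := cell_equiv_sym rB.
rewrite -(card_transporter fA tg) (card_transporter_translates ftr ft tB).
rewrite natrM mulfK // pnatr_eq0 -lt0n cardfs_gt0; apply/fset0Pn.
by exists 1%:M; rewrite in_fset_set // inE; exact: transporter1.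
Qed.

(** [k] is a sign over |Stab t| and does not depend on the chain, so it serves both for [xi] and for
    an arbitrary cycle. *)
Lemma boundary_wall (t : Sigma top.-1) A0 A1 : wall D (val t) A0 A1 ->
  exists2 k : rat, k != 0 & forall (z : chains D Sstar rat top) (r0 r1 : Sigma top),
    cell_equiv D (val r0) (pcone A0) -> cell_equiv D (val r1) (pcone A1) ->
    boundary o z t = k * (weight z r0 - weight z r1).
Proof.
move=> W; have n0 := wall_form0 W; have n1 := wall_form1 W.
have ot := @Sigma_orientable _ t; have bt := o_basis (wall_cell W).
have [k k0 kE] := wall_orientation W.
have st0 h : stab D (val t) h -> gact h @` pcone A0 = pcone A0.
  move=> th; case: (stab_wall D_lt0 N_gt0 W bt th) => -[e //].
  by rewrite (ot _ bt _ th) in e.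
have st1 h : stab D (val t) h -> gact h @` pcone A1 = pcone A1.
  move=> th; case: (stab_wall D_lt0 N_gt0 (wall_sym W) bt th) => -[e //].
  by rewrite (ot _ bt _ th) in e.
have ft : finite_set (stab D (val t)).
  apply: sub_finite_set (finite_pcone_maps D_lt0 n0 n0) => h th.
  by split; [exact: th.1 | exact: st0].
have t0 : #|` fset_set (stab D (val t))|%:R != 0 :> rat.
  rewrite pnatr_eq0 -lt0n cardfs_gt0; apply/fset0Pn.
  by exists 1%:M; rewrite in_fset_set // inE; exact: transporter1.
exists (k%:~R / #|` fset_set (stab D (val t))|%:R).
  by rewrite mulf_neq0 ?invr_neq0 // intr_eq0.
move=> z r0 r1 e0 e1; rewrite ffunE.
have -> : k%:~R / #|` fset_set (stab D (val t))|%:R * (weight z r0 - weight z r1) =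
    k%:~R * (weight z r0 / #|` fset_set (stab D (val t))|%:R -
             weight z r1 / #|` fset_set (stab D (val t))|%:R) by field.
rewrite -(sum_translates z n0 ft st0 e0) -(sum_translates z n1 ft st1 e1).
rewrite -sumrB big_distrr; apply: eq_bigr => s _ /=.
have [A nA sE] := top_rep_form (Sigma_Sstar s).
have AS : pcone A \in Sstar top by rewrite -sE Sigma_Sstar.
have [sigma [s0 sk vs]] := kE A nA AS.
rewrite sE (incidence_wall D_lt0 N_gt0 o_basis W ot nA s0 vs) sk.
by rewrite rmorphM rmorphB /= !pmulrn; ring.
Qed.

Lemma top_rep A : normperfect D A -> exists r : Sigma top, cell_equiv D (val r)
  (pcone A).
Proof.
move=> nA; have [x [[xS xA] _]] := (reps top).2 _ (pcone_inner D_lt0 N_gt0 nA).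
have [B nB xE] := top_rep_form xS.
have xSig : x \in Sigma top.
  by rewrite !inE xS /=; apply/asboolP; rewrite xE;
    exact: (orientable_pcone D_lt0 N_gt0 nB).
by exists [` xSig]%fset.
Qed.

Lemma top_rep_uniq A (r r' : Sigma top) : normperfect D A ->
  cell_equiv D (val r) (pcone A) -> cell_equiv D (val r') (pcone A) -> r = r'.
Proof.
move=> nA rA rA'; apply: val_inj.
have [x [_ ux]] := (reps top).2 _ (pcone_inner D_lt0 N_gt0 nA).
by rewrite -(ux (val r)) ?(ux (val r')); [|split=> //; exact: Sigma_Sstar..].
Qed.

Definition same_weight (z : chains D Sstar rat top) A B :=
  forall r r' : Sigma top, cell_equiv D (val r) (pcone A) ->
    cell_equiv D (val r') (pcone B) -> weight z r = weight z r'.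

Lemma same_weight_trans z A B G : normperfect D B ->
  same_weight z A B -> same_weight z B G -> same_weight z A G.
Proof.
move=> nB AB BG r r' rA rG; have [r1 rB] := top_rep nB.
by rewrite (AB r r1) // (BG r1 r').
Qed.

Lemma same_weight_refl z A : normperfect D A -> same_weight z A A.
Proof. by move=> nA r r' rA rA'; rewrite (top_rep_uniq nA rA rA'). Qed.

Lemma cycle_same_weight z A0 A1 : is_cycle o z ->
  inner_cell D top.-1 (pcone A0 `&` pcone A1) ->
  normperfect D A0 -> normperfect D A1 -> A0 <> A1 -> same_weight z A0 A1.
Proof.
move=> zc tin n0 n1 A01 r0 r1 e0 e1; set t := _ `&` _ in tin.
have [t' [[t'S /cell_equivE[g tg]] _]] := (reps top.-1).2 _ tin.
have [ct' dt' _] := (reps top.-1).1 _ t'S.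
have [B0 [B1 W]] : exists B0 B1, wall D t' B0 B1.
  by apply: codim1_wall => //; rewrite dt' sqrN_pred2.
have Gg := tg.1; have W' := wall_image D_lt0 N_gt0 W Gg; rewrite tg.2 in W'.
have m0 := wall_form0 W; have m1 := wall_form1 W.
have ip0 := image_pcone D_lt0 Gg m0; have ip1 := image_pcone D_lt0 Gg m1.
have key (q0 q1 : Sigma top) : cell_equiv D (val q0) (pcone B0) ->
    cell_equiv D (val q1) (pcone B1) -> weight z q0 = weight z q1.
  move=> h0 h1; have [ot|not] := pselect (orientable D t').
    have tS : t' \in Sigma top.-1 by rewrite !inE t'S /=; apply/asboolP.
    have [k k0 kE] := boundary_wall (t := [` tS]%fset) W.
    have := kE z q0 q1 h0 h1; rewrite zc ffunE => /esym/eqP.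
    by rewrite mulf_eq0 (negPf k0) subr_eq0 => /eqP.
  have [b [bt [h [th hb]]]] : exists b, rbasis t' b /\ exists h, stab D t' h /\
      rsign b (map (gact h) b) <> 1.
    apply: contrapT => no; apply: not => b bt h th; apply: contrapT => hb.
    by apply: no; exists b; split=> //; exists h.
  case: (stab_wall D_lt0 N_gt0 W bt th) => -[e hB]; first by case: hb.
  have -> // : q0 = q1; apply: (top_rep_uniq m1) => //.
  by apply: cell_equiv_trans h0 _; apply/cell_equivE; exists h; split;
    [exact: th.1 | exact: hB].
have eq_image B (q : Sigma top) A : A = form_act g B -> normperfect D B ->
    cell_equiv D (val q) (pcone A) -> cell_equiv D (val q) (pcone B).
  move=> -> nB qA; apply: (cell_equiv_trans qA); apply: cell_equiv_sym.
  by apply/cell_equivE; exists g; split;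
    [exact: Gg | exact: (image_pcone D_lt0 Gg nB)].
have s0 : t `<=` pcone A0 by move=> x [].
have s1 : t `<=` pcone A1 by move=> x [].
have [a0|a0] := wall_only W' n0 s0; have [a1|a1] := wall_only W' n1 s1.
- by case: A01; rewrite a0 a1.
- by apply: key; [exact: eq_image a0 m0 e0 | exact: eq_image a1 m1 e1].
- by apply/esym/key; [exact: eq_image a1 m0 e1 | exact: eq_image a0 m1 e0].
- by case: A01; rewrite a0 a1.
Qed.

End Boundary.

(** * Voronoi's algorithm *)

Lemma seq_min (T : eqType) (K : realDomainType) (f : T -> K) (s : seq T) :
  s != [::] -> exists2 x, x \in s & forall y, y \in s -> f x <= f y.
Proof.
elim: s => // a [|b s] IHs _; first by exists a; rewrite ?mem_head // => y;
  rewrite inE => /eqP ->.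
have [//|x xs xmin] := IHs; have [ax|xa] := leP (f a) (f x).
  exists a; first exact: mem_head.
  move=> y; rewrite inE => /orP[/eqP -> //|/xmin]; exact: le_trans.
exists x; first by rewrite inE xs orbT.
by move=> y; rewrite inE => /orP[/eqP -> |/xmin //]; exact: ltW.
Qed.

Section Ryshkov.
Variables (R : realType) (D : int) (N : nat).
Hypotheses (D_lt0 : D < 0).
Implicit Types (A F G : 'M[R[i]]_N) (u v d x : 'cV[R[i]]_N).

Lemma hf1 d : hf 1%:M d = \sum_i normsq (d i 0).
Proof.
rewrite hfE /hform mulmx1 mxE Re_sum; apply: eq_bigr => i _.
by rewrite !mxE mulrC -normsqE.
Qed.

Lemma posdef1 : posdef (1%:M : 'M[R[i]]_N).
Proof.
apply: posdefP => [|d d0]; first by apply/hermP; rewrite trmxC1.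
rewrite hf1 lt_def sumr_ge0 => [|i _]; last exact: normsq_ge0.
rewrite andbT; apply: contra d0.
rewrite psumr_eq0 => [/allP h|i _]; last exact: normsq_ge0.
apply/eqP/matrixP => i j; rewrite (ord1 j) mxE; apply/eqP; rewrite -normsq_eq0.
by apply: h; rewrite mem_index_enum.
Qed.

Lemma approximate_multiple u (eps : R) : 0 < eps -> u != 0 ->
  exists k : nat, exists d, [/\ (0 < k)%N, hf 1%:M d <= eps,
    intmx D (d + k%:R *: u) & d + k%:R *: u != 0].
Proof.
move=> e0 u0; have [i ui] : exists i, u i 0 != 0.
  apply: contrapT => /forallNP h; case/eqP: u0; apply/matrixP => i j.
  by rewrite (ord1 j) mxE; apply/eqP/negPn/negP/h.
have nu : 0 < normsq (u i 0) by rewrite lt_def normsq_eq0 ui normsq_ge0.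
(* The first bound, summed over the [N] coordinates, gives [eps]; the second keeps coordinate i,
   where u_i is nonzero, from being approximated by 0. *)
pose eps' := Num.min (eps / N%:R) (normsq (u i 0) / 2).
have N0 : (0 < N)%N by exact: leq_ltn_trans (ltn_ord i).
have e'0 : 0 < eps' by rewrite lt_min !divr_gt0 // ltr0n.
have [x ix [k k0 xk]] := dirichlet D_lt0 u e'0.
exists k, (x - k%:R *: u); rewrite subrK; split=> //.
  rewrite hf1; apply: le_trans (_ : \sum_(j < N) eps / N%:R <= _).
    apply: ler_sum => j _; rewrite !mxE; apply: le_trans (xk j) _.
    by rewrite ge_min lexx.
  by rewrite sumr_const card_ord -[_ *+ _]mulr_natr divfK // pnatr_eq0 -lt0n.
apply: contraL (xk i) => /eqP ->; rewrite -ltNge mxE sub0r.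
have -> : normsq (- (k%:R * u i 0)) = k%:R ^+ 2 * normsq (u i 0).
  have -> : - (k%:R * u i 0) = (- k%:R : R)%:C * u i 0.
    by rewrite rmorphN rmorph_nat mulNr.
  by rewrite normsqM /normsq /=; ring.
have : 1 <= k%:R ^+ 2 :> R by rewrite -natrX ler1n expn_gt0 k0.
rewrite /eps' gt_min => k1; apply/orP; right; nra.
Qed.

(* Minkowski-type compactness: a form bounded below on the nonzero lattice
   vectors is positive definite, since some multiple of an isotropic or negative
   vector comes arbitrarily close to the lattice. *)
Lemma ryshkov_posdef A : A \is hermsymmx ->
  (forall v, intmx D v -> v != 0 -> 1 <= hf A v) -> posdef A.
Proof.
move=> hA A1; have [c c0 cA] := hf_bound A posdef1.
have small d : hf 1%:M d <= (c + c)^-1 -> hf A d < 1.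
  move=> hd; have h1 : hf A d <= c * hf 1%:M d by apply: le_trans (ler_norm _) (cA d).
  apply: le_lt_trans h1 _; rewrite mulrC -ltr_pdivlMr // div1r.
  by apply: le_lt_trans hd _; rewrite ltf_pV2 ?posrE ?addr_gt0 // ltrDl.
have cc0 : 0 < (c + c)^-1 by rewrite invr_gt0 addr_gt0.
have expand d u (k : nat) : hf A (d + k%:R *: u) =
    hf A d + k%:R * complex.Re (bform A d u) *+ 2 + k%:R ^+ 2 * hf A u.
  rewrite hfDZ //; have -> : (k%:R : R[i]) = (k%:R : R)%:C by rewrite rmorph_nat.
  by rewrite ReZ /normsq /= expr0n addr0.
have psd u : 0 <= hf A u.
  rewrite leNgt; apply/negP => Au.
  have u0 : u != 0 by apply/eqP => u0; move: Au;
    rewrite u0 hfE /hform mulmx0 mxE ltxx.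
  set a := - hf A u; have a0 : 0 < a by rewrite oppr_gt0.
  set K := hf 1%:M (A *m u); have K0 : 0 <= K by exact: hf_ge0 posdef1.
  (* The first bound gives A[d] < 1. The second, with Cauchy-Schwarz for the identity form, bounds
     the cross term by a/2, so that A[d + k u] < 1 + k a - k^2 a <= 1. *)
  pose eps := Num.min (c + c)^-1 ((a / 2) ^+ 2 / (K + 1)).
  have K1 : 0 < K + 1 by apply: ltr_wpDl.
  have e0 : 0 < eps by rewrite lt_min cc0 divr_gt0 // exprn_gt0 // divr_gt0.
  have [k [d [k0 hd ix x0]]] := approximate_multiple e0 u0.
  have := A1 _ ix x0; rewrite expand leNgt => /negP; apply.
  have Ad : hf A d < 1 by apply: small; apply: le_trans hd _; rewrite ge_min lexx.
  set b := complex.Re (bform A d u).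
  have b2 : b ^+ 2 <= (a / 2) ^+ 2.
    have bE : bform A d u = bform 1%:M d (A *m u) by rewrite /bform mulmx1 mulmxA.
    have : normsq (bform A d u) <= hf 1%:M d * K.
      rewrite bE; apply: cauchy_schwarz; first exact: posdef_herm posdef1.
      by move=> z; exact: hf_ge0 posdef1.
    have hd' : hf 1%:M d * (K + 1) <= (a / 2) ^+ 2.
      by rewrite -ler_pdivlMr //; apply: le_trans hd _; rewrite ge_min lexx orbT.
    have : b ^+ 2 <= normsq (bform A d u) by rewrite lerDl sqr_ge0.
    have := hf_ge0 d posdef1; nra.
  have ba : b <= a / 2.
    by rewrite leNgt; apply/negP => ab; have := b2;
      rewrite leNgt ltr_pXn2r ?ab ?nnegrE //; nra.
  have : 1 <= k%:R :> R by rewrite ler1n.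
  have -> : hf A u = - a by rewrite opprK.
  move: (k%:R) => kk k1; rewrite mulr2n.
  have kb : kk * b <= kk * (a / 2) by rewrite ler_wpM2l // (le_trans ler01).
  have ka : kk * a <= kk ^+ 2 * a.
    by rewrite ler_pM2r // expr2 ler_peMl // (le_trans ler01).
  lra.
(* An isotropic vector of a semidefinite form has zero cross terms, so A[d + k u] = A[d] < 1. *)
apply: posdefP => // u u0; rewrite lt_def psd andbT; apply/eqP => Au.
have [k [d [k0 hd ix x0]]] := approximate_multiple cc0 u0.
have := A1 _ ix x0; rewrite expand Au mulr0 addr0.
have : normsq (bform A d u) <= hf A d * hf A u by exact: cauchy_schwarz.
rewrite Au mulr0 => b0; have /eqP : normsq (bform A d u) = 0.
  by apply/eqP; rewrite eq_le b0 normsq_ge0.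
rewrite normsq_eq0 => /eqP ->; rewrite mulr0 mul0rn addr0 leNgt => /negP; apply.
exact: small.
Qed.

End Ryshkov.

(** * Neighbouring perfect forms *)

Section Neighbours.
Variables (R : realType) (D : int) (N : nat).
Hypotheses (D_lt0 : D < 0) (N_gt1 : (1 < N)%N).
Implicit Types (A B F G : 'M[R[i]]_N) (u v x : 'cV[R[i]]_N).
Local Notation pcone := (@pcone R D N).
Local Notation unitvec := (@unitvec R D N).

Let N_gt0 : (0 < N)%N. Proof. exact: ltnW. Qed.

(* The linear objective function minimised, over the forms that are at least 1
   on the nonzero lattice vectors, exactly at [B]. *)
Definition objective B A : R := \sum_(v <- fset_set (unitvec B)) hf A v.

Lemma objectiveD B A G : objective B (A + G) = objective B A + objective B G.
Proof. by rewrite -big_split; apply: eq_bigr => v _; rewrite hfD. Qed.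

Lemma objectiveZ B (r : R) A : objective B (r%:C *: A) = r * objective B A.
Proof. by rewrite big_distrr; apply: eq_bigr => v _; rewrite hfZ. Qed.

Lemma objective_lt0 B G : normperfect D B -> objective B G < 0 ->
  exists2 v, unitvec B v & hf G v < 0.
Proof.
move=> nB; have fB := finite_unitvec D_lt0 nB.
move=> h; apply: contrapT => no; move: h; apply/negP; rewrite -leNgt.
rewrite /objective big_seq; apply: sumr_ge0 => v; rewrite in_fset_set // inE => Bv.
by rewrite leNgt; apply/negP => Gv; apply: no; exists v.
Qed.

(* Among the directions that decrease the objective and stay in the cone of
   feasible directions at [A], such as [B - A], take one vanishing on as many
   minimal vectors as possible. If it were not determined up to a scalar by
   these zeros, it could be moved, at constant objective, to gain a zero. *)
Lemma facet_direction A B : normperfect D A -> normperfect D B -> A <> B ->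
  exists F, [/\ F \is hermsymmx, forall v, unitvec A v -> 0 <= hf F v,
    objective B F < 0 &
    forall G, G \is hermsymmx ->
      (forall v, unitvec A v -> hf F v = 0 -> hf G v = 0) ->
      exists c : R, G = c%:C *: F].
Proof.
move=> nA nB AB.
have hA := normperfect_herm nA; have hB := normperfect_herm nB.
have fA := finite_unitvec D_lt0 nA; have fB := finite_unitvec D_lt0 nB.
pose cand F := [/\ F \is hermsymmx, forall v, unitvec A v -> 0 <= hf F v &
  objective B F < 0].
pose zeros F := [fset v in fset_set (unitvec A) | hf F v == 0]%fset.
have ex0 : exists k, `[< exists2 F, cand F & #|` zeros F| = k >].
  exists #|` zeros (B - A)|; apply/asboolP; exists (B - A); last by [].
  split.
  - exact: hermB hB hA.
  - move=> v Av; rewrite hfB Av.2 subr_ge0.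
    exact: (normperfect_ge1 nB Av.1 (unitvec_neq0 Av)).
  (* On the minimal vectors of [B] the form [B - A] is nonpositive; a zero sum would make it vanish
     on all of them, hence A = B by perfection of [B]. *)
  - have le0 v : unitvec B v -> hf (B - A) v <= 0.
      move=> Bv; rewrite hfB Bv.2 subr_le0.
      exact: (normperfect_ge1 nA Bv.1 (unitvec_neq0 Bv)).
    have s0 : 0 <= objective B (A - B).
      rewrite /objective big_seq; apply: sumr_ge0 => v;
        rewrite in_fset_set // inE => Bv.
      by have := le0 v Bv; rewrite !hfB; lra.
    have -> : B - A = (-1)%:C *: (A - B) by rewrite -scaleCN1 opprB.
    rewrite objectiveZ mulN1r oppr_lt0 lt_def s0 andbT; apply/negP => /eqP e.
    apply: AB; apply/eqP; rewrite -subr_eq0; apply/eqP.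
    apply: (normperfect_ann nB (hermB hA hB)) => v Bv.
    move/eqP: e; rewrite /objective big_seq psumr_eq0.
      move=> /allP/(_ v); rewrite in_fset_set // mem_set //= => /(_ isT).
      by move/eqP.
    move=> u; rewrite in_fset_set // inE => Bu.
    by have := le0 u Bu; rewrite !hfB; lra.
have bnd k : `[< exists2 F, cand F & #|` zeros F| = k >] ->
    (k <= #|` fset_set (unitvec A)|)%N.
  move=> /asboolP[F _ <-]; apply: fsubset_leq_card.
  by apply/fsubsetP => v; rewrite !inE => /andP[].
case: (ex_maxnP ex0 bnd) => k /asboolP[F [hF F0 FB] Fk] kmax.
exists F; split=> // G hG GF; apply: contrapT => noc.
(* Removing a multiple of [F] brings the objective to 0 and keeps the zeros of [F]; the result is
   nonzero since [G] is not proportional to [F]. *)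
pose G' := G - (objective B G / objective B F)%:C *: F.
have hG' : G' \is hermsymmx by exact: hermB hG (hermZ _ hF).
have G'F v : unitvec A v -> hf F v = 0 -> hf G' v = 0.
  by move=> Av Fv; rewrite hfB hfZ Fv mulr0 subr0 GF.
have G'B : objective B G' = 0.
  rewrite /G' scaleCN1 objectiveD !objectiveZ mulN1r divfK ?subrr //.
  by rewrite lt_eqF.
have [v1 Av1 Gv1] : exists2 v, unitvec A v & hf G' v != 0.
  apply: contrapT => no; apply: noc; exists (objective B G / objective B F).
  apply/eqP; rewrite -subr_eq0; apply/eqP; apply: (normperfect_ann nA hG') => v Av.
  by apply/eqP/negPn/negP => h; apply: no; exists v.
have [H [hH HF HB [v2 Av2 Hv2]]] : exists H, [/\ H \is hermsymmx,
    forall v, unitvec A v -> hf F v = 0 -> hf H v = 0, objective B H = 0 &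
    exists2 v, unitvec A v & hf H v < 0].
  case: (ltP (hf G' v1) 0) => h; first by exists G'; split=> //; exists v1.
  exists ((-1)%:C *: G'); split.
  - exact: hermZ.
  - by move=> v Av Fv; rewrite hfZ G'F // mulr0.
  - by rewrite objectiveZ G'B mulr0.
  - by exists v1 => //; rewrite hfZ mulN1r oppr_lt0 lt_def Gv1.
pose neg := [seq v <- fset_set (unitvec A) | hf H v < 0].
have negE v : v \in neg -> unitvec A v /\ hf H v < 0.
  by rewrite mem_filter => /andP[-> ]; rewrite in_fset_set // inE.
have [|v0 v0n v0min] := @seq_min _ _ (fun v => hf F v / - hf H v) neg.
  have : v2 \in neg by rewrite mem_filter Hv2 in_fset_set // mem_set.
  by case: neg {negE}.
have [Av0 Hv0] := negE _ v0n.
(* Ratio test: the largest step along [H] that keeps all values nonnegative. It creates the zero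
   [v0] and keeps the old ones, against maximality. *)
set s := hf F v0 / - hf H v0 in v0min.
have s0 : 0 <= s by rewrite divr_ge0 ?F0 // oppr_ge0 ltW.
pose F' := F + s%:C *: H.
have cF' : cand F'.
  split; first exact: hermD hF (hermZ _ hH).
    move=> v Av; rewrite hfD hfZ; have [h|h] := leP 0 (hf H v).
      by rewrite addr_ge0 ?F0 // mulr_ge0.
    have vn : v \in neg by rewrite mem_filter h in_fset_set // mem_set.
    have := v0min v vn; rewrite ler_pdivlMr ?oppr_gt0 //.
    by rewrite mulrN; move: (s * _) => y; lra.
  by rewrite objectiveD objectiveZ HB mulr0 addr0.
have /kmax : `[< exists2 F, cand F & #|` zeros F| = #|` zeros F'| >].
  by apply/asboolP; exists F'.
rewrite leqNgt -Fk => /negP; apply; apply: fproper_ltn_card.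
rewrite fproperE.
apply/andP; split.
  apply/fsubsetP => v; rewrite !inE => /andP[];
    rewrite in_fset_set // inE => Av /eqP Fv.
  by rewrite mem_set //= hfD hfZ Fv HF // mulr0 addr0.
apply/fsubsetPn; exists v0; rewrite !inE in_fset_set // mem_set //=.
  rewrite hfD hfZ /s; apply/eqP; field.
  by rewrite lt_eqF.
by apply/eqP => Fv0; move: Hv0; rewrite HF // ltxx.
Qed.

(* [r] is the first parameter at which a new lattice vector takes the value 1. *)
Lemma normperfect_edge A F : normperfect D A -> F \is hermsymmx ->
  (forall v, unitvec A v -> 0 <= hf F v) ->
  (forall G, G \is hermsymmx ->
      (forall v, unitvec A v -> hf F v = 0 -> hf G v = 0) ->
      exists c : R, G = c%:C *: F) ->
  (exists2 v, intmx D v & hf F v < 0) ->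
  exists2 r : R, 0 < r & normperfect D (A + r%:C *: F).
Proof.
move=> nA hF F0 Fl [x0 ix0 Fx0]; have hA := normperfect_herm nA.
pose X := [set x : 'cV[R[i]]_N | intmx D x /\ hf F x < 0].
(* The parameter at which the value at x, decreasing from A[x] along [F], reaches 1. *)
pose rho x := (hf A x - 1) / - hf F x.
have rho_gt0 x : X x -> 0 < rho x.
  move=> [ix Fx]; rewrite divr_gt0 ?oppr_gt0 // subr_gt0 lt_def.
  have xn0 : x != 0 by apply/eqP => x0'; move: Fx;
    rewrite x0' hfE /hform mulmx0 mxE ltxx.
  rewrite (normperfect_ge1 nA ix xn0) andbT; apply/eqP => Ax.
  by have := F0 x (conj ix Ax); rewrite leNgt Fx.
have rhoE x (r : R) : X x -> hf (A + r%:C *: F) x = 1 + (rho x - r) * - hf F x.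
  by move=> [_ Fx]; rewrite hfD hfZ /rho mulrBl divfK ?oppr_eq0 ?lt_eqF //; ring.
have lbX : has_lbound (rho @` X) by exists 0 => _ [x Xx <-]; exact/ltW/rho_gt0.
have infX : has_inf (rho @` X) by split=> //; exists (rho x0); exists x0.
set r := inf (rho @` X).
have r_le x : X x -> r <= rho x by move=> Xx; apply: ge_inf => //; exists x.
have r0 : 0 <= r.
  apply: lb_le_inf; first by exists (rho x0), x0.
  by move=> _ [x Xx <-]; exact/ltW/rho_gt0.
set A' := A + r%:C *: F.
have hA' : A' \is hermsymmx by exact: hermD hA (hermZ _ hF).
have A'1 v : intmx D v -> v != 0 -> 1 <= hf A' v.
  move=> iv v0; have [h|h] := leP 0 (hf F v).
    rewrite hfD hfZ; apply: le_trans (normperfect_ge1 nA iv v0) _.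
    by rewrite lerDl mulr_ge0.
  have Xv : X v by [].
  by rewrite (rhoE _ r Xv) lerDl mulr_ge0 ?subr_ge0 ?r_le // oppr_ge0 ltW.
have pA' : posdef A' by exact: ryshkov_posdef A'1.
have [c c0 cF] := hf_bound F pA'.
(* [F] is bounded by c relative to [A'], so vectors whose parameter is within 1/(2c) of the infimum
   have value at most 2 under [A']. They are finitely many, and the infimum is attained. *)
pose e := c^-1 / 2; have e0 : 0 < e by rewrite divr_gt0 // invr_gt0.
have close x : X x -> rho x < r + e -> hf A' x <= 2.
  move=> Xx rx; have Ax := rhoE x r Xx; rewrite -/A' in Ax.
  have h1 : (rho x - r) * - hf F x <= e * (c * hf A' x).
    apply: ler_pM; rewrite ?subr_ge0 ?r_le ?oppr_ge0 ?(ltW Xx.2) //.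
      by rewrite lerBlDl ltW.
    by apply: le_trans (cF x); rewrite -normrN ler_norm.
  have h2 : e * (c * hf A' x) = hf A' x / 2 by rewrite /e; field; rewrite gt_eqF.
  have : hf A' x <= 1 + hf A' x / 2 by rewrite {1}Ax -h2 lerD2l.
  lra.
have [v Xv rv] : exists2 v, X v & rho v = r.
  have fS := finite_posdef_ball 2 D_lt0 pA'.
  pose near := [seq x <- fset_set [set x : 'cV[R[i]]_N | intmx D x /\ hf A' x <= 2] |
    hf F x < 0].
  have nearP x : X x -> rho x < r + e -> x \in near.
    move=> Xx rx; rewrite mem_filter Xx.2 in_fset_set // mem_set //=.
    by split; [exact: Xx.1 | exact: close].
  have nearX x : x \in near -> X x.
    by rewrite mem_filter => /andP[Fx]; rewrite in_fset_set // inE => -[].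
  have [|v vn vmin] := @seq_min _ _ rho near.
    have [_ [x Xx <-] rx] := inf_adherent e0 infX.
    by have := nearP x Xx rx; case: near {nearP nearX}.
  exists v; first exact: nearX.
  apply/eqP; rewrite eq_le r_le ?andbT; last exact: nearX.
  rewrite leNgt; apply/negP => rv.
  have d0 : 0 < Num.min e (rho v - r) by rewrite lt_min e0 subr_gt0.
  have [_ [x Xx <-]] := inf_adherent d0 infX;
    rewrite -/r -ltrBlDl lt_min => /andP[h1 h2].
  have /vmin : x \in near by apply: nearP => //; rewrite -ltrBlDl.
  by rewrite leNgt => /negP; apply; lra.
exists r; first by rewrite -rv rho_gt0.
split=> // G hG GA'.
(* The zeros of [F] among the minimal vectors of [A] stay minimal, so [G] is a multiple of [F]; it
   also vanishes at the new vector [v], where [F] is negative. *)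
have [|d GE] := Fl G hG.
  move=> x Ax Fx; apply: GA'; split; first exact: Ax.1.
  by rewrite hfD hfZ Fx mulr0 addr0 Ax.2.
have : hf G v = 0.
  apply: GA'; split; first exact: Xv.1.
  by rewrite (rhoE _ r Xv) rv subrr mul0r addr0.
rewrite GE hfZ => /eqP; rewrite mulf_eq0 (lt_eqF Xv.2) orbF => /eqP ->.
by rewrite rmorph0 scale0r.
Qed.

Lemma neighbour A B : normperfect D A -> normperfect D B -> A <> B ->
  exists A', [/\ normperfect D A', objective B A' < objective B A &
    inner_cell D (N ^ 2)%N.-1.-1 (pcone A `&` pcone A')].
Proof.
move=> nA nB AB; have [F [hF F0 FB Fl]] := facet_direction nA nB AB.
have [v1 Bv1 Fv1] := objective_lt0 nB FB.
have [r r0 nA'] := normperfect_edge nA hF F0 Fl (ex_intro2 _ _ v1 Bv1.1 Fv1).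
set A' := A + r%:C *: F in nA'; exists A'; split=> //.
  by rewrite objectiveD objectiveZ gtrDl pmulr_rlt0.
pose M := unitvec A `&` unitvec A'.
have ME v : M v <-> unitvec A v /\ hf F v = 0.
  split=> [[Av [_]]|[Av Fv]].
    rewrite hfD hfZ Av.2 => /eqP; rewrite -subr_eq0 addrC addKr mulf_eq0.
    by rewrite (gt_eqF r0) => /eqP.
  by split=> //; split; [exact: Av.1 | rewrite hfD hfZ Fv mulr0 addr0 Av.2].
have fM : finite_set M.
  by apply: sub_finite_set (finite_unitvec D_lt0 nA) => v [].
have M0 : ~ M 0 by move=> [/unitvecN0].
have tE : pcone A `&` pcone A' = perfect_cone M.
  have Pn : [set A; A'] `<=` @normperfect R D N by move=> _ [] ->.
  have := cell_pcone D_lt0 Pn (or_introl (erefl A)).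
  by rewrite !bigcap_setU !bigcap_set1.
have hM : perfect_cone M `<=` [set B | B \is hermsymmx].
  by move=> x; exact: perfect_cone_herm.
(* This makes the wall meet the positive definite matrices. For u orthogonal to [M], q(u) = c F; the
   objective is nonnegative on q(u) and negative on F, so c <= 0, while F >= 0 on the minimal
   vectors of [A]. Hence q(u) vanishes on them. *)
have spanM u : (forall v, M v -> (v^t* *m u) 0 0 = 0) -> u = 0.
  move=> uM; apply: q_eq0; apply: (normperfect_ann nA); first exact: herm_q.
  have hq v : hf (q u) v = normsq ((v^t* *m u) 0 0).
    by rewrite -ip_q ipC ip_q hf_q.
  have [|c cE] := Fl (q u) (herm_q u).
    by move=> v Av Fv; rewrite hq uM ?ME // /normsq /= !expr0n addr0.
  have c0 : c <= 0.
    have : 0 <= objective B (q u) by apply: sumr_ge0 => v _; rewrite hq normsq_ge0.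
    by rewrite cE objectiveZ nmulr_lge0.
  move=> v Av; apply/eqP; rewrite eq_le {2}hq normsq_ge0 andbT.
  by rewrite cE hfZ mulr_le0_ge0 // F0.
split.
- apply/(is_cellP D N_gt0); exists [set A; A']; split.
  + by exists A; left.
  + by move=> _ [] ->.
  + by rewrite !bigcap_setU !bigcap_set1.
- rewrite tE; apply: succn_inj; rewrite sqrN_pred2 //.
  apply/(dim_rspan_hyperplane hM); exists F; split=> //.
  + by apply/eqP => F00; move: Fv1; rewrite F00 hf0 ltxx.
  + by apply/(perfect_cone_ann F fM M0) => v /ME[].
  + move=> G hG /(perfect_cone_ann G fM M0) h; apply: Fl => // v Av Fv.
    by apply: h; apply/ME.
- have [v Mv] : exists v, M v.
    apply: contrapT => /forallNP no.
    have : (delta_mx (Ordinal N_gt0) 0 : 'cV[R[i]]_N) = 0 by apply: spanM => v /no.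
    by move/matrixP/(_ (Ordinal N_gt0) 0)/eqP; rewrite !mxE !eqxx oner_eq0.
  have pS := posdef_sum_q fM spanM.
  exists (\sum_(v <- fset_set M) q v); split=> //; rewrite tE.
  exact: (perfect_cone_sum_q N_gt0 fM Mv pS).
Qed.

End Neighbours.

(** * Connectedness of the perfect forms and the generating cycle *)

Section Connectedness.
Variables (R : realType) (D : int) (N : nat).
Hypotheses (D_lt0 : D < 0) (N_gt1 : (1 < N)%N).
Variables (Sstar : nat -> {fset set 'M[R[i]]_N})
  (o : set 'M[R[i]]_N -> seq 'M[R[i]]_N).
Hypothesis reps : forall n, cell_reps D n (Sstar n).
Hypothesis o_basis : forall c, is_cell D c -> rbasis c (o c).
Hypothesis o_top : forall c c',
  c \in Sstar (N ^ 2)%N.-1 -> c' \in Sstar (N ^ 2)%N.-1 ->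
  rsign (o c) (o c') = 1.
Implicit Types (A B g h : 'M[R[i]]_N).
Local Notation pcone := (@pcone R D N).
Local Notation top := (N ^ 2)%N.-1.
Local Notation Sigma := (Sigma D Sstar).

Let N_gt0 : (0 < N)%N. Proof. exact: ltnW. Qed.

(* There are finitely many classes of perfect forms, and a change of variables
   with bounded objective maps the minimal vectors of [B] into a finite set. *)
Lemma finite_objective_le B (c : R) : normperfect D B ->
  finite_set [set A | normperfect D A /\ objective D B A <= c].
Proof.
move=> nB; have fB := finite_unitvec D_lt0 nB.
pose form s : 'M[R[i]]_N := xget 0 [set A | normperfect D A /\ s = pcone A].
pose maps s := [set h : 'M[R[i]]_N | forall v, unitvec D B v ->
  [set x : 'cV[R[i]]_N | intmx D x /\ hf (form s) x <= c] (h *m v)].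
have formP s : s \in Sstar top -> normperfect D (form s) /\ s = pcone (form s).
  move=> /(top_rep_form D_lt0 N_gt1 reps)[A nA sE].
  by apply: (@xgetPex _ _ [set A | normperfect D A /\ s = pcone A]); exists A.
apply: (@sub_finite_set _ _ (\bigcup_(s in [set` Sstar top])
  ((fun h => form_act (invmx h) (form s)) @` maps s))); last first.
  apply: bigcup_finite => [|s sS]; first exact: finite_fset.
  have [nF _] := formP s sS.
  apply: finite_image; apply: (finite_mulmx_set fB).
    exact: (finite_posdef_ball _ D_lt0 (normperfect_posdef nF)).
  by move=> u; exact: (ortho_unitvec nB).
move=> A [nA Ac]; have [x [[xS /cell_equivE[g [Gg gx]]] _]] :=
  (reps top).2 _ (pcone_inner D_lt0 N_gt0 nA).
have [nF xE] := formP x xS.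
have AE : A = form_act g (form x).
  apply: (pcone_inj D_lt0 nA (normperfect_form_act Gg nF)).
  by rewrite -(image_pcone D_lt0 Gg nF) -gx -xE.
exists x => //; exists (invmx g); last by rewrite invmxK.
move=> v Bv; split; first by apply: intmxM; [case: Gg | exact: Bv.1].
have -> : hf (form x) (invmx g *m v) = hf A v by rewrite {1}AE hf_form_act.
apply: le_trans Ac; rewrite /objective (big_fsetD1 v) /=; last first.
  by rewrite in_fset_set ?mem_set.
rewrite lerDl big_seq sumr_ge0 // => u _; exact: hf_ge0 (normperfect_posdef nA).
Qed.

(** Induction on the number of perfect forms whose objective is smaller than that of [A]: the
    neighbour is counted for [A] but not for itself. *)
Lemma cycle_same_weight_all (z : chains D Sstar rat top) A B :
  is_cycle o z -> normperfect D A -> normperfect D B -> same_weight z A B.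
Proof.
move=> zc nA nB;
  pose below A := [set A' | normperfect D A' /\ objective D B A' < objective D B A].
have fbelow A' : finite_set (below A').
  apply: sub_finite_set (finite_objective_le (objective D B A') nB) => G [nG /ltW].
  by split.
have [n] := ubnP #|` fset_set (below A)|; elim: n A nA => // n IHn A nA An.
have [->|/eqP AB] := eqVneq A B;
  first exact: (@same_weight_refl _ _ _ D_lt0 N_gt1 _ reps z B nB).
have [A' [nA' lt cAA']] := neighbour D_lt0 N_gt1 nA nB AB.
have AA' : A <> A' by move=> e; move: lt; rewrite e ltxx.
have w1 := cycle_same_weight D_lt0 N_gt1 reps o_basis o_top zc cAA' nA nA' AA'.
apply: (same_weight_trans D_lt0 N_gt1 reps nA' w1); apply: (IHn _ nA').
rewrite ltnS in An; apply: (leq_trans _ An); apply: fproper_ltn_card;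
  rewrite fproperE; apply/andP; split.
  rewrite -fset_set_sub // => G [nG GA']; split=> //; exact: lt_trans lt.
apply/fsubsetPn; exists A'; rewrite in_fset_set //; first by rewrite inE.
by apply/negP; rewrite inE => -[_]; rewrite ltxx.
Qed.

Lemma weight_xi (r : Sigma top) : weight (xi D Sstar) r = 1.
Proof.
have [A nA rE] := top_rep_form D_lt0 N_gt1 reps (Sigma_Sstar r).
have fr : finite_set (stab D (val r)) by rewrite rE;
  exact: (finite_pcone_maps D_lt0 nA nA).
rewrite /weight ffunE mulVf // pnatr_eq0 -lt0n cardfs_gt0; apply/fset0Pn.
by exists 1%:M; rewrite in_fset_set // inE; exact: transporter1.
Qed.

Lemma xi_cycle : is_cycle o (xi D Sstar).
Proof.
apply/ffunP => t; have [ct dt _] := (reps top.-1).1 _ (Sigma_Sstar t).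
have [A0 [A1 W]] : exists A0 A1, wall D (val t) A0 A1.
  by apply: (codim1_wall D_lt0 N_gt0 ct); rewrite dt sqrN_pred2.
have [k _ kE] := boundary_wall D_lt0 N_gt1 reps o_basis o_top W.
have [r0 e0] := top_rep D_lt0 N_gt1 reps (wall_form0 W).
have [r1 e1] := top_rep D_lt0 N_gt1 reps (wall_form1 W).
by rewrite (kE _ r0 r1) // !weight_xi subrr mulr0 ffunE.
Qed.

Lemma xi_generates : generates_homology o (xi D Sstar).
Proof.
split=> [|z zc]; first exact: xi_cycle.
have b0 : boundary o (0 : chains D Sstar rat top.+1) = 0.
  by apply/ffunP => t; rewrite !ffunE big1 // => s _; rewrite ffunE mul0r.
(* Without top-dimensional representatives the chain group is 0. Otherwise all weights of [z] agree
   and those of [xi] are 1, so the common weight is the coefficient and the boundary term is 0. *)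
have [[r0 _]|no] := pselect (exists r : Sigma top, True); last first.
  by exists 0, 0; rewrite b0; apply/ffunP => s; case: no; exists s.
exists (weight z r0), 0; rewrite b0 addr0; apply/ffunP => s.
have [A nA sE] := top_rep_form D_lt0 N_gt1 reps (Sigma_Sstar s).
have [B nB rE] := top_rep_form D_lt0 N_gt1 reps (Sigma_Sstar r0).
have refl (r : Sigma top) : cell_equiv D (val r) (val r).
  by apply/cell_equivE; exists 1%:M; exact: transporter1.
have <- : weight z s = weight z r0.
  by apply: (cycle_same_weight_all zc nA nB); rewrite -?sE -?rE.
have := weight_xi s; rewrite /weight !ffunE /= => h.
by rewrite -[LHS]mulr1 -[X in _ * X = _]h -[RHS]/(_ * _) [RHS]mulrAC mulrA.
Qed.

End Connectedness.

Theorem theorem5p1 (R : realType) (N : nat) (D : int)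
  (hND : (N = 3%N /\ fundamental_discriminant D /\ -24 <= D < 0) \/
         (N = 4%N /\ (D = -3 \/ D = -4)))
  (Sstar : nat -> {fset set 'M[R[i]]_N})
  (hSstar : forall n : nat, cell_reps D n (Sstar n))
  (o : set 'M[R[i]]_N -> seq 'M[R[i]]_N)
  (ho : forall c : set 'M[R[i]]_N, is_cell D c -> rbasis c (o c))
  (* every top-dimensional cell spans H^N(C), which carries one orientation *)
  (htop : forall c c' : set 'M[R[i]]_N,
     c \in Sstar (N ^ 2)%N.-1 -> c' \in Sstar (N ^ 2)%N.-1 ->
     rsign (o c) (o c') = 1) :
  is_cycle o (xi D Sstar) /\ generates_homology o (xi D Sstar).
Proof.
have [D_lt0 N_gt1] : D < 0 /\ (1 < N)%N.
  by case: hND => [[-> [_ /andP[_ ->]]]|[-> [->|->]]].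
by split; [exact: xi_cycle | exact: xi_generates].
Qed.
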